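(* Let $\lambda$ be a dominant integral weight of $\mathfrak{sp}_{2n}$. For every point $\mathbf{d}\in\mathcal{K}_{2n}$, the set $\{f^{\mathbf{s}}_{\mathbf{d}}\cdot\nu^{\mathbf{d}}_{\lambda}\mid\mathbf{s}\in S(\lambda)\}$ forms a basis of $V_{\lambda}^{\mathbf{d}}$.
   Context: Lie algebra. Fix $n\geq1$ and $\overline{i}:=2n+1-i$ for $1\leq i\leq2n$; rows and columns of $2n\times2n$ matrices are indexed by $1<\ldots<n<\overline{n}<\ldots<\overline{1}$. Let $S$ be the $n\times n$ matrix with $1$ on the anti-diagonal and $0$ elsewhere, $M=\begin{pmatrix}0&S\\-S&0\end{pmatrix}$, $\mathfrak{sp}_{2n}=\{X\in\mathfrak{gl}_{2n}(\mathbb{C})\mid X^tM+MX=0\}=\mathfrak{n}_+\oplus\mathfrak{h}\oplus\mathfrak{n}_-$ (strictly upper triangular, diagonal, strictly lower triangular). Simple roots $\alpha_1,\ldots,\alpha_n$, fundamental weights $\omega_1,\ldots,\omega_n$. Positive roots $\Phi^+$: $\alpha_{i,j}=\alpha_i+\ldots+\alpha_j$ ($1\leq i\leq j\leq n$) and $\alpha_{i,\overline{j}}=\alpha_i+\ldots+\alpha_n+\alpha_{n-1}+\ldots+\alpha_j$ ($1\leq i\leq j<n$); also $\alpha_{i,\overline{n}}:=\alpha_{i,n}$. Root vectors of weight $-\beta$ (with $f_{i,j}=f_{\alpha_{i,j}}$): $f_{i,\overline{i}}=E_{\overline{i},i}$; $f_{i,j}=E_{j+1,i}-E_{\overline{i},\overline{j+1}}$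 for $1\leq i\leq j<n$; $f_{i,\overline{j}}=E_{\overline{j},i}+E_{\overline{i},j}$ for $1\leq i<j\leq n$. For a dominant integral weight $\lambda$, $V_\lambda=U(\mathfrak{n}_-)\cdot\nu_\lambda$ is the irreducible representation with highest weight vector $\nu_\lambda$. An enumeration $\Phi^+=\{\beta_1,\ldots,\beta_N\}$ is fixed and $f^{\mathbf{s}}:=f_{\beta_1}^{s_{\beta_1}}\cdots f_{\beta_N}^{s_{\beta_N}}$ for $\mathbf{s}\in\mathbb{N}^{\Phi^+}$. The cone $\mathcal{K}_{2n}\subseteq\mathbb{R}^{\Phi^+}$ consists of the $\mathbf{d}$ (write $d_{i,j}=\mathbf{d}(\alpha_{i,j})$, $d_{i,\overline{n}}=d_{i,n}$) such that: $d_{i,i}+d_{i+1,i+1}\geq d_{i,i+1}$ for $1\leq i\leq n-1$; $d_{i,j}+d_{i+1,j+1}\geq d_{i,j+1}+d_{i+1,j}$ for $1\leq i<j\leq n-1$; $d_{i,\overline{j+1}}+d_{i+1,\overline{j}}\geq d_{i,\overline{j}}+d_{i+1,\overline{j+1}}$ for $1\leq i<j\leq n-1$; $2d_{i,\overline{i+1}}\geq d_{i,\overline{i}}+d_{i+1,\overline{i+1}}$ for $1\leq i\leq n-1$. Filtrations. For $\mathbf{d}\in\mathcal{K}_{2n}$ and $m\in\mathbb{R}$, $(\mathfrak{n}_-)^{\mathbf{d}}_{\leq m}=\mathrm{span}\{f_{\beta}\mid\mathbf{d}(\beta)\leq m\}$ and $U(\mathfrak{n}_-)^{\mathbf{d}}_{\leq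 m}=\mathrm{span}\{f_{\gamma_1}\cdots f_{\gamma_l}\mid l\ge 0,\ \gamma_i\in\Phi^+,\ \mathbf{d}(\gamma_1)+\ldots+\mathbf{d}(\gamma_l)\leq m\}$; with $<m$ similarly. These are filtrations of a Lie algebra and of an algebra; the associated graded objects are $\mathfrak{n}_-^{\mathbf{d}}$ and $U(\mathfrak{n}_-)^{\mathbf{d}}\cong U(\mathfrak{n}_-^{\mathbf{d}})$. Set $(V_\lambda)^{\mathbf{d}}_{\leq m}=U(\mathfrak{n}_-)^{\mathbf{d}}_{\leq m}\cdot\nu_\lambda$, $(V_\lambda)^{\mathbf{d}}_{<m}=U(\mathfrak{n}_-)^{\mathbf{d}}_{<m}\cdot\nu_\lambda$, and $V_\lambda^{\mathbf{d}}=\bigoplus_{m\in\mathbb{R}}(V_\lambda)^{\mathbf{d}}_{\leq m}/(V_\lambda)^{\mathbf{d}}_{<m}$, a cyclic graded $U(\mathfrak{n}_-^{\mathbf{d}})$-module generated by the class $\nu_\lambda^{\mathbf{d}}$ of $\nu_\lambda$. $f^{\mathbf{s}}_{\mathbf{d}}$ is the class of $f^{\mathbf{s}}$ in $U(\mathfrak{n}_-)^{\mathbf{d}}$ (in degree $\sum_\beta s_\beta\mathbf{d}(\beta)$). FFLV polytope. A symplectic Dyck path is a sequence $(p(0),\ldots,p(k))$, $k\geq0$, of positive roots such that $p(0)$ is simple; $p(k)$ is simple or equals $\alpha_{j,\overline{j}}$ for some $1\leq j<n$; and if $p(s)=\alpha_{p,q}$ then $p(s+1)\in\{\alpha_{p,q+1},\alpha_{p+1,q}\}$,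 where $q+1$ is the successor of $q$ in $1<\ldots<n<\overline{n-1}<\ldots<\overline{1}$. For $\lambda=\sum m_i\omega_i$, $\mathrm{FFLV}(\lambda)\subset\mathbb{R}^{\Phi^+}$ is defined by $x_\beta\geq0$ and, for each symplectic Dyck path, $x_{p(0)}+\ldots+x_{p(k)}\leq m_i+\ldots+m_j$ if $p(0)=\alpha_i$, $p(k)=\alpha_j$, and $\leq m_i+\ldots+m_n$ if $p(0)=\alpha_i$, $p(k)=\alpha_{j,\overline{j}}$. $S(\lambda)$ is the set of its integral points. *)

(* Defs.v *)
From HB Require Import structures.
From mathcomp Require Import all_boot all_order all_algebra.
From mathcomp Require Import finmap.
From mathcomp Require Import boolp classical_sets functions cardinality fsbigop.
From mathcomp Require Import reals.
From mathcomp Require Import complex.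
From mathcomp Require Import monalg.
From mathcomp Require Import zify.

Set Implicit Arguments.
Unset Strict Implicit.
Unset Printing Implicit Defensive.

Import Order.TTheory GRing.Theory Num.Theory.

Local Open Scope classical_set_scope.
Local Open Scope quotient_scope.
Local Open Scope ring_scope.

Section Subspaces.
Variables (K : fieldType) (V : lmodType K).

Record subspace := Subspace {
  subspace_pred :> {pred V};
  subspaceP : submod_closed subspace_pred }.

Definition span_pred (A : set V) : {pred V} := [pred v |
  `[< exists k (c : 'I_k -> K) (w : 'I_k -> V),
        (forall i, A (w i)) /\ v = \sum_i c i *: w i >]].

Lemma span_closed A : submod_closed (span_pred A).
Proof.
split.
  apply/asboolP; exists 0%N, (fun=> 0), (fun=> 0).
  by split=> [[]//|]; rewrite big_ord0.
move=> a u v /asboolP[k [c [w [Aw ->]]]].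
move=> /asboolP[l [c' [w' [Aw' ->]]]]; apply/asboolP.
exists (k + l)%N, (fun i => match fintype.split i with inl i => a * c i | inr i => c' i end),
  (fun i => match fintype.split i with inl i => w i | inr i => w' i end).
split=> [i|]; first by case: fintype.split.
rewrite big_split_ord /= scaler_sumr; congr (_ + _); apply: eq_bigr => i _.
  by rewrite (unsplitK (inl i)) scalerA.
by rewrite (unsplitK (inr i)).
Qed.

Definition span A := Subspace (span_closed A).

Lemma span_mem (A : set V) v : A v -> v \in span A.
Proof.
move=> Av; apply/asboolP; exists 1%N, (fun=> 1), (fun=> v).
by split=> //; rewrite big_ord1 scale1r.
Qed.

End Subspaces.

HB.instance Definition _ (K : fieldType) (V : lmodType K) (W : subspace V) :=
  GRing.isSubmodClosed.Build K V (subspace_pred W) (subspaceP W).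

Lemma span_ind (K : fieldType) (V : lmodType K) (A : set V) (W : subspace V) :
  (forall v, A v -> v \in W) -> {subset span A <= W}.
Proof.
move=> AW v /asboolP[k [c [w [Aw ->]]]].
by apply: rpred_sum => i _; apply: rpredZ; apply: AW.
Qed.

Section QuotientSpace.
Variables (K : fieldType) (V : lmodType K) (W : subspace V).

Definition quotspace := Quotient.quot W.
HB.instance Definition _ := Choice.on quotspace.
HB.instance Definition _ := GRing.Zmodule.on quotspace.
HB.instance Definition _ := EqQuotient.on quotspace.

Definition qcls (v : V) : quotspace := \pi_(Quotient.quot W) v.

Lemma qclsP u v : reflect (qcls u = qcls v) (u - v \in W).
Proof. by rewrite Quotient.idealrBE; apply: eqP. Qed.

Lemma qclsD : {morph qcls : u v / u + v}.
Proof. by move=> u v; rewrite /qcls !piE. Qed.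

Lemma qclsK (x : quotspace) : qcls (repr x) = x.
Proof. exact: reprK. Qed.

Lemma qcls0 v : (qcls v == 0) = (v \in W).
Proof. by rewrite -[v in RHS]subr0 Quotient.idealrBE /qcls !piE. Qed.

Definition qscale (a : K) (x : quotspace) := qcls (a *: repr x).

Lemma qclsZ a v : qcls (a *: v) = qscale a (qcls v).
Proof.
apply/qclsP; rewrite -scalerBr rpredZ //; apply/qclsP.
by rewrite qclsK.
Qed.

Fact qscalerA a b x : qscale a (qscale b x) = qscale (a * b) x.
Proof. by rewrite -[x]qclsK -!qclsZ scalerA. Qed.
Fact qscale1r : left_id 1 qscale.
Proof. by move=> x; rewrite -[x]qclsK -qclsZ scale1r. Qed.
Fact qscalerDr : right_distributive qscale +%R.
Proof.
move=> a x y; rewrite -[x]qclsK -[y]qclsK.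
by rewrite -qclsD -!qclsZ scalerDr qclsD.
Qed.
Fact qscalerDl x : {morph qscale^~ x : a b / a + b}.
Proof. by move=> a b; rewrite -[x]qclsK -!qclsZ scalerDl qclsD. Qed.

HB.instance Definition _ := GRing.Zmodule_isLmodule.Build K quotspace
  qscalerA qscale1r qscalerDr qscalerDl.

Fact qcls_is_linear : linear qcls.
Proof. by move=> a u v; rewrite qclsD qclsZ. Qed.

HB.instance Definition _ := GRing.isLinear.Build K V quotspace _ qcls
  qcls_is_linear.

End QuotientSpace.

Section QuotientAlgebra.
Variables (K : fieldType) (A : algType K).

Record ideal := Ideal {
  ideal_space :> subspace A;
  idealM : forall u t v, t \in ideal_space -> u * t * v \in ideal_space;
  ideal1 : 1 \notin ideal_space }.

Variable I : ideal.

Definition quotalg := quotspace I.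
HB.instance Definition _ := Choice.on quotalg.
HB.instance Definition _ := GRing.Lmodule.on quotalg.

Definition qacls (u : A) : quotalg := qcls I u.

HB.instance Definition _ := GRing.isLinear.Build K A quotalg _ qacls
  (@qcls_is_linear K A I).

Lemma qaclsK x : qacls (repr x) = x.
Proof. exact: qclsK. Qed.

Definition qamul : quotalg -> quotalg -> quotalg :=
  locked (fun x y => qacls (repr x * repr y)).

Fact qaclsM : {morph qacls : u v / u * v >-> qamul u v}.
Proof.
move=> u v; rewrite /qamul -lock; apply/qclsP.
have Eu : u - repr (qacls u) \in ideal_space I by apply/qclsP; rewrite qclsK.
have Ev : v - repr (qacls v) \in ideal_space I by apply/qclsP; rewrite qclsK.
rewrite -[u * v](subrK (repr (qacls u) * v)) -mulrBl -addrA -mulrBr.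
apply: rpredD; first by rewrite -[_ * v]mul1r mulrA idealM.
by rewrite -[_ * (v - _)]mulr1 idealM.
Qed.

Fact qamulA : associative qamul.
Proof.
by move=> x y z; rewrite -[x]qaclsK -[y]qaclsK -[z]qaclsK -!qaclsM mulrA.
Qed.
Fact qamul1 : left_id (qacls 1) qamul.
Proof. by move=> x; rewrite -[x]qaclsK -qaclsM mul1r. Qed.
Fact qamul1r : right_id (qacls 1) qamul.
Proof. by move=> x; rewrite -[x]qaclsK -qaclsM mulr1. Qed.
Fact qamulDl : left_distributive qamul +%R.
Proof.
move=> x y z; rewrite -[x]qaclsK -[y]qaclsK -[z]qaclsK.
by rewrite -raddfD -!qaclsM mulrDl raddfD.
Qed.
Fact qamulDr : right_distributive qamul +%R.
Proof.
move=> x y z; rewrite -[x]qaclsK -[y]qaclsK -[z]qaclsK.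
by rewrite -raddfD -!qaclsM mulrDr raddfD.
Qed.
Fact qa1_neq0 : qacls 1 != 0.
Proof. by rewrite [_ == _]qcls0 ideal1. Qed.

HB.instance Definition _ := GRing.Zmodule_isNzRing.Build quotalg
  qamulA qamul1 qamul1r qamulDl qamulDr qa1_neq0.

Fact qa_scalerAl (a : K) (x y : quotalg) : a *: (x * y) = a *: x * y.
Proof.
rewrite -[x]qaclsK -[y]qaclsK.
rewrite -[LHS]/(a *: qamul (qacls _) (qacls _)).
rewrite -[RHS]/(qamul (a *: qacls _) (qacls _)).
by rewrite -qaclsM -!linearZ -qaclsM scalerAl.
Qed.
HB.instance Definition _ := GRing.Lmodule_isLalgebra.Build K quotalg qa_scalerAl.

Fact qa_scalerAr (a : K) (x y : quotalg) : a *: (x * y) = x * (a *: y).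
Proof.
rewrite -[x]qaclsK -[y]qaclsK.
rewrite -[LHS]/(a *: qamul (qacls _) (qacls _)).
rewrite -[RHS]/(qamul (qacls _) (a *: qacls _)).
by rewrite -qaclsM -!linearZ -qaclsM scalerAr.
Qed.
HB.instance Definition _ := GRing.Lalgebra_isAlgebra.Build K quotalg qa_scalerAr.

Fact qacls_is_monoid_morphism : monoid_morphism qacls.
Proof. by split=> // u v; rewrite qaclsM. Qed.
HB.instance Definition _ := GRing.isMonoidMorphism.Build A quotalg qacls
  qacls_is_monoid_morphism.

End QuotientAlgebra.

Section GeneratedIdeal.
Variables (K : fieldType) (A : algType K) (rel : A -> Prop).

Definition gen_ideal_space : subspace A :=
  span [set t | exists u r v, rel r /\ t = u * r * v].

Lemma gen_idealM (u t v : A) :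
  t \in gen_ideal_space -> u * t * v \in gen_ideal_space.
Proof.
move=> /asboolP[l [c [w [Aw ->]]]].
rewrite mulr_sumr mulr_suml; apply: rpred_sum => i _.
rewrite -scalerAr -scalerAl; apply: rpredZ.
have [u' [r [v' [rr ->]]]] := Aw i; apply: span_mem.
by exists (u * u'), r, (v' * v); rewrite !mulrA.
Qed.

Section Augmented.
Variable phi : {linear A -> K | *%R}.
Hypotheses (phiM : {morph phi : u v / u * v}) (phi1 : phi 1 = 1).

Lemma gen_ideal_proper :
  (forall r, rel r -> phi r = 0) -> 1 \notin gen_ideal_space.
Proof.
move=> phi0; apply/negP => /asboolP[l [c [w [Aw /(congr1 phi)]]]].
rewrite phi1 linear_sum big1 => [/eqP|i _]; first by rewrite oner_eq0.
have [u [r [v [rr ->]]]] := Aw i.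
by rewrite linearZ /= !phiM (phi0 r) // mulr0 mul0r mulr0.
Qed.

Lemma augment_linear_rel a x y z : phi x = 0 -> phi y = 0 -> phi z = 0 ->
  phi (z - (a *: x + y)) = 0.
Proof.
by move=> x0 y0 z0; rewrite linearB linearP /= x0 y0 z0 mulr0 addr0 subr0.
Qed.

Lemma augment_bracket_rel x y z : phi x = 0 -> phi y = 0 -> phi z = 0 ->
  phi (z - (x * y - y * x)) = 0.
Proof.
by move=> x0 y0 z0; rewrite !linearB /= !phiM x0 y0 z0 mulr0 !subr0.
Qed.

End Augmented.
End GeneratedIdeal.

Section FreeAlgebra.
Variables (K : fieldType) (X : choiceType).

Definition freealg := {malg K[{fmonom X}]}.
HB.instance Definition _ := Choice.on freealg.
HB.instance Definition _ := GRing.Lmodule.on freealg.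

(* The product of {malg _[_]} is locked: otherwise unification unfolds it. *)
Definition free_mul : freealg -> freealg -> freealg :=
  locked (fun u v : {malg K[{fmonom X}]} => u * v).

Lemma free_mulE : free_mul = fun u v : {malg K[{fmonom X}]} => u * v.
Proof. by rewrite /free_mul -lock. Qed.

Definition free_one : freealg := 1 : {malg K[{fmonom X}]}.

Definition free_gen (x : X) : freealg := << fmu x >>.

Fact free_mulA : associative free_mul.
Proof. by rewrite free_mulE => x y z; apply: mulrA. Qed.
Fact free_mul1 : left_id free_one free_mul.
Proof. by rewrite free_mulE => x; apply: mul1r. Qed.
Fact free_mul1r : right_id free_one free_mul.
Proof. by rewrite free_mulE => x; apply: mulr1. Qed.
Fact free_mulDl : left_distributive free_mul +%R.
Proof. by rewrite free_mulE => x y z; apply: mulrDl. Qed.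
Fact free_mulDr : right_distributive free_mul +%R.
Proof. by rewrite free_mulE => x y z; apply: mulrDr. Qed.
Fact free_one_neq0 : free_one != 0.
Proof. exact: oner_neq0. Qed.
HB.instance Definition _ := GRing.Zmodule_isNzRing.Build freealg
  free_mulA free_mul1 free_mul1r free_mulDl free_mulDr free_one_neq0.

Fact free_scalerAl (a : K) (u v : freealg) :
  a *: (u * v : freealg) = (a *: u : freealg) * v.
Proof.
change (a *: free_mul u v = free_mul (a *: u) v).
by rewrite free_mulE; apply: scalerAl.
Qed.
HB.instance Definition _ := GRing.Lmodule_isLalgebra.Build K freealg
  free_scalerAl.

Fact free_scalerAr (a : K) (u v : freealg) :
  a *: (u * v : freealg) = u * (a *: v : freealg).
Proof.
change (a *: free_mul u v = free_mul u (a *: v)); rewrite free_mulE.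
have malgC_comm (w : {malg K[{fmonom X}]}) : a%:MP * w = w * a%:MP.
  transitivity (fgmul a%:MP w); first by [].
  transitivity (fgmul w a%:MP); last by [].
  rewrite fgmulUg fgmulgU; apply: eq_bigr => m _.
  by rewrite mul1m mulm1 [a * _]mulrC.
have E (x y : {malg K[{fmonom X}]}) : a *: (x * y) = x * (a *: y).
  by rewrite -!mul_malgC mulrA malgC_comm -mulrA.
exact: E.
Qed.
HB.instance Definition _ := GRing.Lalgebra_isAlgebra.Build K freealg
  free_scalerAr.

Definition augment (u : freealg) : K :=
  mcoeff (@fmone X) (u : {malg K[{fmonom X}]}).

Fact augment_is_linear : linear_for *%R augment.
Proof. by move=> a u v; rewrite /augment mcoeffD mcoeffZ. Qed.
HB.instance Definition _ := GRing.isLinear.Build K freealg K _ augment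
  augment_is_linear.

Lemma augmentM : {morph augment : u v / u * v}.
Proof.
move=> u v; change (augment (free_mul u v) = augment u * augment v); rewrite free_mulE.
exact: (rmorphM (@mcoeff {fmonom X} K (fmone X))).
Qed.

Lemma augment1 : augment 1 = 1.
Proof. exact: (rmorph1 (@mcoeff {fmonom X} K (fmone X))). Qed.

Lemma augment_gen x : augment (free_gen x) = 0.
Proof.
rewrite /augment mcoeffU; case: eqP => // /(congr1 (@fmonom_val _)).
by rewrite fmU fm1.
Qed.

End FreeAlgebra.

Section EnvelopingAlgebra.
Variables (K : fieldType) (k : nat) (g : {pred 'M[K]_k}).

Definition mxbracket (x y : 'M[K]_k) := x *m y - y *m x.

Definition lie_elt := {x : 'M[K]_k | x \in g}.

Local Notation T := (freealg K lie_elt).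
Local Notation gen := (@free_gen K lie_elt).

(* U(g) for a Lie algebra g of matrices: the free algebra on the underlying set
   of g, modulo linearity of the generators and [z] = [x][y] - [y][x] for
   z the bracket of x and y. *)
Variant uea_rel : T -> Prop :=
| UeaLinear (a : K) (x y z : lie_elt) of val z = a *: val x + val y :
    uea_rel (gen z - (a *: gen x + gen y))
| UeaBracket (x y z : lie_elt) of val z = mxbracket (val x) (val y) :
    uea_rel (gen z - (gen x * gen y - gen y * gen x)).

Fact uea_ideal1 : 1 \notin gen_ideal_space uea_rel.
Proof.
apply: (@gen_ideal_proper K T uea_rel (@augment K lie_elt)).
- exact: augmentM.
- exact: augment1.
move=> _ [a x y z _|x y z _].
  by apply: augment_linear_rel; apply: augment_gen.
by apply: augment_bracket_rel; [exact: augmentM|exact: augment_gen..].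
Qed.

Definition uea_ideal := Ideal (@gen_idealM K T uea_rel) uea_ideal1.

Definition uea_gen (x : lie_elt) : quotalg uea_ideal := qacls uea_ideal (gen x).

End EnvelopingAlgebra.

Notation uea g := (quotalg (uea_ideal g)).

(* lie_elt g carries no module structure, so linearity of rho in x and its
   compatibility with the bracket are stated through the underlying matrices. *)
Record lie_rep (K : fieldType) (k : nat) (g : {pred 'M[K]_k}) := LieRep {
  rep_space :> lmodType K;
  rho : lie_elt g -> rep_space -> rep_space;
  rho_linear : forall x, linear (rho x);
  rho_add : forall a x y z, val z = a *: val x + val y ->
    forall v, rho z v = a *: rho x v + rho y v;
  rho_bracket : forall x y z, val z = mxbracket (val x) (val y) ->
    forall v, rho z v = rho x (rho y v) - rho y (rho x v) }.

Section Restriction.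
Variables (K : fieldType) (k : nat) (g h : {pred 'M[K]_k}).
Hypothesis gh : {subset g <= h}.

Definition lie_incl (x : lie_elt g) : lie_elt h := Sub (val x) (gh (valP x)).

Definition rep_restrict (V : lie_rep h) : lie_rep g :=
  @LieRep K k g V (fun x => rho (lie_incl x)) (fun x => @rho_linear _ _ _ V _)
    (fun a x y z => @rho_add _ _ _ V a (lie_incl x) (lie_incl y) (lie_incl z))
    (fun x y z => @rho_bracket _ _ _ V (lie_incl x) (lie_incl y) (lie_incl z)).

End Restriction.

Section UeaAction.
Variables (K : fieldType) (k : nat) (g : {pred 'M[K]_k}) (V : lie_rep g).

Local Notation T := {malg K[{fmonom lie_elt g}]}.
Implicit Types (w : {fmonom lie_elt g}) (t : T) (v : V).

HB.instance Definition _ x := GRing.isLinear.Build K V V _ (@rho K k g V x)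
  (rho_linear x).

(* x_1 ... x_l acts by rho x_1 o ... o rho x_l *)
Definition word_act (w : seq (lie_elt g)) v : V := foldr (@rho K k g V) v w.

Definition free_act t v : V :=
  \sum_(w <- msupp t) mcoeff w t *: word_act (fmonom_val w) v.

Lemma word_act_is_linear w : linear (word_act (fmonom_val w)).
Proof.
rewrite /word_act; case: w => w a u v /=.
by elim: w => //= x w ->; rewrite linearP.
Qed.

Lemma free_actEw (D : {fset {fmonom lie_elt g}}) t v : (msupp t `<=` D)%fset ->
  free_act t v = \sum_(w <- D) mcoeff w t *: word_act (fmonom_val w) v.
Proof.
move=> tD; rewrite /free_act; apply: big_fset_incl => // w _ /mcoeff_outdom ->.
by rewrite scale0r.
Qed.

Lemma free_act_linearl a t t' v :
  free_act (a *: t + t') v = a *: free_act t v + free_act t' v.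
Proof.
pose D := (msupp t `|` msupp t' `|` msupp (a *: t + t'))%fset.
have tD : (msupp t `<=` D)%fset by rewrite /D -fsetUA fsubsetUl.
have t'D : (msupp t' `<=` D)%fset by rewrite /D fsetUAC fsubsetUr.
rewrite (free_actEw _ tD) (free_actEw _ t'D) (@free_actEw D) ?fsubsetUr //.
rewrite scaler_sumr -big_split /=; apply: eq_bigr => w _.
by rewrite mcoeffD mcoeffZ scalerDl scalerA.
Qed.

Lemma free_act_linear t : linear (free_act t).
Proof.
move=> a u v; rewrite /free_act scaler_sumr -big_split /=; apply: eq_bigr => w _.
by rewrite word_act_is_linear scalerDr !scalerA mulrC.
Qed.

Definition free_actl v (t : freealg K (lie_elt g)) : V := free_act t v.
HB.instance Definition _ v := GRing.isLinear.Build K (freealg K (lie_elt g)) V _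
  (free_actl v) (fun a t t' => free_act_linearl a t t' v).
HB.instance Definition _ t := GRing.isLinear.Build K V V _
  (free_act t) (free_act_linear t).

Lemma free_actU c w v : free_act << c *g w >> v = c *: word_act (fmonom_val w) v.
Proof.
rewrite (free_actEw v (msuppU_le (k := w) (x := c))) big_seq_fset1.
by rewrite mcoeffUU.
Qed.

Lemma free_act_gen x v : free_act (free_gen K x) v = rho x v.
Proof. by rewrite free_actU fmU scale1r. Qed.

Lemma free_act1 v : free_act 1 v = v.
Proof. by rewrite free_actU fm1 scale1r. Qed.

Lemma free_actM (t t' : freealg K (lie_elt g)) v :
  free_act (t * t') v = free_act t (free_act t' v).
Proof.
transitivity (free_actl v (fgmul t t')).
  by change (free_actl v (free_mul t t') = free_actl v (fgmul t t')); rewrite free_mulE.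
rewrite /fgmul linear_sum [RHS]/free_act; apply: eq_bigr => w1 _.
rewrite linear_sum /free_act.
have -> : word_act (fmonom_val w1) (free_act t' v) = \sum_(w2 <- msupp t')
   mcoeff w2 t' *: word_act (fmonom_val w1) (word_act (fmonom_val w2) v).
  rewrite /free_act; elim/big_rec2: _ => [|w2 x y _ <-].
    by rewrite -[0 in LHS](subrr 0) -scaleN1r addrC word_act_is_linear scaleN1r addNr.
  by rewrite word_act_is_linear.
rewrite scaler_sumr; apply: eq_bigr => w2 _.
rewrite [LHS]free_actU fmM /word_act foldr_cat scalerA //.
Qed.

Lemma linear_relE (A : lmodType K) (phi : A -> V) (lphi : linear phi) a x y z :
  phi (z - (a *: x + y)) = phi z - (a *: phi x + phi y).
Proof.
pose lp := GRing.isLinear.Build K A V _ phi lphi.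
pose f : {linear A -> V} := HB.pack phi lp.
by rewrite -[LHS]/(f _) linearB linearP.
Qed.

Lemma linear_bracketE (A : lmodType K) (phi : A -> V) (lphi : linear phi) x y z :
  phi (z - (x - y)) = phi z - (phi x - phi y).
Proof.
pose lp := GRing.isLinear.Build K A V _ phi lphi.
pose f : {linear A -> V} := HB.pack phi lp.
by rewrite -[LHS]/(f _) !linearB.
Qed.

Lemma linear_idealE (A : algType K) (phi : A -> V) (lphi : linear phi) l
    (c : 'I_l -> K) (w : 'I_l -> A) :
  (forall i, phi (w i) = 0) -> phi (\sum_i c i *: w i) = 0.
Proof.
move=> w0; pose lp := GRing.isLinear.Build K A V _ phi lphi.
pose f : {linear A -> V} := HB.pack phi lp.
rewrite -[LHS]/(f _) linear_sum big1 // => i _.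
by rewrite linearZ /= w0 scaler0.
Qed.

Lemma free_actl_linear v : linear (free_actl v).
Proof. by move=> a t t'; apply: free_act_linearl. Qed.

Lemma free_actlM v (t t' : freealg K (lie_elt g)) :
  free_actl v (t * t') = free_act t (free_actl v t').
Proof. exact: free_actM. Qed.

Lemma free_actl_gen v x : free_actl v (free_gen K x) = rho x v.
Proof. exact: free_act_gen. Qed.

Lemma free_act_rel r : uea_rel r -> forall v, free_actl v r = 0.
Proof.
move=> rr v; case: rr => [a x y z e|x y z e].
  rewrite (linear_relE (free_actl_linear v)) !free_actl_gen.
  by rewrite (rho_add e) subrr.
rewrite (linear_bracketE (free_actl_linear v)) !free_actlM !free_actl_gen.
by rewrite !free_act_gen (rho_bracket e) subrr.
Qed.

Lemma free_act_ideal (t : freealg K (lie_elt g)) v :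
  t \in ideal_space (uea_ideal g) -> free_actl v t = 0.
Proof.
move=> /asboolP[l [c [w [Aw ->]]]].
apply: (linear_idealE (free_actl_linear v)) => i.
have [u [r [u' [rr ->]]]] := Aw i.
have E : free_act r (free_actl v u') = 0 by apply: free_act_rel.
by rewrite free_actlM free_actM E; exact: (linear0 (free_act u)).
Qed.

Definition uea_act (u : uea g) (v : V) : V := free_act (repr u) v.

Lemma uea_act_cls (t : freealg K (lie_elt g)) v :
  uea_act (qacls (uea_ideal g) t) v = free_act t v.
Proof.
apply/eqP; rewrite -subr_eq0 -[X in X == _]/(free_actl v _ - free_actl v _).
rewrite -linearB; apply/eqP/free_act_ideal; apply/qclsP; exact: qclsK.
Qed.

Lemma uea_act_linear u : linear (uea_act u).
Proof. exact: free_act_linear. Qed.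

Lemma uea_act_linearl v : linear (uea_act^~ v).
Proof.
move=> a x y; rewrite -[x]qaclsK -[y]qaclsK -linearP !uea_act_cls.
exact: (free_act_linearl a).
Qed.

Lemma uea_act1 v : uea_act 1 v = v.
Proof. by rewrite -[1]/(qacls (uea_ideal g) 1) uea_act_cls; apply: free_act1. Qed.

Lemma uea_actM x y v : uea_act (x * y) v = uea_act x (uea_act y v).
Proof.
by rewrite -[x]qaclsK -[y]qaclsK -rmorphM !uea_act_cls free_actM.
Qed.

Lemma uea_act_gen x v : uea_act (uea_gen x) v = rho x v.
Proof. by rewrite uea_act_cls free_act_gen. Qed.

End UeaAction.

Section Subtypes.
Variables (K : fieldType) (V W : lmodType K).

Definition subsp (U : subspace V) := {x : V | x \in U}.
HB.instance Definition _ U := SubChoice.on (subsp U).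
HB.instance Definition _ U :=
  [SubChoice_isSubLmodule of subsp U by <:].

Variable f : {linear V -> W}.

Definition image_pred (U : subspace V) : {pred W} :=
  [pred y | `[< exists2 x, x \in U & y = f x >]].

Fact image_closed U : submod_closed (image_pred U).
Proof.
split; first by apply/asboolP; exists 0; rewrite ?rpred0 ?linear0.
move=> a _ _ /asboolP[x Ux ->] /asboolP[y Uy ->]; apply/asboolP.
by exists (a *: x + y); rewrite ?linearP // rpredD ?rpredZ.
Qed.

Definition image_space U := Subspace (image_closed U).

Lemma image_mem (U : subspace V) x : x \in U -> f x \in image_space U.
Proof. by move=> Ux; apply/asboolP; exists x. Qed.

End Subtypes.

Section DirectSum.
Variables (K : fieldType) (I : Type) (F : I -> lmodType K).

Definition family := forall i, F i.
Implicit Types x y z : family.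
HB.instance Definition _ := gen_eqMixin family.
HB.instance Definition _ := gen_choiceMixin family.

Definition fam_zero : family := fun=> 0.
Definition fam_opp x : family := fun i => - x i.
Definition fam_add x y : family := fun i => x i + y i.
Definition fam_scale a x : family := fun i => a *: x i.

Lemma famP x y : (forall i, x i = y i) -> x = y.
Proof. exact: functional_extensionality_dep. Qed.

Fact fam_addA : associative fam_add.
Proof. by move=> x y z; apply/famP => i; apply: addrA. Qed.
Fact fam_addC : commutative fam_add.
Proof. by move=> x y; apply/famP => i; apply: addrC. Qed.
Fact fam_add0 : left_id fam_zero fam_add.
Proof. by move=> x; apply/famP => i; apply: add0r. Qed.
Fact fam_addN : left_inverse fam_zero fam_opp fam_add.
Proof. by move=> x; apply/famP => i; apply: addNr. Qed.
HB.instance Definition _ :=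
  GRing.isZmodule.Build family fam_addA fam_addC fam_add0 fam_addN.

Fact fam_scaleA a b x : fam_scale a (fam_scale b x) = fam_scale (a * b) x.
Proof. by apply/famP => i; apply: scalerA. Qed.
Fact fam_scale1 : left_id 1 fam_scale.
Proof. by move=> x; apply/famP => i; apply: scale1r. Qed.
Fact fam_scaleDr : right_distributive fam_scale +%R.
Proof. by move=> a x y; apply/famP => i; apply: scalerDr. Qed.
Fact fam_scaleDl x : {morph fam_scale^~ x : a b / a + b}.
Proof. by move=> a b; apply/famP => i; apply: scalerDl. Qed.
HB.instance Definition _ := GRing.Zmodule_isLmodule.Build K family
  fam_scaleA fam_scale1 fam_scaleDr fam_scaleDl.

Definition fin_supp_pred : {pred family} :=
  [pred x : family | `[< finite_set [set i | x i <> 0] >]].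

Fact fin_supp_closed : submod_closed fin_supp_pred.
Proof.
split.
  by apply/asboolP/(sub_finite_set (B := set0)) => // i /=; apply.
move=> a x y /asboolP fx /asboolP fy; apply/asboolP.
have /(sub_finite_set _) : finite_set ([set i | x i <> 0] `|` [set i | y i <> 0]).
  by rewrite finite_setU.
apply=> i /= nz; have [x0|] := pselect (x i = 0); last by left.
right=> y0; apply: nz; change (a *: x i + y i = 0).
by rewrite x0 y0 scaler0 addr0.
Qed.

Definition dsum := subsp (Subspace fin_supp_closed).
HB.instance Definition _ := Choice.on dsum.
HB.instance Definition _ := GRing.Lmodule.on dsum.

Definition component (x : dsum) (i : I) : F i := val x i.

End DirectSum.

Section AssociatedGraded.
Variables (K : fieldType) (R : realType) (V : lmodType K).

Record filtration := Filtration {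
  fle : R -> subspace V;
  flt : R -> subspace V;
  flt_sub : forall m, {subset flt m <= fle m} }.

Variable F : filtration.

(* V_{<= m} / V_{< m}, seen as the image of V_{<= m} in V / V_{< m} *)
Definition gr_piece_space (m : R) : subspace (quotspace (flt F m)) :=
  image_space (@qcls K V (flt F m)) (fle F m).

Definition gr_piece (m : R) := subsp (gr_piece_space m).
HB.instance Definition _ m := Choice.on (gr_piece m).
HB.instance Definition _ m := GRing.Lmodule.on (gr_piece m).

Definition gr := dsum gr_piece.
HB.instance Definition _ := Choice.on gr.
HB.instance Definition _ := GRing.Lmodule.on gr.

(* Class of v in degree m; junk value 0 when v is not in V_{<= m}. *)
Definition gr_class (m : R) (v : V) : gr_piece m := insubd 0 (qcls (flt F m) v).

Definition gr_in_fam (m : R) (v : V) : family gr_piece :=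
  fun k => if k == m then gr_class k v else 0.

Fact gr_in_fin m v : gr_in_fam m v \in Subspace (fin_supp_closed gr_piece).
Proof.
apply/asboolP/(sub_finite_set (B := [set m])) => // k /=.
by rewrite /gr_in_fam; case: eqP.
Qed.

Definition gr_in (m : R) (v : V) : gr := Sub (gr_in_fam m v) (gr_in_fin m v).

Definition gr_rep (m : R) (x : gr_piece m) : V := repr (val x).

Lemma gr_classE m v : v \in fle F m -> val (gr_class m v) = qcls (flt F m) v.
Proof. by move=> Fv; rewrite insubdK //; apply: image_mem. Qed.

Lemma gr_rep_mem m (x : gr_piece m) : gr_rep x \in fle F m.
Proof.
have /asboolP[v Fv e] := valP x.
rewrite -[gr_rep x](subrK v) rpredD // (flt_sub (f := F)) //.
by apply/qclsP; rewrite qclsK.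
Qed.

Lemma gr_class_rep m (x : gr_piece m) : gr_class m (gr_rep x) = x.
Proof. by apply: val_inj; rewrite gr_classE ?gr_rep_mem // qclsK. Qed.

Lemma gr_class_eq0 m v : v \in fle F m -> (gr_class m v = 0) <-> v \in flt F m.
Proof.
move=> Fv; split=> [/(congr1 val)|].
  by rewrite gr_classE //= => /eqP; rewrite qcls0.
by rewrite -qcls0 => /eqP e; apply: val_inj; rewrite gr_classE.
Qed.

Lemma gr_class_linear m a u v : u \in fle F m -> v \in fle F m ->
  gr_class m (a *: u + v) = a *: gr_class m u + gr_class m v.
Proof.
move=> Fu Fv; apply: val_inj.
by rewrite linearP /= !gr_classE ?rpredD ?rpredZ // linearP.
Qed.

End AssociatedGraded.

Section GrIn.
Variables (K : fieldType) (R : realType) (V : lmodType K) (F : filtration R V).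

Lemma gr_inE m v k :
  component (gr_in F m v) k = if k == m then gr_class F k v else 0.
Proof. by []. Qed.

Lemma gr_rep_in m v k : v \in fle F m -> k = m ->
  gr_rep (component (gr_in F m v) k) - v \in flt F m.
Proof.
move=> Fv ->; rewrite gr_inE eqxx; apply/qclsP.
by rewrite qclsK gr_classE.
Qed.

End GrIn.

(* The action of gr U on gr V induced by a bilinear map compatible with the
   filtrations: the degree c component of x . y is the sum over a + b = c of the
   classes of u v, for u and v representatives of the components x_a and y_b. *)
Section GradedAction.
Variables (K : fieldType) (R : realType) (U V : lmodType K).
Variables (FU : filtration R U) (FV : filtration R V) (act : U -> V -> V).

Record filtered_action : Prop := FilteredAction {
  filt_actl : forall v, linear (act^~ v);
  filt_actr : forall u, linear (act u);
  filt_le : forall a b u v,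
    u \in fle FU a -> v \in fle FV b -> act u v \in fle FV (a + b);
  filt_ltl : forall a b u v,
    u \in flt FU a -> v \in fle FV b -> act u v \in flt FV (a + b);
  filt_ltr : forall a b u v,
    u \in fle FU a -> v \in flt FV b -> act u v \in flt FV (a + b) }.

Hypothesis actF : filtered_action.

Definition gr_act_term (x : gr FU) (y : gr FV) (c a : R) : gr_piece FV c :=
  gr_class FV c (act (gr_rep (component x a)) (gr_rep (component y (c - a)))).

Definition gr_act_fam (x : gr FU) (y : gr FV) : family (gr_piece FV) :=
  fun c => \sum_(a \in [set: R]) gr_act_term x y c a.

Lemma gr_act_term_neq0 x y c a : gr_act_term x y c a <> 0 ->
  component x a <> 0 /\ component y (c - a) <> 0.
Proof.
have E : a + (c - a) = c by rewrite addrC subrK.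
have fc (W : R -> subspace V) v : v \in W (a + (c - a)) -> v \in W c by rewrite E.
have rle : act (gr_rep (component x a)) (gr_rep (component y (c - a))) \in fle FV c.
  by apply: fc; rewrite (filt_le actF) ?gr_rep_mem.
have rep0 (M : lmodType K) (G : filtration R M) k (z : gr_piece G k) : z = 0 -> gr_rep z \in flt G k.
  by move=> z0; apply/gr_class_eq0; rewrite ?gr_rep_mem // gr_class_rep.
move=> nz; split=> z; apply: nz; apply/gr_class_eq0 => //; apply: fc.
  by apply: (filt_ltl actF); [exact: rep0|exact: gr_rep_mem].
by apply: (filt_ltr actF); [exact: gr_rep_mem|exact: rep0].
Qed.

Fact gr_act_fin x y : gr_act_fam x y \in Subspace (fin_supp_closed (gr_piece FV)).
Proof.
have /asboolP fx := valP x; have /asboolP fy := valP y.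
apply/asboolP; apply: sub_finite_set (finite_image2 (fun a b => a + b) fx fy).
move=> c /= nz; apply: contrapT => nI; apply: nz.
apply: fsbig1 => a _; apply: contrapT => /gr_act_term_neq0[xa yb].
by apply: nI; exists a => //; exists (c - a) => //; rewrite addrC subrK.
Qed.

Definition gr_act (x : gr FU) (y : gr FV) : gr FV :=
  Sub (gr_act_fam x y) (gr_act_fin x y).

Lemma gr_act_in a b u v : u \in fle FU a -> v \in fle FV b ->
  gr_act (gr_in FU a u) (gr_in FV b v) = gr_in FV (a + b) (act u v).
Proof.
move=> Uu Vv; apply: val_inj; apply: famP => c.
change (\sum_(k \in [set: R]) gr_act_term (gr_in FU a u) (gr_in FV b v) c k =
  component (gr_in FV (a + b) (act u v)) c).
have supp k : gr_act_term (gr_in FU a u) (gr_in FV b v) c k <> 0 ->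
    k = a /\ c = a + b.
  move=> /gr_act_term_neq0; rewrite !gr_inE.
  case: eqP => [->|_ []//]; case: eqP => [<- _|_ []//].
  by rewrite addrC subrK.
rewrite gr_inE; case: eqP => [e|ne]; last first.
  by apply: fsbig1 => k _; apply: contrapT => /supp[].
rewrite -(fsbig_widen [set a] setT) //; last first.
  by move=> k [_ /= ka]; apply: contrapT => /supp[].
rewrite fsbig_set1 /gr_act_term.
have ca : c - a = b by rewrite e addrC addKr.
have Eu := gr_rep_in Uu (erefl a); have Ev := gr_rep_in Vv ca.
set u' := gr_rep _ in Eu *; set v' := gr_rep _ in Ev *.
have Vv' : v' \in fle FV b by rewrite -[v'](subrK v) rpredD // flt_sub.
apply: val_inj.
have le : act u v \in fle FV c by rewrite e (filt_le actF).
have le' : act u' v' \in fle FV c by rewrite e (filt_le actF) ?gr_rep_mem.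
rewrite !gr_classE //; apply/qclsP; rewrite e.
pose act2 := GRing.isLinear.Build K V V _ (act u) (filt_actr actF u).
pose f2 : {linear V -> V} := HB.pack (act u) act2.
pose act1 := GRing.isLinear.Build K U V _ (act^~ v') (filt_actl actF v').
pose f1 : {linear U -> V} := HB.pack (act^~ v') act1.
rewrite -[act u' v'](subrK (act u v')) -addrA rpredD //.
  rewrite -[act u' v' - _]/(f1 u' - f1 u) -linearB.
  exact: (filt_ltl actF).
rewrite -[act u v' - _]/(f2 v' - f2 v) -linearB.
exact: (filt_ltr actF).
Qed.

End GradedAction.

Section Basis.
Variables (K : fieldType) (M : lmodType K) (I : choiceType).

Definition is_basis (S : set I) (f : I -> M) : Prop :=
  (forall (s : seq I) (c : I -> K), uniq s -> (forall i, i \in s -> S i) ->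
     \sum_(i <- s) c i *: f i = 0 -> forall i, i \in s -> c i = 0) /\
  (forall v, v \in span (f @` S)).

End Basis.

Section Irreducible.
Variables (K : fieldType) (k : nat) (g : {pred 'M[K]_k}) (V : lie_rep g).

Definition irreducible_rep : Prop :=
  (exists v : V, v <> 0) /\
  forall W : subspace V, (forall x w, w \in W -> rho x w \in W) ->
    (forall w, w \in W -> w = 0) \/ (forall w, w \in W).

End Irreducible.

(* The pair (i, q) with 1 <= i <= q <= 2n - i stands for alpha_{i,q} if q <= n
   and for alpha_{i, \bar j} with j = 2n - q if q >= n; the two readings agree
   for q = n, where alpha_{i, \bar n} = alpha_{i, n}. Thus the order
   1 < ... < n < \bar{n-1} < ... < \bar 1 becomes the order on integers. *)
Definition posroot (n : nat) :=
  {p : 'I_n.*2 * 'I_n.*2 | [&& 0 < p.1, p.1 <= p.2 & p.1 + p.2 <= n.*2]%N}.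
HB.instance Definition _ n := Finite.on (posroot n).

Section Roots.
Variable n : nat.
Implicit Types b : posroot n.

Definition ri b : nat := (val b).1.
Definition rq b : nat := (val b).2.

Lemma posrootP b : [/\ 0 < ri b, ri b <= rq b & ri b + rq b <= n.*2]%N.
Proof. by have /and3P := valP b. Qed.

Definition simple_root b := ri b == rq b.

(* alpha_{j, \bar j} with 1 <= j < n *)
Definition long_root b := (ri b < n)%N && (rq b == n.*2 - ri b)%N.

Definition dyck_step b b' :=
  ((ri b' == ri b) && (rq b' == (rq b).+1)) ||
  ((ri b' == (ri b).+1) && (rq b' == rq b)).

(* The path p(0) = b, p(1), ..., p(k) with s = [:: p(1); ...; p(k)] *)
Definition dyck_path b (s : seq (posroot n)) :=
  [&& simple_root b, path dyck_step b s &
      simple_root (last b s) || long_root (last b s)].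

End Roots.

Section Polyhedra.
Variables (R : realType) (n : nat).

(* lam k is the coefficient of omega_{k+1} *)
Definition FFLV (lam : 'I_n -> nat) : set (posroot n -> R) :=
  [set x | (forall b, 0 <= x b) /\
    forall b s, dyck_path b s ->
      (simple_root (last b s) -> \sum_(c <- b :: s) x c <=
         \sum_(k < n | (ri b <= k.+1 <= ri (last b s))%N) (lam k)%:R) /\
      (long_root (last b s) -> \sum_(c <- b :: s) x c <=
         \sum_(k < n | (ri b <= k.+1)%N) (lam k)%:R)].

Definition FFLV_points (lam : 'I_n -> nat) : set {ffun posroot n -> nat} :=
  [set s | FFLV lam (fun b => (s b)%:R)].

Variable d : posroot n -> R.

(* d_{i,q} and d_{i, \bar j}; the default value is never reached in in_cone. *)
Definition coord (i q : nat) : R :=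
  if [pick b : posroot n | (ri b == i) && (rq b == q)] is Some b then d b else 0.
Definition coord_bar (i j : nat) : R := coord i (n.*2 - j)%N.

Definition in_cone : Prop :=
  [/\ forall i, (1 <= i <= n.-1)%N ->
        coord i i.+1 <= coord i i + coord i.+1 i.+1,
      forall i j, (1 <= i)%N -> (i < j)%N -> (j <= n.-1)%N ->
        coord i j.+1 + coord i.+1 j <= coord i j + coord i.+1 j.+1,
      forall i j, (1 <= i)%N -> (i < j)%N -> (j <= n.-1)%N ->
        coord_bar i j + coord_bar i.+1 j.+1 <=
        coord_bar i j.+1 + coord_bar i.+1 j
    & forall i, (1 <= i <= n.-1)%N ->
        coord_bar i i + coord_bar i.+1 i.+1 <= 2 * coord_bar i i.+1].

End Polyhedra.

Section Symplectic.
Variables (K : fieldType) (n : nat).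

Definition antidiag : 'M[K]_n := \matrix_(i, j) ((i + j).+1 == n)%N%:R.
Definition sp_form : 'M[K]_(n + n) := block_mx 0 antidiag (- antidiag) 0.

Definition sp : {pred 'M[K]_(n + n)} :=
  [pred X | X^T *m sp_form + sp_form *m X == 0].

Definition strictly_upper (X : 'M[K]_(n + n)) :=
  [forall r : 'I_(n + n), forall c : 'I_(n + n), (c <= r)%N ==> (X r c == 0)].
Definition strictly_lower (X : 'M[K]_(n + n)) :=
  [forall r : 'I_(n + n), forall c : 'I_(n + n), (r <= c)%N ==> (X r c == 0)].

Definition nminus : {pred 'M[K]_(n + n)} :=
  [pred X | (X \in sp) && strictly_lower X].

Lemma nminus_sp : {subset nminus <= sp}.
Proof. by move=> X /andP[]. Qed.

Definition bar (i : nat) : nat := (n.*2.+1 - i)%N.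

(* Matrix unit E_{a,b}, with rows and columns numbered from 1. *)
Definition Emx (a b : nat) : 'M[K]_(n + n) :=
  \matrix_(r, c) ((r.+1 == a) && (c.+1 == b))%:R.

Definition root_mx (b : posroot n) : 'M[K]_(n + n) :=
  let i := ri b in let q := rq b in let j := (n.*2 - q)%N in
  if (q == n.*2 - i)%N then Emx (bar i) i
  else if (q < n)%N then Emx q.+1 i - Emx (bar i) (bar q.+1)
  else Emx (bar j) i + Emx (bar i) j.

Lemma sp_formE (r c : 'I_(n + n)) :
  sp_form r c = ((r + c).+1 == n + n)%:R * (if (r < n)%N then 1 else -1).
Proof.
rewrite /sp_form /block_mx !mxE; case: splitP => r' rE; rewrite !mxE;
  case: splitP => c' cE; rewrite !mxE rE cE.
- have -> : ((r' + c').+1 == n + n) = false.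
    by have := ltn_ord r'; have := ltn_ord c'; lia.
  by rewrite mul0r.
- rewrite mulr1; congr (_%:R); lia.
- rewrite mulrN1; congr (- _%:R); lia.
- have -> : ((n + r' + (n + c')).+1 == n + n) = false by lia.
  by rewrite mul0r.
Qed.

Lemma spP (X : 'M[K]_(n + n)) :
  (forall r c : 'I_(n + n), X (rev_ord r) c * (if (r < n)%N then 1 else -1) =
    X (rev_ord c) r * (if (c < n)%N then 1 else -1)) ->
  X \in sp.
Proof.
move=> XE; apply/eqP/matrixP => r c.
rewrite mxE [X in X + _]mxE [X in _ + X]mxE [RHS]mxE.
rewrite (bigD1 (rev_ord c)) //= [in X in _ + X](bigD1 (rev_ord r)) //=.
rewrite !big1 ?addr0 => [|k kr|k kc].
- rewrite [X^T _ _]mxE !sp_formE /=.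
  have -> : (n + n - c.+1 + c).+1 == n + n by have := ltn_ord c; lia.
  have -> : (r + (n + n - r.+1)).+1 == n + n by have := ltn_ord r; lia.
  rewrite !mul1r [X in _ + X]mulrC XE.
  have -> : (n + n - c.+1 < n)%N = ~~ (c < n)%N by have := ltn_ord c; lia.
  by case: (c < n)%N; rewrite /= ?mulrN1 ?mulr1 ?addNr ?subrr.
- rewrite sp_formE; case: eqP => [e|_]; last by rewrite !mul0r.
  case/negP: kr; apply/eqP/val_inj => /=.
  by have := ltn_ord k; have := ltn_ord r; lia.
- rewrite sp_formE; case: eqP => [e|_]; last by rewrite mul0r mulr0.
  case/negP: kc; apply/eqP/val_inj => /=.
  by have := ltn_ord k; have := ltn_ord c; lia.
Qed.

Lemma Emx0 (a b : nat) (r c : 'I_(n + n)) :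
  ((r.+1 == a) && (c.+1 == b)) = false -> Emx a b r c = 0.
Proof. by rewrite mxE => ->. Qed.

(* The reflection (r, c) |-> (\bar c, \bar r) in the antidiagonal maps E_{a,b}
   to E_{\bar b, \bar a}. *)
Lemma Emx_rev (a b : nat) (r c : 'I_(n + n)) : (0 < a)%N -> (0 < b)%N ->
  (a <= n + n)%N -> (b <= n + n)%N ->
  Emx a b (rev_ord r) c = ((bar a == r.+1) && (b == c.+1))%:R.
Proof.
move=> a0 b0 an bn; rewrite mxE /= /bar; congr (_%:R); have := ltn_ord r; lia.
Qed.

Lemma root_mx_nminus b : root_mx b \in nminus.
Proof.
have [i0 iq iqn] := posrootP b; rewrite /root_mx.
move: (ri b) (rq b) i0 iq iqn => i q i0 iq iqn; apply/andP; split; last first.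
  apply/forallP => r; apply/forallP => c; apply/implyP => rc; apply/eqP.
  have := ltn_ord r; have := ltn_ord c => cn rn; rewrite /bar.
  case: ifP => [/eqP e|ne]; last case: ifP => qn.
  - by apply: Emx0; lia.
  - by rewrite mxE [(- _ : 'M__) _ _]mxE !Emx0 ?subrr //; lia.
  - by rewrite mxE !Emx0 ?addr0 //; lia.
apply: spP => r c; have := ltn_ord r; have := ltn_ord c => cn rn.
case: ifP => [/eqP e|ne]; last case: ifP => qn.
- rewrite !Emx_rev; try (rewrite /bar; lia).
  have bb : bar (bar i) = i by rewrite /bar; lia.
  rewrite bb; case: (boolP ((i == r.+1) && (i == c.+1))) => H.
    have -> : (i == c.+1) && (i == r.+1) by lia.
    by have -> : (r < n)%N = (c < n)%N by lia.
  have -> : (i == c.+1) && (i == r.+1) = false by lia.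
  by rewrite !mul0r.
- have EN (A B : 'M[K]_(n + n)) r0 c0 : (A - B) r0 c0 = A r0 c0 - B r0 c0.
    by rewrite !mxE.
  rewrite !EN !Emx_rev; try (rewrite /bar; lia).
  have bb : bar (bar i) = i by rewrite /bar; lia.
  have bn : (n < bar q.+1)%N by rewrite /bar; lia.
  rewrite bb; move: (bar q.+1) bn => p pn.
  rewrite [(i == r.+1) && _]andbC [(i == c.+1) && _]andbC.
  case: (boolP ((p == r.+1) && (i == c.+1))) => H1.
    have -> : (p == c.+1) && (i == r.+1) = false by lia.
    have -> : (r < n)%N = false by lia.
    have -> : (c < n)%N by lia.
    by rewrite subr0 sub0r mulr1 mulrN1.
  case: (boolP ((p == c.+1) && (i == r.+1))) => H2; last by rewrite subr0 !mul0r.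
  have -> : (r < n)%N by lia.
  have -> : (c < n)%N = false by lia.
  by rewrite sub0r subr0 mulrN1 mulr1.
- have ED (A B : 'M[K]_(n + n)) r0 c0 : (A + B) r0 c0 = A r0 c0 + B r0 c0.
    by rewrite mxE.
  rewrite !ED !Emx_rev; try (rewrite /bar; lia).
  have bb : bar (bar i) = i by rewrite /bar; lia.
  have bj : bar (bar (n.*2 - q)) = (n.*2 - q)%N by rewrite /bar; lia.
  have jn : (0 < n.*2 - q <= n)%N by lia.
  have ni : (i <= n)%N by lia.
  rewrite bb bj; move: (n.*2 - q)%N jn => j jn {bb bj}.
  rewrite [(i == r.+1) && _]andbC [(i == c.+1) && _]andbC.
  rewrite [((j == c.+1) && _)%:R + _]addrC.
  set A := (j == r.+1) && (i == c.+1); set B := (j == c.+1) && (i == r.+1).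
  case: (boolP (A || B)) => [AB|/norP[/negPf -> /negPf ->]]; last first.
    by rewrite addr0 !mul0r.
  have -> : (r < n)%N = (c < n)%N by move: AB; rewrite /A /B; lia.
  by [].
Qed.

End Symplectic.

Arguments sp K n : clear implicits.
Arguments nminus K n : clear implicits.
Arguments root_mx K {n} b.
Arguments root_mx_nminus K {n} b.
Arguments nminus_sp K n : clear implicits.

Section HighestWeight.
Variables (K : fieldType) (n : nat).

(* omega_i = eps_1 + ... + eps_i, where eps_r (h) is the r-th diagonal entry. *)
Definition fund_weight (i : nat) (h : 'M[K]_(n + n)) : K :=
  \sum_(r < n + n | (r < i)%N) h r r.

Definition weight (lam : 'I_n -> nat) (h : 'M[K]_(n + n)) : K :=
  \sum_(k < n) (lam k)%:R * fund_weight k.+1 h.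

Definition highest_weight_vector (V : lie_rep (sp K n)) (lam : 'I_n -> nat)
    (nu : V) : Prop :=
  [/\ nu <> 0,
      forall x : lie_elt (sp K n), strictly_upper (val x) -> rho x nu = 0
    & forall h : lie_elt (sp K n), is_diag_mx (val h) ->
        rho h nu = weight lam (val h) *: nu].

End HighestWeight.

Section SpanProduct.
Variables (K : fieldType) (A : algType K).

Lemma span_mul (X Y : set A) (W : subspace A) :
  (forall x y, X x -> Y y -> x * y \in W) ->
  forall u v, u \in span X -> v \in span Y -> u * v \in W.
Proof.
move=> XY u v /asboolP[k [c [w [Xw ->]]]] /asboolP[l [c' [w' [Yw ->]]]].
rewrite mulr_suml; apply: rpred_sum => i _.
rewrite mulr_sumr; apply: rpred_sum => j _.
by rewrite -scalerAl -scalerAr scalerA rpredZ // XY.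
Qed.

End SpanProduct.

Section PBWFiltration.
Variables (R : realType) (n : nat).
Local Notation C := R[i].
Local Notation U := (uea (nminus C n)).

Definition root_gen (b : posroot n) : U :=
  uea_gen (Sub (root_mx C b) (root_mx_nminus C b)).

Definition root_word (s : seq (posroot n)) : U := \prod_(b <- s) root_gen b.

Definition pbw_monomial (e : seq (posroot n)) (s : {ffun posroot n -> nat}) : U :=
  \prod_(b <- e) root_gen b ^+ s b.

Variable d : posroot n -> R.

(* U(n_-)_{<= m} and U(n_-)_{< m} *)
Definition Ule (m : R) : subspace U :=
  span [set u | exists2 s, \sum_(b <- s) d b <= m & u = root_word s].
Definition Ult (m : R) : subspace U :=
  span [set u | exists2 s, \sum_(b <- s) d b < m & u = root_word s].

Fact Ult_sub m : {subset Ult m <= Ule m}.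
Proof.
apply: span_ind => _ [s sm ->]; apply: span_mem; exists s => //; exact: ltW.
Qed.

Definition Ufilt : filtration R U := Filtration Ult_sub.

Lemma root_wordM s t : root_word s * root_word t = root_word (s ++ t).
Proof. by rewrite /root_word big_cat. Qed.

Lemma Ule_mul a b u v : u \in Ule a -> v \in Ule b -> u * v \in Ule (a + b).
Proof.
apply: span_mul => _ _ [s sa ->] [t tb ->]; rewrite root_wordM.
by apply: span_mem; exists (s ++ t) => //; rewrite big_cat lerD.
Qed.

Lemma Ult_mull a b u v : u \in Ult a -> v \in Ule b -> u * v \in Ult (a + b).
Proof.
apply: span_mul => _ _ [s sa ->] [t tb ->]; rewrite root_wordM.
by apply: span_mem; exists (s ++ t) => //; rewrite big_cat ltr_leD.
Qed.

Lemma Ult_mulr a b u v : u \in Ule a -> v \in Ult b -> u * v \in Ult (a + b).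
Proof.
apply: span_mul => _ _ [s sa ->] [t tb ->]; rewrite root_wordM.
by apply: span_mem; exists (s ++ t) => //; rewrite big_cat ler_ltD.
Qed.

Definition degree (s : {ffun posroot n -> nat}) : R := \sum_b (s b)%:R * d b.

Lemma pbw_monomial_mem e s : perm_eq e (enum {: posroot n}) ->
  pbw_monomial e s \in Ule (degree s).
Proof.
move=> eE; apply: span_mem; exists (flatten [seq nseq (s b) b | b <- e]).
  rewrite /degree -big_enum -(perm_big _ eE) /= big_flatten big_map.
  rewrite le_eqVlt; apply/orP; left; apply/eqP/eq_bigr => b _.
  by rewrite big_nseq -Monoid.iteropE /= mulr_natl.
rewrite /root_word big_flatten big_map; apply: eq_bigr => b _.
by rewrite big_nseq -Monoid.iteropE.
Qed.

(* The class of f^s in U(n_-)^d, in degree sum_b s_b d(b). *)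
Definition gr_monomial (e : seq (posroot n)) (s : {ffun posroot n -> nat}) :
  gr Ufilt := gr_in Ufilt (degree s) (pbw_monomial e s).

Variables (V : lie_rep (sp C n)) (nu : V).

Definition nminus_rep : lie_rep (nminus C n) := rep_restrict (nminus_sp C n) V.

Definition nu_orbit (u : U) : V := @uea_act _ _ _ nminus_rep u nu.
Fact nu_orbit_linear : linear nu_orbit.
Proof. exact: (@uea_act_linearl _ _ _ nminus_rep nu). Qed.
HB.instance Definition _ := GRing.isLinear.Build C U V _ nu_orbit nu_orbit_linear.

(* (V_lambda)_{<= m} = U(n_-)_{<= m} . nu, and likewise with < m *)
Definition Vle (m : R) : subspace V := image_space nu_orbit (Ule m).
Definition Vlt (m : R) : subspace V := image_space nu_orbit (Ult m).

Fact Vlt_sub m : {subset Vlt m <= Vle m}.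
Proof.
by move=> _ /asboolP[u uU ->]; apply: image_mem; apply: Ult_sub.
Qed.

Definition Vfilt : filtration R V := Filtration Vlt_sub.

Definition Vact : U -> V -> V := @uea_act _ _ _ nminus_rep.

Lemma Vact_filtered : filtered_action Ufilt Vfilt Vact.
Proof.
have orbM u v : Vact u (nu_orbit v) = nu_orbit (u * v) by rewrite /nu_orbit uea_actM.
split.
- exact: (@uea_act_linearl _ _ _ nminus_rep).
- exact: (@uea_act_linear _ _ _ nminus_rep).
- move=> a b u _ uU /asboolP[v vU ->]; rewrite orbM.
  by apply: image_mem; apply: Ule_mul.
- move=> a b u _ uU /asboolP[v vU ->]; rewrite orbM.
  by apply: image_mem; apply: Ult_mull.
- move=> a b u _ uU /asboolP[v vU ->]; rewrite orbM.
  by apply: image_mem; apply: Ult_mulr.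
Qed.

Lemma nu_mem : nu \in Vle 0.
Proof.
have E : nu_orbit 1 = nu by apply: (@uea_act1 _ _ _ nminus_rep).
rewrite -[X in X \in _]E.
apply: image_mem; apply: span_mem.
by exists [::]; rewrite /root_word ?big_nil.
Qed.

(* The class of nu in V_lambda^d = gr Vfilt; it has degree 0, nu = 1 . nu. *)
Definition gr_nu : gr Vfilt := gr_in Vfilt 0 nu.

Definition gr_monomial_nu (e : seq (posroot n)) (s : {ffun posroot n -> nat}) :
  gr Vfilt := gr_act Vact_filtered (gr_monomial e s) gr_nu.

Lemma gr_monomial_nuE e s : perm_eq e (enum {: posroot n}) ->
  gr_monomial_nu e s = gr_in Vfilt (degree s + 0) (Vact (pbw_monomial e s) nu).
Proof. by move=> eE; apply: gr_act_in; [exact: pbw_monomial_mem|exact: nu_mem]. Qed.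

End PBWFiltration.

(* Main.v *)
(* The proof compares V with the submodule generated by nu' in a tensor product
   of exterior powers of C^{2n}: words in the root vectors satisfy the same linear
   relations on nu and on nu'.

   Spanning. If X in sp has rank one (or is u v^T minus its adjoint), then
   X^N nu = 0 as soon as N exceeds the number of exterior powers on which X can
   act, and up to shorter words only the strictly lower triangular part of X
   matters. Letting X vary and extracting a coefficient gives a relation among the
   words whose roots, read as intervals [i, 2n - q], have prescribed endpoints;
   among these the multiset of nested intervals, i.e. the one supported on a Dyck
   path, has the largest spread. Hence f^s nu with s outside the polytope is a
   combination of shorter words and of words of smaller spread.

   Independence and degrees. A point s of S(lam) is a sum of antichains, one for
   each exterior power, and the antichains define a coordinate of the tensor space.
   The inequalities of the cone, extended to the root system of type A_{2n-1}, are
   the Monge inequalities of a transportation problem. They show that the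
   coordinate attached to s is nonzero on f^s nu', and on another word w only if
   deg s <= deg w for every d in the cone. So the matrix of these coordinates is
   triangular, which gives linear independence, and the expansion of a word w only
   involves the f^s with deg s <= deg w. *)
From HB Require Import structures.
From mathcomp Require Import all_boot all_order all_algebra all_fingroup.
From mathcomp Require Import boolp classical_sets cardinality reals.
From mathcomp Require Import complex.
From mathcomp Require Import zify ring lra.
Require Import Defs.

Set Implicit Arguments.
Unset Strict Implicit.
Unset Printing Implicit Defensive.

Import Order.TTheory GRing.Theory Num.Theory.

Local Open Scope ring_scope.

Arguments subspace_pred : simpl never.

(** * The symplectic Lie algebra and its representations *)

(** The point [d] enters neither the relations nor the termination order of the spanning argument,
    which concerns [V] alone. It enters through the detecting coordinates, whose degree inequality
    holds at all points of the cone simultaneously. Since [d] may lie on the boundary of the cone,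
    where ties occur, strictness is borrowed from one fixed interior point, [inner].

    [V] is known only as an irreducible module with a highest weight vector, so every computation
    takes place in the tensor space, and two transfers in opposite directions are needed. Vanishing
    of [X^N] on the highest weight vector passes from the tensor space to [V] by irreducibility.
    Linear relations among words pass from [V] to the tensor space by positivity of a Hermitian
    form, available because the ground field has a conjugation. *)

Lemma posroot_inj n (b b' : posroot n) : ri b = ri b' -> rq b = rq b' -> b = b'.
Proof.
move=> ei eq; apply: val_inj.
case: b b' ei eq => [[i q] /= h] [[i' q'] /= h']; rewrite /ri /rq /= => ei eq.
by congr (_, _); apply: val_inj.
Qed.

Section SymplecticAlgebra.
Variables (K : fieldType) (n : nat).
Implicit Types (X Y : 'M[K]_(n + n)) (b : posroot n).

(** Converse of [spP]: each row of [sp_form] has a single nonzero entry, so an entry of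
    [X^T M + M X] involves only two entries of [X]. *)
Lemma spE X (r c : 'I_(n + n)) : X \in sp K n ->
  X (rev_ord r) c * (if (r < n)%N then 1 else -1) =
  X (rev_ord c) r * (if (c < n)%N then 1 else -1).
Proof.
move=> /eqP/matrixP/(_ r c).
rewrite mxE [X in X + _]mxE [X in _ + X]mxE [RHS]mxE.
rewrite (bigD1 (rev_ord c)) //= [in X in _ + X](bigD1 (rev_ord r)) //=.
rewrite !big1 ?addr0 => [|k kr|k kc].
- rewrite [X^T _ _]mxE !sp_formE /=.
  have -> : (n + n - c.+1 + c).+1 == n + n by have := ltn_ord c; lia.
  have -> : (r + (n + n - r.+1)).+1 == n + n by have := ltn_ord r; lia.
  rewrite !mul1r [X in _ + X]mulrC.
  have -> : (n + n - c.+1 < n)%N = ~~ (c < n)%N by have := ltn_ord c; lia.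
  move/eqP; rewrite addr_eq0 => /eqP E.
  by apply: oppr_inj; rewrite -E; case: (c < n)%N; rewrite /= ?mulrN1 ?mulr1 ?opprK.
- rewrite sp_formE; case: eqP => [e|_]; last by rewrite !mul0r.
  case/negP: kr; apply/eqP/val_inj => /=.
  by have := ltn_ord k; have := ltn_ord r; lia.
- rewrite sp_formE; case: eqP => [e|_]; last by rewrite mul0r mulr0.
  case/negP: kc; apply/eqP/val_inj => /=.
  by have := ltn_ord k; have := ltn_ord c; lia.
Qed.

Fact sp_submod_closed : submod_closed (sp K n).
Proof.
split; first by rewrite inE trmx0 mul0mx mulmx0 addr0.
move=> a X Y; rewrite !inE => /eqP EX /eqP EY.
rewrite linearP /= mulmxDl mulmxDr -scalemxAl -scalemxAr addrACA -scalerDr.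
by rewrite EX EY scaler0 addr0.
Qed.
HB.instance Definition _ :=
  GRing.isSubmodClosed.Build K 'M[K]_(n + n) (sp K n) sp_submod_closed.

Lemma sp_bracket X Y : X \in sp K n -> Y \in sp K n -> mxbracket X Y \in sp K n.
Proof.
rewrite !inE !addr_eq0 => /eqP EX /eqP EY; apply/eqP.
rewrite /mxbracket linearB /= !trmx_mul mulmxBl mulmxBr -!mulmxA EX EY.
by rewrite !mulmxN !mulmxA EX EY !mulNmx !opprK opprB.
Qed.

Definition upper X := [forall r : 'I_(n + n), forall c : 'I_(n + n),
  (c < r)%N ==> (X r c == 0)].

Lemma upperP X : reflect (forall r c : 'I_(n + n), (c < r)%N -> X r c = 0) (upper X).
Proof.
apply: (iffP forallP) => [h r c cr|h r].
  by have /forallP/(_ c)/implyP/(_ cr)/eqP := h r.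
by apply/forallP => c; apply/implyP => cr; apply/eqP/h.
Qed.

Lemma strictly_upperP X :
  reflect (forall r c : 'I_(n + n), (c <= r)%N -> X r c = 0) (strictly_upper X).
Proof.
apply: (iffP forallP) => [h r c cr|h r].
  by have /forallP/(_ c)/implyP/(_ cr)/eqP := h r.
by apply/forallP => c; apply/implyP => cr; apply/eqP/h.
Qed.

Fact low_subproof b : (rq b < n + n)%N.
Proof. by have [] := posrootP b; rewrite addnn; lia. Qed.
Fact top_subproof b : ((ri b).-1 < n + n)%N.
Proof. by have [] := posrootP b; rewrite addnn; lia. Qed.

(* [root_mx b] has a single nonzero entry (low b, top b) below the diagonal and
   weakly above the antidiagonal; this entry is 1. *)
Definition low b : 'I_(n + n) := Ordinal (low_subproof b).
Definition top b : 'I_(n + n) := Ordinal (top_subproof b).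

Lemma root_mx_entry b b' : root_mx K b' (low b) (top b) = (b' == b)%:R.
Proof.
have [i0 iq iqn] := posrootP b; have [i0' iq' iqn'] := posrootP b'.
have -> : (b' == b) = (ri b' == ri b) && (rq b' == rq b).
  apply/eqP/andP => [->//|[/eqP e1 /eqP e2]]; exact: posroot_inj.
have ED (A B : 'M[K]_(n + n)) r0 c0 : (A + B) r0 c0 = A r0 c0 + B r0 c0.
  by rewrite mxE.
have EN (A : 'M[K]_(n + n)) r0 c0 : (- A) r0 c0 = - A r0 c0 by rewrite mxE.
rewrite /root_mx; case: ifP => [/eqP e|ne]; last case: ifP => qn.
- by rewrite mxE /bar /=; congr (_%:R); lia.
- rewrite ED EN [X in _ - X]Emx0 ?subr0 /bar /=; last lia.
  by rewrite mxE /=; congr (_%:R); lia.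
- rewrite ED [X in _ + X]Emx0 ?addr0 /bar /=; last lia.
  by rewrite mxE /=; congr (_%:R); lia.
Qed.

Lemma root_mx_lower b (r c : 'I_(n + n)) : (r <= c)%N -> root_mx K b r c = 0.
Proof.
have /andP[_ /forallP/(_ r)/forallP/(_ c)/implyP h] := root_mx_nminus K b.
by move=> /h/eqP.
Qed.

Lemma root_mx_sp b : root_mx K b \in sp K n.
Proof. exact/nminus_sp/root_mx_nminus. Qed.

Lemma mkrootP i q : (0 < i)%N -> (i <= q)%N -> (i + q <= n.*2)%N ->
  exists2 b : posroot n, ri b = i & rq b = q.
Proof.
move=> i0 iq iqn; have ilt : (i < n.*2)%N by lia.
have qlt : (q < n.*2)%N by lia.
have h : [&& 0 < Ordinal ilt, Ordinal ilt <= Ordinal qlt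
  & Ordinal ilt + Ordinal qlt <= n.*2]%N by apply/and3P.
by exists (exist _ (Ordinal ilt, Ordinal qlt) h).
Qed.

(** The positions [(low b, top b)] fill the part of the strict lower triangle weakly above the
    antidiagonal, and [spE] reflects the remaining entries into it. *)
Lemma sp_upperP X : X \in sp K n -> (forall b, X (low b) (top b) = 0) -> upper X.
Proof.
move=> Xsp X0.
have H (r c : 'I_(n + n)) : (c < r)%N -> (c + r < n + n)%N -> X r c = 0.
  move=> cr crn; have [|||b bi bq] := @mkrootP c.+1 r; [lia|lia|lia|].
  have -> : r = low b by apply: val_inj.
  have -> : c = top b by apply: val_inj; rewrite /= bi.
  exact: X0.
apply/upperP => r c cr; have [crn|crn] := ltnP (c + r)%N (n + n)%N; first exact: H.
have rn := ltn_ord r.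
have := spE (rev_ord r) c Xsp; rewrite rev_ordK.
rewrite [X in _ = X * _]H ?mul0r /=; [|lia..].
by move/eqP; rewrite mulf_eq0 => /orP[/eqP//|]; case: ifP; rewrite ?oppr_eq0 oner_eq0.
Qed.

Lemma sp_decomp X : X \in sp K n ->
  exists2 Y, Y \in sp K n & upper Y /\
  X = \sum_b X (low b) (top b) *: root_mx K b + Y.
Proof.
move=> Xsp; exists (X - \sum_b X (low b) (top b) *: root_mx K b).
  by rewrite rpredB ?rpred_sum // => b _; rewrite rpredZ ?root_mx_sp.
split; last by rewrite addrC subrK.
apply: sp_upperP => [|b].
  by rewrite rpredB ?rpred_sum // => b _; rewrite rpredZ ?root_mx_sp.
have EB (A B : 'M[K]_(n + n)) r0 c0 : (A - B) r0 c0 = A r0 c0 - B r0 c0.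
  by rewrite !mxE.
rewrite EB summxE (bigD1 b) //= big1 ?addr0 => [|b' /negPf bb'].
  by rewrite mxE root_mx_entry eqxx mulr1 subrr.
by rewrite mxE root_mx_entry bb' mulr0.
Qed.

Definition diag_part X : 'M[K]_(n + n) := \matrix_(r, c) (X r c *+ (r == c)).

Lemma sp_diag_part X : X \in sp K n -> diag_part X \in sp K n.
Proof.
move=> Xsp; apply: spP => r c; rewrite !mxE.
have -> : (rev_ord c == r) = (rev_ord r == c).
  by rewrite -(inj_eq (@rev_ord_inj _) (rev_ord c)) rev_ordK eq_sym.
by case: eqP => [_|_]; rewrite ?mulr0n ?mul0r // !mulr1n spE.
Qed.

Lemma diag_partP X : is_diag_mx (diag_part X).
Proof. by apply/is_diag_mxP => i j ij; rewrite mxE -val_eqE /= (negPf ij). Qed.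

Lemma upper_diag_part X : upper X -> strictly_upper (X - diag_part X).
Proof.
move=> /upperP Xu; apply/strictly_upperP => r c cr; rewrite !mxE.
by case: eqP => [->|/eqP rc]; rewrite ?subrr // subr0 Xu //; move: rc cr; rewrite -val_eqE /=; lia.
Qed.

End SymplecticAlgebra.

Lemma rpred_chain (K : fieldType) (V : lmodType K) (W : subspace V) (y x z : V) :
  x - y \in W -> y - z \in W -> x - z \in W.
Proof. by move=> xy yz; rewrite -[x](subrK y) -addrA rpredD. Qed.

Lemma span_linear_ind (K : fieldType) (V V' : lmodType K) (A : set V)
    (W : subspace V') (f : V -> V') :
  linear f -> (forall x, A x -> f x \in W) -> forall x, x \in span A -> f x \in W.
Proof.
move=> lf AW x /asboolP[k [c [w [Aw ->]]]].
pose lp := GRing.isLinear.Build K V V' _ f lf.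
pose g : {linear V -> V'} := HB.pack f lp.
rewrite -[f _]/(g _) linear_sum rpred_sum // => i _.
by rewrite linearZ rpredZ //; apply: AW.
Qed.

(** * Words in the root vectors, modulo shorter words *)

Section Representation.
Variables (K : fieldType) (n : nat) (E : lie_rep (sp K n)).
Implicit Types (X Y : 'M[K]_(n + n)) (v : E) (b : posroot n) (s : seq (posroot n)).

(* Total version of [rho]: matrices outside sp act by zero. *)
Definition mact X v : E :=
  if insub X is Some x then rho (x : lie_elt (sp K n)) v else 0.

Lemma mact_rho (x : lie_elt (sp K n)) v : mact (val x) v = rho x v.
Proof. by rewrite /mact valK. Qed.

Lemma mactE X (XP : X \in sp K n) v : mact X v = rho (Sub X XP : lie_elt (sp K n)) v.
Proof. by rewrite -mact_rho SubK. Qed.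

Fact mact_is_linear X : linear (mact X).
Proof.
move=> a u v; rewrite /mact; case: insubP => [x _ _|_]; first exact: rho_linear.
by rewrite scaler0 addr0.
Qed.
HB.instance Definition _ X := GRing.isLinear.Build K E E _ (mact X) (mact_is_linear X).

Lemma mactP a X Y v : X \in sp K n -> Y \in sp K n ->
  mact (a *: X + Y) v = a *: mact X v + mact Y v.
Proof.
move=> XP YP; have ZP : a *: X + Y \in sp K n by rewrite rpredD // rpredZ.
by rewrite (mactE ZP) (mactE XP) (mactE YP); apply: rho_add; rewrite !SubK.
Qed.

Lemma mact0 v : mact 0 v = 0.
Proof.
have /(@mactP 1 0 0 v)/(_ (rpred0 _)) := rpred0 (sp K n).
rewrite scaler0 addr0 scale1r => /eqP.
by rewrite -subr_eq0 opprD addrA subrr sub0r oppr_eq0 => /eqP.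
Qed.

Lemma mactD X Y v : X \in sp K n -> Y \in sp K n ->
  mact (X + Y) v = mact X v + mact Y v.
Proof. by move=> XP YP; rewrite -[X]scale1r mactP // !scale1r. Qed.

Lemma mactZ a X v : X \in sp K n -> mact (a *: X) v = a *: mact X v.
Proof. by move=> XP; rewrite -[a *: X]addr0 mactP ?rpred0 // mact0 addr0. Qed.

Lemma mact_sum (I : Type) (r : seq I) (P : pred I) (c : I -> K) (X : I -> 'M[K]_(n + n)) v :
  (forall i, X i \in sp K n) ->
  mact (\sum_(i <- r | P i) c i *: X i) v = \sum_(i <- r | P i) c i *: mact (X i) v.
Proof.
move=> XP; suff [] : mact (\sum_(i <- r | P i) c i *: X i) v =
    \sum_(i <- r | P i) c i *: mact (X i) v /\ \sum_(i <- r | P i) c i *: X i \in sp K n by [].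
elim/big_rec2: _ => [|i y1 y2 _ [<- yP]]; first by rewrite mact0 rpred0.
by rewrite mactP // rpredD // rpredZ.
Qed.

Lemma mact_bracket X Y v : X \in sp K n -> Y \in sp K n ->
  mact X (mact Y v) = mact Y (mact X v) + mact (mxbracket X Y) v.
Proof.
move=> XP YP; have ZP := sp_bracket XP YP.
rewrite (mactE ZP) !(mactE XP) !(mactE YP).
rewrite (@rho_bracket _ _ _ E (Sub X XP) (Sub Y YP) (Sub (mxbracket X Y) ZP)) ?SubK //.
by rewrite addrCA subrr addr0.
Qed.

Definition froot b v : E := mact (root_mx K b) v.
HB.instance Definition _ b := GRing.isLinear.Build K E E _ (froot b) (mact_is_linear (root_mx K b)).

Lemma mactB X : {morph mact X : u v / u - v}.
Proof. exact: raddfB. Qed.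

Lemma frootB b : {morph froot b : u v / u - v}.
Proof. exact: raddfB. Qed.

Definition fword s v : E := foldr froot v s.

Lemma fword_cat s1 s2 v : fword (s1 ++ s2) v = fword s1 (fword s2 v).
Proof. by rewrite /fword foldr_cat. Qed.

Fact fword_is_linear s : linear (fword s).
Proof.
by move=> a u v; elim: s => //= b s IH; rewrite -linearP -IH.
Qed.
HB.instance Definition _ s := GRing.isLinear.Build K E E _ (fword s) (fword_is_linear s).

(** The bound is strict so that [short_span v (size s)] holds the lower order terms of the word [s];
    modulo these the letters commute ([fword_perm]). *)
Definition short_span (v : E) (N : nat) : subspace E :=
  span [set u | exists2 s, (size s < N)%N & u = fword s v]%classic.

Lemma fword_short v s N : (size s < N)%N -> fword s v \in short_span v N.
Proof. by move=> sN; apply: span_mem; exists s. Qed.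

Lemma short_span_sub v N N' : (N <= N')%N ->
  {subset short_span v N <= short_span v N'}.
Proof.
by move=> NN'; apply: span_ind => _ [s sN ->]; apply/fword_short/(leq_trans sN).
Qed.

Lemma froot_short v b N u : u \in short_span v N -> froot b u \in short_span v N.+1.
Proof.
by apply: span_linear_ind (mact_is_linear _) _ _ => _ [s sN ->]; apply: (@fword_short v (b :: s)).
Qed.

Lemma fword_short_cat v s N u :
  u \in short_span v N -> fword s u \in short_span v (size s + N).
Proof. by move=> uN; elim: s => //= b s IH; apply: froot_short. Qed.

Definition upper_eigen v := forall X, X \in sp K n -> upper X ->
  exists a, mact X v = a *: v.

Variable v0 : E.
Hypothesis v0_eigen : upper_eigen v0.

(** Stated for a single [u] on which upper triangular elements are already controlled, so that it
    can serve inside the induction of [mact_upper_short] that establishes this control. *)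
Lemma mact_short_decomp X N u : X \in sp K n ->
  (forall Y, Y \in sp K n -> upper Y -> mact Y u \in short_span v0 N) ->
  u \in short_span v0 N -> mact X u \in short_span v0 N.+1.
Proof.
move=> XP upu uN; have [Y YP [Yu ->]] := sp_decomp XP.
have SP : \sum_b X (low b) (top b) *: root_mx K b \in sp K n.
  by rewrite rpred_sum // => b _; rewrite rpredZ ?root_mx_sp.
rewrite mactD // rpredD //; last exact: short_span_sub (upu _ _ _).
rewrite mact_sum => [|b]; last exact: root_mx_sp.
by rewrite rpred_sum // => b _; rewrite rpredZ // froot_short.
Qed.

(** Moving [X] past the first letter leaves a bracket that need not be upper triangular, but it acts
    on a word with one letter less and adds back at most one. *)
Lemma mact_upper_short X N u : X \in sp K n -> upper X ->
  u \in short_span v0 N -> mact X u \in short_span v0 N.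
Proof.
move=> XP Xu; apply: span_linear_ind (mact_is_linear _) _ _ => _ [s sN ->].
elim: s X XP Xu N sN => [|b s IH] X XP Xu N sN.
  rewrite -[fword [::] v0]/v0; have [a ->] := v0_eigen XP Xu; rewrite rpredZ //.
  exact: (@fword_short v0 [::]).
case: N sN => // N sN; rewrite [fword _ _]/= /froot mact_bracket ?root_mx_sp //.
have sN' : fword s v0 \in short_span v0 N by exact: fword_short.
apply: rpredD; first by apply: froot_short; apply: IH.
by apply: mact_short_decomp; rewrite ?sp_bracket ?root_mx_sp // => Y YP Yu; exact: IH.
Qed.

Lemma mact_short X N u : X \in sp K n ->
  u \in short_span v0 N -> mact X u \in short_span v0 N.+1.
Proof.
by move=> XP uN; apply: mact_short_decomp => // Y YP Yu; apply: mact_upper_short.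
Qed.

Lemma froot_comm_short s1 b b' s2 :
  fword (s1 ++ b :: b' :: s2) v0 - fword (s1 ++ b' :: b :: s2) v0
    \in short_span v0 (size s1 + size s2).+2.
Proof.
rewrite !fword_cat -linearB /= {1}/froot [mact _ (froot b' _)]mact_bracket ?root_mx_sp //.
rewrite [_ + mact (mxbracket _ _) _]addrC addrK.
rewrite -!addnS; apply/fword_short_cat/mact_short; last exact: fword_short.
by rewrite sp_bracket ?root_mx_sp.
Qed.

Lemma fword_perm_cons s1 b s2 :
  fword (b :: s1 ++ s2) v0 - fword (s1 ++ b :: s2) v0
    \in short_span v0 (size s1 + size s2).+1.
Proof.
elim: s1 => [|b1 s1 IH] /=; first by rewrite subrr rpred0.
apply: (rpred_chain (y := froot b1 (froot b (fword (s1 ++ s2) v0)))).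
  have := @froot_comm_short [::] b b1 (s1 ++ s2).
  by rewrite size_cat add0n addSn.
by rewrite -frootB addSn; apply: froot_short.
Qed.

Lemma fword_perm s s' : perm_eq s s' ->
  fword s v0 - fword s' v0 \in short_span v0 (size s).
Proof.
elim: s s' => [|b s IH] s' ss'.
  by move: ss'; rewrite perm_sym => /perm_nilP ->; rewrite subrr rpred0.
have bs' : b \in s' by rewrite -(perm_mem ss') mem_head.
case/splitPr: bs' ss' => s1 s2; rewrite perm_sym perm_catC /= perm_cons perm_sym => ss'.
have {}ss' : perm_eq s (s1 ++ s2) by rewrite (perm_trans ss') // perm_catC.
apply: (rpred_chain (y := fword (b :: s1 ++ s2) v0)).
  by rewrite /= -frootB; apply: froot_short; apply: IH.
have -> : (size s).+1 = (size s1 + size s2).+1 by rewrite (perm_size ss') size_cat.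
exact: fword_perm_cons.
Qed.

Definition lower_act X v : E := \sum_b X (low b) (top b) *: froot b v.

(* The upper triangular part of [X] does not increase the length of words. *)
Lemma mact_power X N (XP : X \in sp K n) :
  iter N (mact X) v0 - iter N (lower_act X) v0 \in short_span v0 N /\
  iter N (lower_act X) v0 \in short_span v0 N.+1.
Proof.
elim: N => [|N [IH1 IH2]].
  by rewrite subrr rpred0; split => //; apply: (@fword_short v0 [::]).
rewrite !iterS; set Z := iter N (lower_act X) v0 in IH1 IH2 *; split; last first.
  by rewrite rpred_sum // => b _; rewrite rpredZ // froot_short.
apply: (rpred_chain (y := mact X Z)).
  by rewrite -mactB; exact: mact_short XP IH1.
have [Y YP [Yu XE]] := sp_decomp XP.
rewrite {1}XE mactD ?rpred_sum // => [|b _]; last by rewrite rpredZ ?root_mx_sp.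
rewrite mact_sum => [|b]; last exact: root_mx_sp.
by rewrite addrAC subrr add0r mact_upper_short.
Qed.

Definition fspan : subspace E := span [set u | exists s, u = fword s v0]%classic.

Lemma fspan_short u : u \in fspan -> exists N, u \in short_span v0 N.
Proof.
move=> /asboolP[k [c [w [Aw ->]]]].
elim/big_ind: _ => [|x y [N1 h1] [N2 h2]|i _]; first by exists 0%N; rewrite rpred0.
  exists (maxn N1 N2); rewrite rpredD //.
    by apply: short_span_sub h1; apply: leq_maxl.
  by apply: short_span_sub h2; apply: leq_maxr.
by have [s ->] := Aw i; exists (size s).+1; rewrite rpredZ // fword_short.
Qed.

Lemma short_fspan N : {subset short_span v0 N <= fspan}.
Proof. by apply: span_ind => _ [s _ ->]; apply: span_mem; exists s. Qed.

Lemma mact_fspan X u : u \in fspan -> mact X u \in fspan.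
Proof.
have [XP|XP] := boolP (X \in sp K n).
  by move=> /fspan_short[N uN]; apply/short_fspan/mact_short/uN.
by rewrite /mact insubN // rpred0.
Qed.

End Representation.

(** * The tensor model of the highest weight module *)

(* The tensor product over j of the k_j-th tensor powers of the vector
   representation, in coordinates: a slot (j, a) is the a-th factor of the j-th
   block, and a tensor is a function of multi-indices, which assign a basis
   vector to every slot. *)
Section TensorModel.
Variables (K : numClosedFieldType) (n m : nat) (k : 'I_m -> nat).
Hypothesis k_le : forall j, (k j <= n)%N.

Definition slot := {t : 'I_m * 'I_n | (t.2 < k t.1)%N}.
HB.instance Definition _ := Finite.on slot.
Definition blk (t : slot) : 'I_m := (val t).1.
Definition pos (t : slot) : 'I_(n + n) := lshift n (val t).2.

Definition multi := {ffun slot -> 'I_(n + n)}.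
Definition tensor := {ffun multi -> K^o}.
HB.instance Definition _ := GRing.Lmodule.on tensor.
Implicit Types (t : slot) (I : multi) (phi psi : tensor) (X Y : 'M[K]_(n + n)).

Lemma pos_lt t : (pos t < k (blk t))%N.
Proof. exact: valP t. Qed.

Lemma pos_ltn t : (pos t < n)%N.
Proof. exact: leq_trans (pos_lt t) (k_le _). Qed.

Lemma slot_inj t t' : blk t = blk t' -> pos t = pos t' :> nat -> t = t'.
Proof.
case: t t' => [[j a] /= h] [[j' a'] /= h']; rewrite /blk /pos /= => ej ea.
by apply: val_inj => /=; congr (_, _) => //; apply: val_inj.
Qed.

Lemma slotP (j : 'I_m) (a : nat) : (a < k j)%N -> exists2 t, blk t = j & pos t = a :> nat.
Proof.
move=> ak; have an : (a < n)%N by apply: leq_trans (k_le j).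
by exists (exist (fun x : 'I_m * 'I_n => x.2 < k x.1)%N (j, Ordinal an) ak).
Qed.

Definition upd I t a : multi := [ffun t' => if t' == t then a else I t'].

Lemma upd_same I t a : upd I t a t = a. Proof. by rewrite ffunE eqxx. Qed.
Lemma upd_other I t a t' : t' != t -> upd I t a t' = I t'.
Proof. by rewrite ffunE => /negPf ->. Qed.
Lemma upd_upd I t a b : upd (upd I t a) t b = upd I t b.
Proof. by apply/ffunP => t'; rewrite !ffunE; case: eqP. Qed.
Lemma upd_comm I t t' a b : t != t' ->
  upd (upd I t a) t' b = upd (upd I t' b) t a.
Proof.
move=> tt'; apply/ffunP => t''; rewrite !ffunE.
by case: (t'' =P t) => [->|//]; rewrite (negPf tt').
Qed.
Lemma upd_id I t : upd I t (I t) = I.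
Proof. by apply/ffunP => t'; rewrite ffunE; case: eqP => [->|]. Qed.

Definition slot_act t X phi : tensor :=
  [ffun I : multi => \sum_a X (I t) a * phi (upd I t a)].
Definition tensor_act X phi : tensor := \sum_t slot_act t X phi.

Lemma slot_act_linear t X : linear (slot_act t X).
Proof.
move=> c u v; apply/ffunP => I; rewrite !ffunE /GRing.scale /= mulr_sumr -big_split /=.
by apply: eq_bigr => a _; rewrite !ffunE /GRing.scale /=; ring.
Qed.
HB.instance Definition _ t X :=
  GRing.isLinear.Build K tensor tensor _ (slot_act t X) (slot_act_linear t X).

Lemma slot_actP c t X Y phi :
  slot_act t (c *: X + Y) phi = c *: slot_act t X phi + slot_act t Y phi.
Proof.
apply/ffunP => I; rewrite !ffunE /GRing.scale /= mulr_sumr -big_split /=.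
by apply: eq_bigr => a _; rewrite !mxE; ring.
Qed.

Lemma slot_act_mul t X Y phi :
  slot_act t X (slot_act t Y phi) = slot_act t (X *m Y) phi.
Proof.
apply/ffunP => I; rewrite !ffunE.
under eq_bigr => a _.
  rewrite ffunE upd_same mulr_sumr.
  by under eq_bigr => b _ do rewrite upd_upd mulrA; over.
rewrite exchange_big /=; apply: eq_bigr => b _.
by rewrite mxE mulr_suml.
Qed.

Lemma slot_act_comm t t' X Y phi : t != t' ->
  slot_act t X (slot_act t' Y phi) = slot_act t' Y (slot_act t X phi).
Proof.
move=> tt'; apply/ffunP => I; rewrite !ffunE.
under eq_bigr => a _.
  rewrite ffunE upd_other; last by rewrite eq_sym.
  rewrite mulr_sumr.
  by under eq_bigr => b _ do rewrite upd_comm // mulrCA; over.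
rewrite exchange_big /=; apply: eq_bigr => b _.
by rewrite ffunE upd_other // mulr_sumr.
Qed.

Lemma tensor_act_linear X : linear (tensor_act X).
Proof.
move=> c u v; rewrite /tensor_act scaler_sumr -big_split /=.
by apply: eq_bigr => t _; rewrite linearP.
Qed.
HB.instance Definition _ X :=
  GRing.isLinear.Build K tensor tensor _ (tensor_act X) (tensor_act_linear X).

Lemma tensor_actP c X Y phi :
  tensor_act (c *: X + Y) phi = c *: tensor_act X phi + tensor_act Y phi.
Proof.
rewrite /tensor_act scaler_sumr -big_split /=.
by apply: eq_bigr => t _; rewrite slot_actP.
Qed.

Lemma tensor_act_bracket X Y phi : tensor_act (mxbracket X Y) phi =
  tensor_act X (tensor_act Y phi) - tensor_act Y (tensor_act X phi).
Proof.
have E A B : tensor_act A (tensor_act B phi) =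
    \sum_t \sum_t' slot_act t A (slot_act t' B phi).
  by apply: eq_bigr => t _; rewrite linear_sum.
rewrite !E [X in _ - X]exchange_big /= -sumrB; apply: eq_bigr => t _.
rewrite -sumrB (bigD1 t) //= big1 ?addr0 => [|t' tt'].
  rewrite !slot_act_mul /mxbracket [_ - _]addrC -scaleN1r slot_actP scaleN1r.
  by rewrite addrC.
by rewrite slot_act_comm ?subrr // eq_sym.
Qed.

Definition tensor_rho (x : lie_elt (sp K n)) phi := tensor_act (val x) phi.

Definition tensor_rep : lie_rep (sp K n).
Proof.
refine (@LieRep K _ (sp K n) tensor tensor_rho _ _ _).
- by move=> x; apply: tensor_act_linear.
- by move=> a x y z e v; rewrite /tensor_rho e tensor_actP.
- by move=> x y z e v; rewrite /tensor_rho e tensor_act_bracket.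
Defined.

Lemma mact_tensor X phi : X \in sp K n -> mact (E := tensor_rep) X phi = tensor_act X phi.
Proof. by move=> XP; rewrite (mactE XP). Qed.

(** Bilinear rather than Hermitian, so that adjoints are plain transposes; positivity comes back by
    pairing with [conj_tensor]. *)
Definition form phi psi : K := \sum_I phi I * psi I.

Lemma formC phi psi : form phi psi = form psi phi.
Proof. by apply: eq_bigr => I _; rewrite mulrC. Qed.

Fact form_is_linear phi : linear_for *%R (form phi).
Proof.
move=> a u v; rewrite /form mulr_sumr -big_split /=; apply: eq_bigr => I _.
by rewrite !ffunE /GRing.scale /=; ring.
Qed.
HB.instance Definition _ phi :=
  GRing.isLinear.Build K tensor K _ (form phi) (form_is_linear phi).

Lemma form_slot_act t X phi psi :
  form (slot_act t X phi) psi = form phi (slot_act t X^T psi).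
Proof.
rewrite /form.
under eq_bigr => I _ do rewrite ffunE mulr_suml.
under [RHS]eq_bigr => I _ do rewrite ffunE mulr_sumr.
rewrite !pair_big /=.
(* Exchanges the entry of the multi-index in slot [t] with the summation index. *)
pose h (p : multi * 'I_(n + n)) := (upd p.1 t p.2, p.1 t).
have hK : involutive h.
  by case=> I a; rewrite /h /= upd_upd upd_id upd_same.
rewrite [RHS](reindex_inj (inv_inj hK)) /=; apply: eq_bigr => -[I a] _ /=.
by rewrite upd_upd upd_id mxE upd_same; ring.
Qed.

Lemma form_tensor_act X phi psi :
  form (tensor_act X phi) psi = form phi (tensor_act X^T psi).
Proof.
rewrite formC /tensor_act !linear_sum; apply: eq_bigr => t _.
exact: etrans (formC _ _) (form_slot_act _ _ _ _).
Qed.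

Definition conj_tensor phi : tensor := [ffun I => (phi I)^*].

Lemma form_conj phi : form (conj_tensor phi) phi = 0 -> phi = 0.
Proof.
move=> /eqP; rewrite psumr_eq0 => [/allP phi0|I _]; last first.
  by rewrite ffunE mulrC mul_conjC_ge0.
apply/ffunP => I; have := phi0 I (mem_index_enum _).
by rewrite ffunE mulrC mul_conjC_eq0 => /eqP ->; rewrite ffunE.
Qed.

Lemma conj_tensor_act X phi : (forall r c, (X r c)^* = X r c) ->
  conj_tensor (tensor_act X phi) = tensor_act X (conj_tensor phi).
Proof.
move=> Xr; apply/ffunP => I; rewrite ffunE /tensor_act !sum_ffunE rmorph_sum.
apply: eq_bigr => t _; rewrite !ffunE rmorph_sum; apply: eq_bigr => a _.
by rewrite rmorphM /= Xr ffunE.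
Qed.

Definition blk_perm : pred {perm slot} :=
  [pred s : {perm slot} | [forall t, blk (s t) == blk t]].

Lemma blk_permP (s : {perm slot}) : reflect (forall t, blk (s t) = blk t) (blk_perm s).
Proof. by apply: (iffP forallP) => h t; [apply/eqP|rewrite h]. Qed.

Implicit Types (y : slot -> 'cV[K]_(n + n)) (u v : 'cV[K]_(n + n)).

(* The tensor product over all blocks of the wedge products of the vectors
   [y t], t running over the block. *)
Definition wedge y : tensor := [ffun I : multi =>
  \sum_(s | blk_perm s) (-1) ^+ s * \prod_t y (s t) (I t) 0].

Lemma wedgeE y I : wedge y I =
  \sum_(s | blk_perm s) (-1) ^+ s * \prod_t y (s t) (I t) 0.
Proof. by rewrite ffunE. Qed.

Lemma tensorE a phi psi I : (a *: phi + psi) I = a * phi I + psi I.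
Proof. by rewrite !ffunE. Qed.

Definition updv y t u t' := if t' == t then u else y t'.

Lemma eq_wedge y y' : (forall t, y t = y' t) -> wedge y = wedge y'.
Proof.
move=> e; apply/ffunP => I; rewrite !wedgeE; apply: eq_bigr => s _; congr (_ * _).
by apply: eq_bigr => t _; rewrite e.
Qed.

Lemma prod_updv y t u I (s : {perm slot}) :
  \prod_t' updv y (s t) u (s t') (I t') 0 =
  u (I t) 0 * \prod_(t' | t' != t) y (s t') (I t') 0.
Proof.
rewrite (bigD1 t) //= /updv eqxx; congr (_ * _).
by apply: eq_bigr => t' tt'; rewrite (inj_eq perm_inj) (negPf tt').
Qed.

Lemma wedge_linear y t : linear (fun u => wedge (updv y t u)).
Proof.
move=> a u v; apply/ffunP => I; rewrite [RHS]tensorE !wedgeE mulr_sumr -big_split /=.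
apply: eq_bigr => s _; rewrite -(permKV s t).
rewrite !prod_updv.
rewrite [in LHS]mxE [in LHS]mxE.
by rewrite mulrDl mulrDr mulrA !mulrA [_ * a]mulrC.
Qed.

Lemma wedge_sum y t (J : finType) (c : J -> K) (w : J -> 'cV[K]_(n + n)) :
  wedge (updv y t (\sum_j c j *: w j)) = \sum_j c j *: wedge (updv y t (w j)).
Proof.
pose lp := GRing.isLinear.Build K _ tensor _ _ (wedge_linear y t).
pose f : {linear 'cV[K]_(n + n) -> tensor} := HB.pack (fun u => wedge (updv y t u)) lp.
rewrite -[LHS]/(f _) linear_sum; apply: eq_bigr => j _; exact: linearZ.
Qed.

Lemma wedgeZ y t a u : wedge (updv y t (a *: u)) = a *: wedge (updv y t u).
Proof.
by have := @wedge_sum y t 'I_1 (fun=> a) (fun=> u); rewrite !big_ord1.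
Qed.

Lemma wedge0 y t : wedge (updv y t 0) = 0.
Proof. by rewrite -[0 in LHS](scale0r 0) wedgeZ scale0r. Qed.

Lemma wedge_alt y t1 t2 : t1 != t2 -> blk t1 = blk t2 -> y t1 = y t2 -> wedge y = 0.
Proof.
move=> t12 b12 y12; apply/ffunP => I; rewrite [RHS]ffunE; apply/eqP.
suff : wedge y I = - wedge y I.
  by move/eqP; rewrite -addr_eq0 -mulr2n mulrn_eq0.
pose tau := tperm t1 t2.
have ytau t : y (tau t) = y t by rewrite /tau; case: tpermP => // ->.
have btau t : blk (tau t) = blk t by rewrite /tau; case: tpermP => // ->.
rewrite !wedgeE [LHS](reindex_inj (mulIg tau)) -sumrN /=; apply: eq_big => s.
  by apply/blk_permP/blk_permP => h t; have := h t; rewrite permM btau.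
move=> _; rewrite odd_permM odd_tperm t12 addbT signrN mulNr; congr (- (_ * _)).
by apply: eq_bigr => t _; rewrite permM ytau.
Qed.

Lemma tensor_act_wedge X y :
  tensor_act X (wedge y) = \sum_t wedge (updv y t (X *m y t)).
Proof.
apply/ffunP => I; rewrite !sum_ffunE.
under eq_bigr => t _.
  rewrite ffunE; under eq_bigr => a _ do rewrite wedgeE mulr_sumr; over.
under [RHS]eq_bigr => t _ do rewrite wedgeE.
rewrite [RHS]exchange_big /=.
under eq_bigr => t _ do rewrite exchange_big.
rewrite exchange_big /=; apply: eq_bigr => s _.
rewrite [RHS](reindex_inj (@perm_inj _ s)) /=; apply: eq_bigr => t _.
rewrite prod_updv mxE mulrA -mulrA mulr_suml mulr_sumr; apply: eq_bigr => a _.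
rewrite (bigD1 t) //= upd_same.
have -> : \prod_(i | i != t) y (s i) (upd I t a i) 0 = \prod_(t' | t' != t) y (s t') (I t') 0.
  by apply: eq_bigr => t' tt'; rewrite upd_other.
by rewrite mulrCA !mulrA.
Qed.

Definition evec (c : 'I_(n + n)) : 'cV[K]_(n + n) := delta_mx c 0.

Lemma vec_sum u : u = \sum_c u c 0 *: evec c.
Proof. by rewrite [LHS]matrix_sum_delta; apply: eq_bigr => c _; rewrite big_ord1. Qed.

Lemma mulmx_evec X c : X *m evec c = col c X.
Proof. by rewrite colE. Qed.

(* Expanding the vector in slot t over the basis, every term but one repeats a
   vector of the block. *)
Lemma wedge_block y t u : y t = evec (pos t) ->
  (forall t', blk t' = blk t -> t' != t -> y t' = evec (pos t')) ->
  (forall c : 'I_(n + n), (k (blk t) <= c)%N -> u c 0 = 0) ->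
  wedge (updv y t u) = u (pos t) 0 *: wedge y.
Proof.
move=> yt yb u0; rewrite [u in LHS]vec_sum wedge_sum (bigD1 (pos t)) //= big1 ?addr0.
  congr (_ *: _); apply: eq_wedge => t'; rewrite /updv; case: eqP => [->|//].
  by rewrite yt.
move=> c ct; have [kc|ck] := leqP (k (blk t)) c; first by rewrite u0 ?scale0r.
have [t' bt' pt'] := slotP ck.
have t't : t' != t by apply: contra_neq ct => <-; apply: val_inj.
rewrite (@wedge_alt _ t' t) ?scaler0 // /updv eqxx (negPf t't) yb //.
by congr evec; apply: val_inj.
Qed.

(** The tensor product over j of the highest weight vectors of the exterior powers of degree
    [k j]. *)
Definition hw_tensor := wedge (fun t => evec (pos t)).

Lemma hw_tensor_upper X : upper X ->
  tensor_act X hw_tensor = (\sum_t X (pos t) (pos t)) *: hw_tensor.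
Proof.
move=> /upperP Xu; rewrite tensor_act_wedge scaler_suml; apply: eq_bigr => t _.
rewrite mulmx_evec wedge_block // => [|c kc]; first by rewrite mxE.
by rewrite mxE Xu // (leq_trans (pos_lt t)).
Qed.

Lemma hw_tensor_eval I : hw_tensor I != 0 ->
  exists2 s : {perm slot}, blk_perm s & forall t, I t = pos (s t).
Proof.
rewrite wedgeE => I0; have [s bs h] : exists2 s, blk_perm s &
    (-1) ^+ s * \prod_t evec (pos (s t)) (I t) 0 != 0.
  apply/exists_inP; rewrite -negb_forall_in; apply: contra I0 => /forall_inP h.
  by rewrite big1 // => s /h/eqP.
exists s => // t; move: h; rewrite (bigD1 t) //= mxE andbT.
by case: (I t =P pos (s t)) => // _; rewrite mulr0n mul0r mulr0 eqxx.
Qed.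

Lemma hw_tensor_pos : hw_tensor [ffun t => pos t] = 1.
Proof.
rewrite wedgeE (bigD1 1%g) /=; last by apply/blk_permP => t; rewrite perm1.
rewrite odd_perm1 mul1r [X in _ + X]big1 => [|s /andP[/blk_permP bs s1]].
  rewrite addr0 big1 // => t _; rewrite perm1 mxE ffunE !eqxx //.
have [t st] : exists t, s t != t.
  apply/existsP; rewrite -negb_forall; apply: contra s1 => /forallP h.
  by apply/eqP/permP => t; rewrite perm1; apply/eqP.
rewrite (bigD1 t) //= ffunE mxE andbT.
have -> : (pos t == pos (s t)) = false.
  apply: contraNF st => /eqP e; apply/eqP/slot_inj; [exact: bs|by rewrite e].
by rewrite mulr0n mul0r mulr0.
Qed.

Section PowerKill.
Variables (X : 'M[K]_(n + n)) (u : 'cV[K]_(n + n)) (v : 'I_(n + n) -> K) (G : pred nat).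
Hypothesis Xe : forall t, X *m evec (pos t) = v (pos t) *: u.
Hypothesis Xu : X *m u = 0.
(** [X] acts by zero on the initial wedge of a block outside [G]: either it kills all basis vectors
    of the block, or it maps their span to itself with trace zero. *)
Hypothesis bad : forall j, ~~ G (k j) ->
  (forall t, blk t = j -> v (pos t) = 0) \/
  (forall c : 'I_(n + n), (k j <= c)%N -> u c 0 = 0) /\
  \sum_(t | blk t == j) v (pos t) * u (pos t) 0 = 0.

Let yset (U : {set slot}) t := if t \in U then u else evec (pos t).

Definition used_span (N : nat) : subspace tensor :=
  span [set phi | exists2 U : {set slot}, #|U| = N /\ (forall t, t \in U -> G (k (blk t))) &
    phi = wedge (yset U)]%classic.

Lemma used_span_step N phi : phi \in used_span N -> tensor_act X phi \in used_span N.+1.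
Proof.
apply: span_linear_ind (tensor_act_linear X) _ _ => _ [U [UN UG] ->].
rewrite tensor_act_wedge (partition_big blk predT) //= rpred_sum // => j _.
have upE t : t \notin U -> X *m yset U t = v (pos t) *: u.
  by rewrite /yset => /negPf ->.
have [Gj|/[dup] Gj /bad bj] := boolP (G (k j)).
  rewrite rpred_sum // => t /eqP tj; have [tU|tU] := boolP (t \in U).
    by rewrite {2}/yset tU Xu wedge0 rpred0.
  rewrite upE // wedgeZ rpredZ //; apply: span_mem; exists (t |: U).
    split; first by rewrite cardsU1 tU UN.
    by move=> t'; rewrite in_setU1 => /orP[/eqP ->|/UG//]; rewrite tj.
  by apply: eq_wedge => t'; rewrite /updv /yset in_setU1; case: eqP.
have jU t : blk t = j -> t \notin U.
  by move=> tj; apply: contra Gj => /UG; rewrite tj.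
case: bj => [v0|[u0 vu]].
  by rewrite big1 ?rpred0 // => t /eqP tj; rewrite upE ?jU // v0 // scale0r wedge0.
suff -> : \sum_(t | blk t == j) wedge (updv (yset U) t (X *m yset U t)) =
    (\sum_(t | blk t == j) v (pos t) * u (pos t) 0) *: wedge (yset U).
  by rewrite vu scale0r rpred0.
rewrite scaler_suml; apply: eq_bigr => t /eqP tj.
rewrite upE ?jU // wedgeZ wedge_block ?scalerA //.
- by rewrite /yset (negPf (jU _ tj)).
- by move=> t' tt' _; rewrite /yset (negPf (jU _ _)) // tt'.
- by move=> c; rewrite tj; apply: u0.
Qed.

(* X replaces basis vectors by multiples of u, and only one slot of each good
   block can be used. *)
Lemma power_kill N : (#|[pred j | G (k j)]| < N)%N -> iter N (tensor_act X) hw_tensor = 0.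
Proof.
move=> GN; have : iter N (tensor_act X) hw_tensor \in used_span N.
  elim: N {GN} => [|N IH]; last exact: used_span_step.
  apply: span_mem; exists finset.set0; first by rewrite cards0; split => // t; rewrite inE.
  by apply: eq_wedge => t; rewrite /yset inE.
move=> /asboolP[l [c [w [wA ->]]]]; rewrite big1 // => i _.
have [U [UN UG ->]] := wA i.
have [/dinjectiveP inj|/dinjectivePn[t1 t1U [t2 /andP[/= t21 t2U] b12]]] :=
    boolP (dinjectiveb blk U).
  suff : (#|U| <= #|[pred j | G (k j)]|)%N by rewrite UN leqNgt GN.
  rewrite -(card_in_imset inj); apply: subset_leq_card; apply/fintype.subsetP => j.
  by move=> /imsetP[t tU ->]; rewrite inE UG.
by rewrite (@wedge_alt _ t2 t1) ?scaler0 // /yset t1U t2U.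
Qed.

End PowerKill.

End TensorModel.

(** * Transfer between an irreducible module and the tensor model *)

Section ProductRepresentation.
Variables (K : fieldType) (n : nat) (V1 V2 : lie_rep (sp K n)).

Definition prod_rho (x : lie_elt (sp K n)) (v : V1 * V2) : V1 * V2 :=
  (rho x v.1, rho x v.2).

Definition prod_rep : lie_rep (sp K n).
Proof.
refine (@LieRep K _ (sp K n) (V1 * V2)%type prod_rho _ _ _).
- by move=> x a u v; rewrite /prod_rho /= !rho_linear.
- by move=> a x y z e v; rewrite /prod_rho !(rho_add e).
- by move=> x y z e v; rewrite /prod_rho !(rho_bracket e).
Defined.

Lemma mact_prod X (v : prod_rep) : mact X v = (mact X v.1, mact X v.2).
Proof. by rewrite /mact; case: insubP. Qed.

Lemma iter_mact_prod N X (v : prod_rep) :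
  iter N (mact X) v = (iter N (mact X) v.1, iter N (mact X) v.2).
Proof.
by elim: N => [|N IH]; [rewrite -surjective_pairing|rewrite !iterS mact_prod IH].
Qed.

Lemma fword_prod s (v : prod_rep) : fword s v = (fword s v.1, fword s v.2).
Proof.
by elim: s => [|b s IH] /=; [rewrite -surjective_pairing|rewrite {1}/froot IH mact_prod].
Qed.

End ProductRepresentation.

(** * Weights and highest weight vectors *)

Section Weights.
Variables (K : numFieldType) (n : nat).
Implicit Types (b : posroot n) (s : seq (posroot n)).

Lemma diag_bracket_entry d (A : 'M[K]_(n + n)) r c :
  mxbracket (diag_mx d) A r c = (d 0 r - d 0 c) * A r c.
Proof. by rewrite /mxbracket mul_diag_mx mul_mx_diag !mxE; ring. Qed.

Lemma root_mx_supp b (r c : 'I_(n + n)) : root_mx K b r c != 0 ->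
  r = low b /\ c = top b \/ r = rev_ord (top b) /\ c = rev_ord (low b).
Proof.
have [i0 iq iqn] := posrootP b.
have E (A B : 'M[K]_(n + n)) r0 c0 : (A + B) r0 c0 = A r0 c0 + B r0 c0.
  by rewrite mxE.
have EN (A : 'M[K]_(n + n)) r0 c0 : (- A) r0 c0 = - A r0 c0 by rewrite mxE.
have H (a a' : nat) : Emx K n a a' r c != 0 -> r.+1 = a /\ c.+1 = a'.
  by rewrite mxE; case: andP => [[/eqP ? /eqP ?]|]; rewrite ?eqxx.
have D (x y : K) : x + y != 0 -> x != 0 \/ y != 0.
  by have [->|] := eqVneq x 0; rewrite ?add0r; [right|left].
have cn := ltn_ord c; have rn := ltn_ord r.
rewrite /root_mx /bar; case: ifP => [/eqP e /H[e1 e2]|ne]; last case: ifP => qn.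
- by left; split; apply: val_inj => /=; lia.
- rewrite E EN => /D[/H[e1 e2]|]; first by left; split; apply: val_inj => /=; lia.
  by rewrite oppr_eq0 => /H[e1 e2]; right; split; apply: val_inj => /=; lia.
- rewrite E => /D[] /H[e1 e2]; first by left; split; apply: val_inj => /=; lia.
  by right; split; apply: val_inj => /=; lia.
Qed.

(* The diagonal matrix (n, ..., 1, -1, ..., -n) takes positive integral values
   on all positive roots. *)
Definition grading_mx : 'M[K]_(n + n) :=
  diag_mx (\row_r (n%:R - (r : nat)%:R - (n <= r)%:R)).

Lemma grading_mx_sp : grading_mx \in sp K n.
Proof.
apply: spP => r c; rewrite !mxE.
have -> : (rev_ord c == r) = (rev_ord r == c).
  by rewrite -(inj_eq (@rev_ord_inj _) (rev_ord c)) rev_ordK eq_sym.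
have [e|_] := eqVneq (rev_ord r) c; last by rewrite !mulr0n !mul0r.
rewrite !mulr1n -e rev_ordK /=; have rn := ltn_ord r.
have -> : (n + n - r.+1)%:R = (n + n)%:R - r.+1%:R :> K by rewrite natrB.
have -> : (n <= n + n - r.+1)%N = (r < n)%N by lia.
have -> : (n + n - r.+1 < n)%N = ~~ (r < n)%N by lia.
by rewrite [(n <= r)%N]leqNgt; case: (r < n)%N => /=; rewrite natrD -natr1; ring.
Qed.

(** The height of the root with alpha_n counted twice: alpha_n takes the value 2 on [grading_mx],
    the other simple roots the value 1. *)
Definition height b : nat := (rq b - ri b + 1 + (n <= rq b))%N.

Lemma grading_bracket b :
  mxbracket grading_mx (root_mx K b) = (- (height b)%:R) *: root_mx K b.
Proof.
have [i0 iq iqn] := posrootP b.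
apply/matrixP => r c; rewrite diag_bracket_entry.
rewrite [RHS]mxE; have [->|/root_mx_supp] := eqVneq (root_mx K b r c) 0.
  by rewrite !mulr0.
have E : (height b)%:R = (rq b)%:R - (ri b).-1%:R + (n <= rq b)%:R :> K.
  rewrite /height natrD; congr (_ + _); rewrite -natrB; last lia.
  by congr (_%:R); lia.
move=> [[-> ->]|[-> ->]]; congr (_ * _); rewrite !mxE E /=.
  have -> : (n <= (ri b).-1)%N = false by lia.
  by rewrite /=; ring.
have -> : (n + n - (ri b).-1.+1)%:R = (n + n)%:R - (ri b)%:R :> K.
  by rewrite prednK // natrB //; lia.
have -> : (n + n - (rq b).+1)%:R = (n + n)%:R - (rq b).+1%:R :> K.
  by rewrite natrB //; lia.
have -> : (n <= n + n - (ri b).-1.+1)%N = true by lia.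
have -> : (n <= n + n - (rq b).+1)%N = ~~ (n <= rq b)%N by lia.
have -> : (ri b)%:R = (ri b).-1%:R + 1 :> K by rewrite natr1 prednK.
by case: (n <= rq b)%N => /=; rewrite -natr1 natrD; ring.
Qed.

Variables (E : lie_rep (sp K n)) (v0 : E) (mu : K).
Hypothesis v0_mu : mact grading_mx v0 = mu *: v0.

Lemma grading_fword s :
  mact grading_mx (fword s v0) = (mu - (\sum_(b <- s) height b)%:R) *: fword s v0.
Proof.
elim: s => [|b s IH]; first by rewrite big_nil subr0.
rewrite [fword _ _]/= /froot mact_bracket ?grading_mx_sp ?root_mx_sp //.
rewrite IH grading_bracket mactZ ?root_mx_sp // linearZ /= -scalerDl big_cons natrD.
by congr (_ *: _); ring.
Qed.

(* Eigenvectors of [grading_mx] for the eigenvalues mu - 1, mu - 2, ... do not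
   produce the eigenvalue mu. *)
Lemma nonempty_words_avoid c :
  c *: v0 \in span [set u | exists2 s, s <> [::] & u = fword s v0]%classic ->
  c *: v0 = 0.
Proof.
move=> /asboolP[l [a [w [wA cE]]]].
pose H s := (\sum_(b <- s) height b)%N.
have /choice [f fP] : forall i, exists s, s <> [::] /\ w i = fword s v0.
  by move=> i; have [s s0 ->] := wA i; exists s.
have Hpos s : s <> [::] -> (0 < H s)%N.
  by case: s => // b s _; rewrite /H big_cons /height; lia.
pose A M : subspace E :=
  span [set u | exists2 s, (0 < H s <= M)%N & u = fword s v0]%classic.
have {cE} : c *: v0 \in A (\max_i H (f i))%N.
  rewrite cE rpred_sum // => i _; have [fi ->] := fP i.
  by rewrite rpredZ //; apply: span_mem; exists (f i); rewrite ?Hpos // leq_bigmax.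
move: (\max_i _)%N => M; elim: M c => [|M IH] c.
  move=> /asboolP[l' [a' [w' [wA' ->]]]]; rewrite big1 // => i _.
  by have [s] := wA' i; lia.
move=> cA.
(* [g] kills the words of height [M.+1], keeps the lower ones in [A M], and multiplies [c *: v0] by
   [M.+1]. *)
pose g (u : E) := mact grading_mx u - (mu - M.+1%:R) *: u.
have gl : linear g.
  move=> a' u v; rewrite /g linearP scalerDr scalerBr !scalerA [a' * _]mulrC.
  by rewrite opprD addrACA.
have gA : forall u, u \in A M.+1 -> g u \in A M.
  apply: span_linear_ind gl _ => _ [s /andP[s0 sM] ->].
  rewrite /g grading_fword -scalerBl -/(H s).
  have [->|sM'] := eqVneq (H s) M.+1; first by rewrite subrr scale0r rpred0.
  rewrite rpredZ //; apply: span_mem; exists s; rewrite // s0 /=; lia.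
have := gA _ cA; rewrite /g linearZ /= v0_mu !scalerA -scalerBl.
have -> : c * mu - (mu - M.+1%:R) * c = c * M.+1%:R by ring.
move=> /IH/eqP; rewrite mulrC -scalerA scaler_eq0 pnatr_eq0 /= => /eqP //.
Qed.

Lemma fspan_split u : u \in fspan v0 -> exists c, exists2 y,
  y \in span [set u | exists2 s, s <> [::] & u = fword s v0]%classic & u = c *: v0 + y.
Proof.
move=> /asboolP[l [a [w [wA ->]]]].
elim/big_ind: _ => [|x y [c1 [y1 h1 ->]] [c2 [y2 h2 ->]]|i _].
- by exists 0, 0; rewrite ?rpred0 // scale0r addr0.
- by exists (c1 + c2), (y1 + y2); rewrite ?rpredD // scalerDl addrACA.
have [[|b s] ->] := wA i; first by exists (a i), 0; rewrite ?rpred0 ?addr0.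
exists 0, (a i *: fword (b :: s) v0); last by rewrite scale0r add0r.
by rewrite rpredZ //; apply: span_mem; exists (b :: s).
Qed.

End Weights.

Section HighestWeightVectors.
Variables (K : fieldType) (n : nat) (lam : 'I_n -> nat).

Lemma weight_diag_part X : weight (K := K) lam (diag_part X) = weight lam X.
Proof.
apply: eq_bigr => i _; congr (_ * _); apply: eq_bigr => r _.
by rewrite mxE eqxx.
Qed.

Lemma hw_upper (V : lie_rep (sp K n)) (nu : V) X : highest_weight_vector lam nu ->
  X \in sp K n -> upper X -> mact X nu = weight lam X *: nu.
Proof.
move=> [_ nup nuh] XP Xu; have DP := sp_diag_part XP.
have UP : X - diag_part X \in sp K n by rewrite rpredB.
rewrite -{1}[X](subrK (diag_part X)) mactD // (mactE UP) nup; last first.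
  by rewrite SubK upper_diag_part.
by rewrite add0r (mactE DP) nuh ?SubK ?diag_partP // weight_diag_part.
Qed.

End HighestWeightVectors.

Section Transfer.
Variables (K : numClosedFieldType) (n m : nat) (k : 'I_m -> nat).
Hypothesis k_le : forall j, (k j <= n)%N.
Variable lam : 'I_n -> nat.
Hypothesis lam_k : forall X : 'M[K]_(n + n),
  weight lam X = \sum_(t : slot n k) X (pos t) (pos t).
Variables (V : lie_rep (sp K n)) (nu : V).
Hypothesis nu_hw : highest_weight_vector lam nu.

Local Notation W := (tensor_rep K n k).
Local Notation nu' := (hw_tensor K n k : W).
Let P := prod_rep V W.
(** The submodule generated by [eta] stands in for the graph of an isomorphism from the module of
    [nu] to that of [nu']; its intersections with the two factors are what has to be controlled. *)
Let eta : P := (nu, nu').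

Lemma mact_hw_tensor X : X \in sp K n -> upper X -> mact X nu' = weight lam X *: nu'.
Proof. by move=> XP Xu; rewrite mact_tensor // hw_tensor_upper // lam_k. Qed.

Lemma hw_tensor_neq0 : nu' <> 0.
Proof.
move=> /(congr1 (fun phi : tensor K n k => phi [ffun t => pos t])).
by rewrite hw_tensor_pos ffunE => /eqP; rewrite oner_eq0.
Qed.

Lemma pair_hw X : X \in sp K n -> upper X -> mact X eta = weight lam X *: eta.
Proof.
by move=> XP Xu; rewrite mact_prod (hw_upper nu_hw) // mact_hw_tensor.
Qed.

Let eta_eigen : upper_eigen eta.
Proof. by move=> X XP Xu; exists (weight lam X); apply: pair_hw. Qed.

Lemma grading_upper : upper (grading_mx K n).
Proof. by apply/upperP => r c cr; rewrite mxE; case: eqP cr => // ->; rewrite ltnn. Qed.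

Let nonempty (E : lie_rep (sp K n)) (v : E) : subspace E :=
  span [set u | exists2 s, s <> [::] & u = fword s v]%classic.

Lemma pair_split u : u \in fspan eta -> exists c, exists2 y,
  y.1 \in nonempty nu /\ y.2 \in nonempty nu' & u = c *: eta + y.
Proof.
move=> /fspan_split[c [y yne ->]]; exists c, y => //.
split; move: y yne; apply: span_linear_ind => // _ [s s0 ->]; rewrite fword_prod /=;
  by apply: span_mem; exists s.
Qed.

Lemma avoid1 c : c *: nu \in nonempty nu -> c = 0.
Proof.
have [nu0 _ _] := nu_hw.
move=> /(nonempty_words_avoid (hw_upper nu_hw (grading_mx_sp K n) grading_upper)).
by move=> /eqP; rewrite scaler_eq0 => /orP[/eqP//|/eqP].
Qed.

Lemma avoid2 c : c *: nu' \in nonempty nu' -> c = 0.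
Proof.
move=> /(nonempty_words_avoid (mact_hw_tensor (grading_mx_sp K n) grading_upper)).
move=> /eqP; rewrite scaler_eq0 => /orP[/eqP//|/eqP].
by move/hw_tensor_neq0.
Qed.

Lemma iter_mact_fspan N X : iter N (mact X) eta \in fspan eta.
Proof.
elim: N => [|N IH]; last exact: mact_fspan.
by apply: span_mem; exists [::].
Qed.

(* The vectors v with (v, 0) in the submodule of V * W generated by (nu, nu')
   form a submodule of V; it does not contain nu, for weight reasons. *)
Lemma transfer_power N X : irreducible_rep V ->
  iter N (mact X) nu' = 0 -> iter N (mact X) nu = 0.
Proof.
move=> [_ irr] Xnu'.
pose A : {pred V} := [pred v | ((v, 0) : P) \in fspan eta].
have AE v : (v \in A) = (((v, 0) : P) \in fspan eta) by [].
have Acl : submod_closed A.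
  split; first by rewrite AE; exact: rpred0.
  move=> a u v; rewrite !AE => uA vA.
  have -> : ((a *: u + v, 0) : P) = (a *: u + v, a *: 0 + 0).
    by rewrite scaler0 addr0.
  exact: (rpredD (rpredZ a uA) vA).
have XA : iter N (mact X) nu \in A.
  by rewrite AE; have := iter_mact_fspan N X; rewrite iter_mact_prod Xnu'.
have [] := irr (Subspace Acl); first 1 last.
- by apply.
- move=> /(_ nu); rewrite -[_ \in _]/(nu \in A) AE => /pair_split[c [[y1 y2] /= [h1 h2]]] [e1 e2].
  have c0 : c = 0.
    apply/avoid2; rewrite -[c *: nu'](addrK y2) -e2 sub0r rpredN //.
  rewrite c0 scale0r add0r in e1.
  have : (1 : K) = 0 by apply: avoid1; rewrite scale1r [X in X \in _]e1.
  by move/eqP; rewrite oner_eq0.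
- move=> x w; rewrite -![_ \in Subspace _]/(_ \in A) !AE => wA; rewrite -mact_rho.
  by have := mact_fspan eta_eigen (val x) wA; rewrite mact_prod /= linear0.
Qed.

Lemma root_mx_tr_sp (b : posroot n) : (root_mx K b)^T \in sp K n.
Proof.
apply: spP => r c; rewrite !mxE.
have := spE (rev_ord r) (rev_ord c) (root_mx_sp K b); rewrite !rev_ordK => H.
have sgn (i : 'I_(n + n)) : (rev_ord i < n)%N = ~~ (i < n)%N.
  by have := ltn_ord i; rewrite /=; lia.
move: H; rewrite !sgn.
have := ltn_ord r; case: (r < n)%N; case: (c < n)%N => _ /=; rewrite ?mulr1 ?mulrN1 //.
- by move=> /oppr_inj.
- by move=> ->.
Qed.

Lemma root_mx_tr_upper (b : posroot n) : strictly_upper (root_mx K b)^T.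
Proof. by apply/strictly_upperP => r c cr; rewrite mxE root_mx_lower. Qed.

Lemma hw_tensor_killed b : mact (root_mx K b)^T nu' = 0.
Proof.
have /strictly_upperP U := root_mx_tr_upper b.
rewrite mact_hw_tensor ?root_mx_tr_sp //; last by apply/upperP => r c /ltnW/U.
by rewrite lam_k big1 ?scale0r // => t _; rewrite U.
Qed.

Lemma form_mact b (phi psi : W) :
  form (mact (root_mx K b) phi) psi = form phi (mact (root_mx K b)^T psi).
Proof. by rewrite !mact_tensor ?root_mx_tr_sp ?root_mx_sp // form_tensor_act. Qed.

Lemma form_nonempty (y : W) : y \in nonempty nu' -> form nu' y = 0.
Proof.
move=> /asboolP[l [a [w [wA ->]]]]; rewrite linear_sum big1 // => i _.
rewrite linearZ /=; have [[|b s] // _ ->] := wA i.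
by rewrite formC /= /froot form_mact hw_tensor_killed linear0 mulr0.
Qed.

(** A letter crosses the form as a raising operator, which keeps [(0, y)] in the submodule. For the
    empty word, the coefficient of [nu'] in [y] equals that of [nu] in 0, and nonempty words on
    [nu'] are orthogonal to [nu']. *)
Lemma graph_orthogonal (y : W) : ((0, y) : P) \in fspan eta ->
  forall s, form (fword s nu') y = 0.
Proof.
move=> yN s; elim: s y yN => [|b s IH] y yN.
  move: yN => /pair_split[c [[y1 y2] /= [h1 h2]] [e1 e2]].
  have c0 : c = 0 by apply: avoid1; rewrite -[c *: nu](addrK y1) -e1 sub0r rpredN.
  by rewrite e2 c0 scale0r add0r form_nonempty.
rewrite /= /froot form_mact IH //.
by have := mact_fspan eta_eigen (root_mx K b)^T yN; rewrite mact_prod /= linear0.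
Qed.

Lemma fword_real s I : (fword s nu' I)^* = fword s nu' I.
Proof.
suff E : conj_tensor (fword s nu' : W) = fword s nu' by rewrite -[in RHS]E ffunE.
elim: s => [|b s IH].
  apply/ffunP => I'; rewrite ffunE wedgeE rmorph_sum; apply: eq_bigr => p _.
  rewrite rmorphM rmorphXn rmorphN rmorph1 rmorph_prod; congr (_ * _).
  by apply: eq_bigr => t _; rewrite mxE; case: (_ && _); rewrite ?rmorph0 ?rmorph1.
rewrite /= /froot mact_tensor ?root_mx_sp // conj_tensor_act ?IH // => r c.
rewrite /root_mx; case: ifP => _; last case: ifP => _; rewrite !mxE;
  rewrite ?rmorphB ?rmorphD ?rmorph_nat //=.
Qed.

(* If (0, y) lies in the submodule generated by (nu, nu'), then y is orthogonal
   to U(sp) nu', hence to its own conjugate when it lies there too. *)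
Lemma transfer_linear l (c : 'I_l -> K) (s : 'I_l -> seq (posroot n)) :
  \sum_i c i *: fword (s i) nu = 0 -> \sum_i c i *: fword (s i) nu' = 0.
Proof.
move=> nu0; set y := LHS; apply: form_conj.
have yN : ((0, y) : P) \in fspan eta.
  have -> : ((0, y) : P) = \sum_i c i *: fword (s i) eta.
    rewrite [RHS]surjective_pairing -nu0 /y; congr (_, _).
      rewrite -[RHS]/(fst _) raddf_sum; apply: eq_bigr => i _.
      by rewrite fword_prod.
    rewrite -[RHS]/(snd _) raddf_sum; apply: eq_bigr => i _.
    by rewrite fword_prod.
  by apply: rpred_sum => i _; rewrite rpredZ //; apply: span_mem; exists (s i).
have -> : conj_tensor y = \sum_i (c i)^* *: fword (s i) nu'.
  apply/ffunP => I; rewrite ffunE !sum_ffunE rmorph_sum; apply: eq_bigr => i _.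
  by rewrite !ffunE rmorphM /= fword_real.
rewrite formC linear_sum big1 // => i _.
by rewrite linearZ /= formC graph_orthogonal // mulr0.
Qed.

End Transfer.

(** * Leading terms of the relations *)

(** Interpolation at the nonzero points 1, ..., M: the inverse Vandermonde matrix writes a
    coefficient as a combination of values, which all lie in [W]. *)
Lemma coef_extract (K : numFieldType) (V : lmodType K) (W : subspace V) (J : eqType)
    (r : seq J) (e : J -> nat) (v : J -> V) :
  (forall z : K, z != 0 -> \sum_(i <- r) z ^+ e i *: v i \in W) ->
  forall e0, \sum_(i <- r | e i == e0) v i \in W.
Proof.
move=> rW e0; pose M := (\max_(i <- r) e i).+1.
pose z : 'rV[K]_M := \row_j j.+1%:R.
have Au : Vandermonde M z \in unitmx.
  rewrite unitmxE det_Vandermonde unitfE; apply/prodf_neq0 => i _.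
  apply/prodf_neq0 => j ij; rewrite !mxE subr_eq0 eqr_nat eqSS.
  by rewrite neq_ltn ij orbT.
have [e0M|Me0] := ltnP e0 M; last first.
  rewrite big_seq_cond big1 ?rpred0 // => i /andP[ir /eqP ei]; move: Me0; rewrite -ei /M ltnNge.
  by rewrite leq_bigmax_seq.
pose l : 'cV_M := invmx (Vandermonde M z) *m delta_mx (Ordinal e0M) 0.
have lE (d : nat) : (d < M)%N -> \sum_j l j 0 * z 0 j ^+ d = (d == e0)%:R.
  move=> dM; transitivity ((Vandermonde M z *m l) (Ordinal dM) 0).
    by rewrite mxE; apply: eq_bigr => j _; rewrite !mxE mulrC.
  by rewrite mulmxA mulmxV // mul1mx mxE eqxx andbT.
have <- : \sum_j l j 0 *: \sum_(i <- r) z 0 j ^+ e i *: v i = \sum_(i <- r | e i == e0) v i;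
  last by apply: rpred_sum => j _; rewrite rpredZ // rW // mxE pnatr_eq0.
under eq_bigr => j _ do rewrite scaler_sumr.
rewrite exchange_big [RHS]big_mkcond; apply: eq_big_seq => i ir /=.
under eq_bigr => j _ do rewrite scalerA.
rewrite -scaler_suml lE; last by rewrite ltnS leq_bigmax_seq.
by case: eqP; rewrite ?scale1r ?scale0r.
Qed.

Lemma digits_inj B m (f g : nat -> nat) :
  (forall x, f x < B)%N -> (forall x, g x < B)%N ->
  (\sum_(x < m) f x * B ^ x = \sum_(x < m) g x * B ^ x)%N ->
  forall x, (x < m)%N -> f x = g x.
Proof.
elim: m f g => // m IH f g fB gB.
have E (h : nat -> nat) : (\sum_(x < m.+1) h x * B ^ x = (\sum_(x < m) h x.+1 * B ^ x) * B + h 0)%N.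
  rewrite big_ord_recl expn0 muln1 addnC; congr (_ + _)%N.
  by rewrite big_distrl; apply: eq_bigr => x _; rewrite /= expnSr mulnA.
rewrite !E => e; have B0 : (0 < B)%N by apply: leq_trans (fB 0).
have e0 : f 0 = g 0.
  by have := congr1 (modn^~ B) e; rewrite /= !modnMDl !modn_small.
have e1 : (\sum_(x < m) f x.+1 * B ^ x = \sum_(x < m) g x.+1 * B ^ x)%N.
  by move/eqP: e; rewrite e0 eqn_add2r eqn_pmul2r // => /eqP.
by case=> // x xm; apply: (IH (fun x => f x.+1) (fun x => g x.+1)).
Qed.

(* The root alpha_{i,q} is read as the interval [i, 2n - q]; along a Dyck path
   these intervals decrease. *)
Section Intervals.
Variable n : nat.
Implicit Types (b : posroot n) (w s : seq (posroot n)).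

Definition rc b : nat := (n.*2 - rq b)%N.

Lemma ri_gt0 b : (0 < ri b)%N. Proof. by have [] := posrootP b. Qed.
Lemma ri_le_rc b : (ri b <= rc b)%N. Proof. by have [] := posrootP b; rewrite /rc; lia. Qed.
Lemma rc_lt b : (rc b < n.*2)%N. Proof. by have [] := posrootP b; rewrite /rc; lia. Qed.

Lemma posroot_inj_rc b b' : ri b = ri b' -> rc b = rc b' -> b = b'.
Proof.
move=> ei ec; apply: posroot_inj => //.
by have [] := posrootP b; have [] := posrootP b'; move: ec; rewrite /rc; lia.
Qed.

(** In terms of intervals: that of [b'] lies inside that of [b]. *)
Definition nested b b' := (ri b <= ri b')%N && (rq b <= rq b')%N.
Definition chain s := forall b b', b \in s -> b' \in s -> nested b b' || nested b' b.

Definition endpoints x w : nat := \sum_(b <- w) ((ri b == x) + (rc b == x)).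
Definition cut al be w : nat := \sum_(b <- w) ((ri b <= al) && (be <= rc b)).
Definition spread w : nat :=
  \sum_(al < n.*2.+1) \sum_(be < n.*2.+1 | al < be) cut al be w.

Lemma below_endpoints al w :
  (\sum_(b <- w) ((ri b <= al) + (rc b <= al)) = \sum_(x < al.+1) endpoints x w)%N.
Proof.
rewrite /endpoints exchange_big; apply: eq_bigr => b _; rewrite big_split /=.
have H (y : nat) : (\sum_(x < al.+1) (y == x) = (y <= al))%N.
  have [ya|ya] := ltnP y al.+1.
    rewrite (bigD1 (Ordinal ya)) //= eqxx big1 => [|x]; first by rewrite -ltnS ya.
    by rewrite -val_eqE /= eq_sym => /negPf ->.
  by rewrite big1 => [|x _]; [|have := ltn_ord x]; lia.
by rewrite !H.
Qed.

Lemma above_endpoints be w :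
  (\sum_(b <- w) ((be <= ri b) + (be <= rc b)) =
   \sum_(x < n.*2 | be <= x) endpoints x w)%N.
Proof.
rewrite /endpoints exchange_big; apply: eq_bigr => b _; rewrite big_split /=.
have H (y : nat) : (y < n.*2)%N -> (\sum_(x < n.*2 | be <= x) (y == x) = (be <= y))%N.
  move=> yn; have [yb|yb] := leqP be y.
    rewrite (bigD1 (Ordinal yn)) //= eqxx big1 => [|x /andP[_]]; first by [].
    by rewrite -val_eqE /= eq_sym => /negPf ->.
  by rewrite big1 => [|x bx]; lia.
rewrite !H ?rc_lt //; have := rc_lt b; have := ri_le_rc b; lia.
Qed.

Lemma sum_lt_seq (T : eqType) (r : seq T) (f g : T -> nat) :
  (\sum_(b <- r) f b < \sum_(b <- r) g b)%N -> exists2 b, b \in r & (f b < g b)%N.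
Proof.
move=> fg; apply/hasP; apply: contraLR fg => /hasPn h; rewrite -leqNgt.
by rewrite !big_seq; apply: leq_sum => b /h; rewrite -leqNgt.
Qed.

Lemma sum_le_eq (I : finType) (P : pred I) (f g : I -> nat) :
  (forall i, P i -> (f i <= g i)%N) -> (\sum_(i | P i) f i = \sum_(i | P i) g i)%N ->
  forall i, P i -> f i = g i.
Proof.
move=> fg e i Pi.
have := leqif_sum (fun i Pi => leqif_eq (fg i Pi)); rewrite e => -[_].
by rewrite eqxx => /esym/forall_inP/(_ i Pi)/eqP.
Qed.

(** An interval containing [[al, be]] has one endpoint at most [al] and one at least [be], so the
    cut is bounded by either number of such endpoints, and both depend on [endpoints] only. A chain
    attains one of the bounds: otherwise some [b1] starts by [al] and ends before [be], some [b2]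
    starts after [al] and ends at [be] or later, and these two are not nested. *)
Lemma chain_cut s w al be : chain s -> (al < be)%N ->
  (forall x, (x < n.*2)%N -> endpoints x w = endpoints x s) ->
  (cut al be w <= cut al be s)%N.
Proof.
move=> sch ab ews.
have [aln|aln] := leqP n.*2 al.
  by rewrite /cut big1 // => b _; have := rc_lt b; lia.
pose p r := (\sum_(b <- r) ((ri b <= al) + (rc b <= al)))%N.
pose q r := (\sum_(b <- r) ((be <= ri b) + (be <= rc b)))%N.
have pE : p w = p s.
  by rewrite /p !below_endpoints; apply: eq_bigr => x _; rewrite ews //; have := ltn_ord x; lia.
have qE : q w = q s.
  by rewrite /q !above_endpoints; apply: eq_bigr => x _; rewrite ews.
have cp r : (cut al be r <= p r)%N by apply: leq_sum => b _; lia.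
have cq r : (cut al be r <= q r)%N by apply: leq_sum => b _; lia.
have [sp|sp] := leqP (p s) (cut al be s); first by rewrite (leq_trans (cp w)) // pE.
have [sq|sq] := leqP (q s) (cut al be s); first by rewrite (leq_trans (cq w)) // qE.
have [b1 b1s h1] := sum_lt_seq sp; have [b2 b2s h2] := sum_lt_seq sq.
have := sch _ _ b1s b2s; rewrite /nested; move: h1 h2.
have := ri_le_rc b1; have := ri_le_rc b2.
have [_ _ ?] := posrootP b1; have [_ _ ?] := posrootP b2; rewrite /rc; lia.
Qed.

Lemma sum_count (f : posroot n -> nat) w : (\sum_(b <- w) f b = \sum_b count_mem b w * f b)%N.
Proof.
elim: w => [|b w IH]; first by rewrite big_nil big1.
rewrite big_cons IH /=; under [RHS]eq_bigr do rewrite mulnDl; rewrite big_split /=.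
congr (_ + _)%N; rewrite (bigD1 b) //= eqxx mul1n big1 ?addn0 // => b' /negPf b'b.
by rewrite eq_sym b'b.
Qed.

(** A multiplicity is a second difference of cuts. As [ri b < rc b], all four cuts are in the range
    [al < be] covered by [spread]. *)
Lemma count_nonloop b w : (ri b < rc b)%N ->
  (count_mem b w + cut (ri b).-1 (rc b) w + cut (ri b) (rc b).+1 w =
   cut (ri b) (rc b) w + cut (ri b).-1 (rc b).+1 w)%N.
Proof.
move=> ac; rewrite /cut -sum1_count big_mkcond -!big_split; apply: eq_bigr => b' _ /=.
have -> : (if b' == b then 1 else 0)%N = ((ri b' == ri b) && (rc b' == rc b)) :> nat.
  case: eqP => [->|ne]; first by rewrite !eqxx.
  by case: andP => // -[/eqP e1 /eqP e2]; case: ne; apply: posroot_inj_rc.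
have := ri_gt0 b; lia.
Qed.

Lemma chain_spread s w : chain s ->
  (forall x, (x < n.*2)%N -> endpoints x w = endpoints x s) ->
  (spread w <= spread s)%N /\ (spread w = spread s -> perm_eq w s).
Proof.
move=> sch ews.
have le al : (\sum_(be < n.*2.+1 | al < be) cut al be w <=
    \sum_(be < n.*2.+1 | al < be) cut al be s)%N.
  by apply: leq_sum => be ab; apply: chain_cut.
split=> [|e]; first by apply: leq_sum.
have cE al be : (al < be)%N -> cut al be w = cut al be s.
  move=> ab; have [ben|ben] := ltnP be n.*2.+1; last first.
    by rewrite /cut !big1 // => b _; have := rc_lt b; lia.
  have aln : (al < n.*2.+1)%N by lia.
  have := @sum_le_eq _ predT _ _ (fun (i : 'I_n.*2.+1) _ => le i) e (Ordinal aln) isT.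
  move=> /sum_le_eq/(_ (Ordinal ben) ab); apply.
  by move=> i ai; apply: chain_cut.
have nonloop b : (ri b < rc b)%N -> count_mem b w = count_mem b s.
  move=> ac; have := count_nonloop w ac; have := count_nonloop s ac.
  have := ri_gt0 b; rewrite !cE; lia.
suff cnt b : count_mem b w = count_mem b s.
  by apply/allP => b _; apply/eqP; rewrite /= cnt.
(* A one-point interval is invisible to the cuts; its multiplicity is what remains of
   [endpoints (ri b)] after the other intervals are accounted for. *)
have [/nonloop//|bloop] := ltnP (ri b) (rc b).
have ba : rc b = ri b by have := ri_le_rc b; lia.
have := ews (ri b); rewrite -{1}ba rc_lt => /(_ isT).
rewrite /endpoints (sum_count _ w) (sum_count _ s) (bigD1 b) //= [RHS](bigD1 b) //= ba eqxx.
suff -> : (\sum_(i | i != b) count_mem i w * ((ri i == ri b) + (rc i == ri b)) =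
    \sum_(i | i != b) count_mem i s * ((ri i == ri b) + (rc i == ri b)))%N.
  by move=> /eqP; rewrite eqn_add2r eqn_pmul2r // => /eqP.
apply: eq_bigr => b' b'b; have [/nonloop -> //|b'loop] := ltnP (ri b') (rc b').
have b'a : rc b' = ri b' by have := ri_le_rc b'; lia.
suff e0 : (ri b' == ri b) = false.
  by have e1 : (rc b' == ri b) = false; [rewrite b'a|rewrite e0 e1 !muln0].
by apply: contraNF b'b => /eqP e0; apply/eqP/posroot_inj_rc; rewrite // ba b'a.
Qed.

(** For [B] larger than twice the length there are no carries, so the digits in base [B] are the
    endpoint multiplicities, and a single parameter [z] separates all endpoint multisets. *)
Definition exponent B w : nat := \sum_(b <- w) (B ^ ri b + B ^ rc b).

Lemma exponent_endpoints B w :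
  exponent B w = (\sum_(x < n.*2) endpoints x w * B ^ x)%N.
Proof.
rewrite /exponent /endpoints; under [RHS]eq_bigr do rewrite big_distrl.
rewrite exchange_big; apply: eq_bigr => b _ /=.
under eq_bigr do rewrite mulnDl; rewrite big_split /=.
have H (y : nat) : (y < n.*2)%N -> (\sum_(x < n.*2) (y == x) * B ^ x = B ^ y)%N.
  move=> yn; rewrite (bigD1 (Ordinal yn)) //= eqxx mul1n big1 ?addn0 // => x.
  by rewrite -val_eqE /= eq_sym => /negPf ->.
rewrite !H ?rc_lt //; have := rc_lt b; have := ri_le_rc b; lia.
Qed.

Lemma exponent_inj w s x : size w = size s ->
  exponent (size s).*2.+1 w = exponent (size s).*2.+1 s ->
  (x < n.*2)%N -> endpoints x w = endpoints x s.
Proof.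
move=> ws; rewrite !exponent_endpoints.
have H r x' : (endpoints x' r <= (size r).*2)%N.
  rewrite /endpoints -muln2 -sum1_size big_distrl /=; apply: leq_sum => b _; lia.
move=> e xn; apply: (@digits_inj _ _ (endpoints^~ w) (endpoints^~ s) _ _ e x xn) => y.
  by rewrite ltnS -ws.
by rewrite ltnS.
Qed.

End Intervals.

Section LeadingTerm.
Variables (K : numFieldType) (n : nat) (E : lie_rep (sp K n)) (v0 : E).
Hypothesis v0_eigen : upper_eigen v0.
Implicit Types (b : posroot n) (w s : seq (posroot n)).

Fixpoint words N : seq (seq (posroot n)) :=
  if N is N'.+1 then [seq b :: w | b <- enum {: posroot n}, w <- words N'] else [:: [::]].

Lemma words_size N w : w \in words N -> size w = N.
Proof.
elim: N w => [|N IH] w; first by rewrite inE => /eqP ->.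
by move=> /allpairsP[[b w'] /= [_ /IH <- ->]].
Qed.

Lemma mem_words w : w \in words (size w).
Proof.
elim: w => [|b w IH] //; apply/allpairsP; exists (b, w); split => //.
by rewrite mem_enum.
Qed.

Lemma iter_lower_act N X : iter N (lower_act X) v0 =
  \sum_(w <- words N) (\prod_(b <- w) X (low b) (top b)) *: fword w v0.
Proof.
elim: N => [|N IH]; first by rewrite big_seq1 big_nil scale1r.
rewrite iterS IH /= big_allpairs_dep big_enum; apply: eq_bigr => b _.
rewrite linear_sum scaler_sumr; apply: eq_bigr => w _.
by rewrite linearZ /= big_cons scalerA.
Qed.

Variables (s : seq (posroot n)) (Q : pred (posroot n)).
Hypothesis s_chain : chain s.
Hypothesis sQ : all Q s.
Local Notation B := (size s).*2.+1.
Hypothesis killer : forall z : K, z != 0 -> exists2 X, X \in sp K n &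
  (forall b, X (low b) (top b) = if Q b then z ^+ (B ^ ri b + B ^ rc b) else 0) /\
  iter (size s) (mact X) v0 = 0.

Lemma leading_term : fword s v0 \in span [set u | exists2 w,
  (size w < size s)%N \/ size w = size s /\ (spread w < spread s)%N & u = fword w v0]%classic.
Proof.
set W := span _.
have shortW : {subset short_span v0 (size s) <= W}.
  by apply: span_ind => _ [w sw ->]; apply: span_mem; exists w => //; left.
have : \sum_(w <- words (size s) | exponent B w == exponent B s)
    (if all Q w then fword w v0 else 0) \in W.
  apply: coef_extract => z /killer[X XP [XE X0]].
  have [h _] := mact_power v0_eigen (size s) XP.
  move: h; rewrite X0 sub0r rpredN => /shortW; rewrite iter_lower_act.
  set L := (X in X \in _ -> _); set L' := (X in _ -> X \in _); suff -> : L = L' by [].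
  apply: eq_bigr => w _.
  have [wQ|wQ] := boolP (all Q w); last first.
    move: wQ => /allPn[b bw bQ]; rewrite scaler0.
    by rewrite (big_rem _ bw) /= XE (negPf bQ) mul0r scale0r.
  congr (_ *: _); rewrite /exponent; elim: w wQ => [|b w IH] /=; first by rewrite !big_nil.
  by move=> /andP[bQ /IH wQ]; rewrite !big_cons XE bQ wQ [RHS]exprD.
rewrite (bigID (fun w => perm_eq w s)) /= => h.
have {}h : \sum_(i <- words (size s) | (exponent B i == exponent B s) && perm_eq i s)
    (if all Q i then fword i v0 else 0) \in W.
  move: h; rewrite rpredDr // big_seq_cond rpred_sum // => w /and3P[ww /eqP ew nws].
  case: ifP => _; last exact: rpred0.
  have sw := words_size ww.
  have [le eq] := chain_spread s_chain (fun x xn => exponent_inj sw ew xn).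
  apply: span_mem; exists w => //; right; split => //.
  by rewrite ltn_neqAle le andbT; apply: contra nws => /eqP/eq.

(* The rearrangements of [s] each contribute [fword s v0] up to shorter words, and their number [c]
   is invertible in characteristic zero. *)
pose c := size [seq w <- words (size s) | perm_eq w s].
have c0 : c%:R != 0 :> K.
  rewrite pnatr_eq0 size_eq0 -has_filter; apply/hasP; exists s => //.
  exact: mem_words.
suff : c%:R *: fword s v0 \in W by rewrite rpredZeq (negPf c0).
rewrite -[X in X \in _](subrK (\sum_(i <- words (size s) |
  (exponent B i == exponent B s) && perm_eq i s) (if all Q i then fword i v0 else 0))).
rewrite rpredD // /c -sum1_size natr_sum scaler_suml big_filter.
have EQ i : perm_eq i s -> (exponent B i == exponent B s) && perm_eq i s.
  by move=> p; rewrite p andbT /exponent (perm_big _ p).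
rewrite [X in _ - X](eq_bigl (fun i => perm_eq i s)) => [|i]; last first.
  by apply/idP/idP => [/andP[]//|/EQ].
rewrite -sumrB rpred_sum // => w ws; rewrite (perm_all _ ws) sQ scale1r.
by apply: shortW; apply: fword_perm; rewrite // perm_sym.
Qed.

End LeadingTerm.

(** * Root elements with a vanishing power on the highest weight tensor *)

Section RootElements.
Variables (K : numClosedFieldType) (n m : nat) (k : 'I_m -> nat).
Hypothesis k_le : forall j, (k j <= n)%N.

Lemma sum_block (F : 'I_(n + n) -> K) j :
  \sum_(t : slot n k | blk t == j) F (pos t) = \sum_(c < n + n | (c < k j)%N) F c.
Proof.
rewrite (partition_big (@pos n m k) (fun c => c < k j)%N) /= => [|t /eqP <-]; last exact: pos_lt.
apply: eq_bigr => c ck; have [t tj tc] := slotP k_le ck.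
rewrite (big_pred1 t) => [|t' /=]; first by congr F; apply: val_inj.
apply/andP/eqP => [[/eqP b' /eqP p']|->]; last by rewrite tj eqxx; split=> //; apply/eqP/val_inj.
by apply: slot_inj; rewrite ?b' ?tj // p' tc.
Qed.

Variables (B i : nat) (z : K).
Hypothesis z0 : z != 0.
Local Notation sgn c := (if (c < n)%N then 1 else -1 : K).

Lemma sgn_rev (c : 'I_(n + n)) : sgn (rev_ord c) = - sgn c.
Proof.
have -> : (rev_ord c < n)%N = ~~ (c < n)%N by have := ltn_ord c; rewrite /=; lia.
by case: (c < n)%N; rewrite ?opprK.
Qed.

(* The long root element - u u^T M. *)
Lemma long_killer (i0 : (0 < i)%N) : exists2 X, X \in sp K n &
  (forall b, X (low b) (top b) =
     if (i <= ri b)%N then z ^+ (B ^ ri b + B ^ rc b) else 0) /\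
  forall N, (#|[pred j | (i <= k j)%N]| < N)%N ->
    iter N (tensor_act X) (hw_tensor K n k) = 0.
Proof.
(* [y] is indexed by interval endpoints: the row [low b] of [u] carries the label [rc b], and the
   reversal of the column [top b] carries [ri b]. *)
pose y x : K := if (i <= x <= n.*2 - i)%N then z ^+ (B ^ x) else 0.
pose u : 'cV[K]_(n + n) := \col_c y (n.*2 - c)%N.
pose X : 'M[K]_(n + n) := \matrix_(r, c) (u r 0 * u (rev_ord c) 0 * sgn c).
exists X.
  apply: spP => r c; rewrite [X _ _]mxE [X in _ = X * _]mxE.
  by rewrite mulrAC [u _ _ * u _ _]mulrC.
split=> [b|N].
  have [b0 bq bqn] := posrootP b; rewrite !mxE /=.
  have -> : ((ri b).-1 < n)%N by lia.
  have -> : (n.*2 - (n + n - (ri b).-1.+1) = ri b)%N by lia.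
  rewrite mulr1 -/(rc b) /y; have := ri_le_rc b; rewrite /rc.
  have [ib|ib] := leqP i (ri b) => h; last by rewrite mulr0.
  have -> : (i <= n.*2 - rq b <= n.*2 - i)%N by lia.
  have -> : (ri b <= n.*2 - i)%N by lia.
  by rewrite exprD mulrC.
apply: (power_kill k_le (u := u) (v := fun c => u (rev_ord c) 0)).
- move=> t; rewrite mulmx_evec; apply/colP => r; rewrite !mxE.
  by rewrite (pos_ltn k_le) mulr1 mulrC.
- apply/colP => r; rewrite !mxE.
  (* [X u] is a multiple of [u] with factor [u^T M u] up to sign, which vanishes because [M] is
     skew. *)
  transitivity (u r 0 * \sum_c (u (rev_ord c) 0 * u c 0 * sgn c)).
    by rewrite mulr_sumr; apply: eq_bigr => c _; rewrite [X _ _]mxE -!mulrA [_ * u c 0]mulrC.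
  suff -> : \sum_c (u (rev_ord c) 0 * u c 0 * sgn c) = 0 by rewrite mulr0.
  set s := \sum_c _; have : s = - s.
    rewrite {1}/s (reindex_inj rev_ord_inj) /= -sumrN; apply: eq_bigr => c _.
    by rewrite rev_ordK sgn_rev mulrN [u c 0 * _]mulrC.
  by move/eqP; rewrite -addr_eq0 -mulr2n mulrn_eq0 => /eqP.
- move=> j; rewrite -ltnNge => kj; left => t tj; rewrite mxE /y /=.
  have := pos_lt t; rewrite tj => tk.
  by have -> : (i <= n.*2 - (n + n - (pos t).+1))%N = false by have := pos_ltn k_le t; lia.
Qed.

(* A short root element u v^T - (its adjoint), where v^T u = 0 and u, v are
   supported in the coordinates i, ..., j+1 (the 0-based i-1, ..., j). *)
Lemma short_killer j (i0 : (0 < i)%N) (ij : (i <= j)%N) (jn : (j < n)%N) :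
  exists2 X, X \in sp K n &
  (forall b, X (low b) (top b) =
     if (i <= ri b)%N && (rq b <= j)%N then z ^+ (B ^ ri b + B ^ rc b) else 0) /\
  forall N, (#|[pred a | (i <= k a <= j)%N]| < N)%N ->
    iter N (tensor_act X) (hw_tensor K n k) = 0.
Proof.
have ilt : (i.-1 < n + n)%N by lia.
pose c0 := Ordinal ilt.
pose v (c : 'I_(n + n)) : K := if (i <= c.+1 <= j)%N then z ^+ (B ^ c.+1) else 0.
pose u1 (c : 'I_(n + n)) : K := if (i <= c <= j)%N then z ^+ (B ^ (n.*2 - c)) else 0.
(* The coordinate of [u] at [c0] is free: [v] starts at [c0], so this row of [u v^T] meets only
   entries on or above the diagonal. It is chosen to make [v^T u] vanish. *)
pose a := - (\sum_(c | c != c0) v c * u1 c) / v c0.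
pose u : 'cV[K]_(n + n) := \col_c (if c == c0 then a else u1 c).
have vc0 : v c0 != 0 by rewrite /v /= prednK // leqnn ij expf_neq0.
have vu : \sum_c v c * u c 0 = 0.
  rewrite (bigD1 c0) //= mxE eqxx /a mulrC divfK // addrC; apply/eqP; rewrite subr_eq0.
  by apply/eqP/eq_bigr => c /negPf cc0; rewrite mxE cc0.
have u0 (c : 'I_(n + n)) : (j < c)%N -> u c 0 = 0.
  move=> jc; rewrite mxE -val_eqE /= /u1.
  have -> : (c == i.-1 :> nat) = false by lia.
  by have -> : (i <= c <= j)%N = false by lia.
have v0 (c : 'I_(n + n)) : (n <= c)%N -> v c = 0.
  by move=> nc; rewrite /v; have -> : (i <= c.+1 <= j)%N = false by lia.
pose X : 'M[K]_(n + n) := \matrix_(r, c) (u r 0 * v c - v (rev_ord r) * u (rev_ord c) 0).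
have un (c : 'I_(n + n)) : (n <= c)%N -> u c 0 = 0 by move=> nc; apply: u0; lia.
exists X.
  apply: spP => r c; rewrite [in LHS]mxE [in RHS]mxE !rev_ordK.
  have H (r' c' : 'I_(n + n)) : u (rev_ord r') 0 * v c' * (sgn r' + sgn c') = 0.
    have [rn|rn] := ltnP r' n.
      by rewrite un ?mul0r // /=; have := ltn_ord r'; lia.
    have [cn|cn] := ltnP c' n; first by rewrite addNr mulr0.
    by rewrite (v0 c') // mulr0 mul0r.
  apply/eqP; rewrite -subr_eq0; have := H r c; have := H c r.
  move: (u (rev_ord r) 0) (u (rev_ord c) 0) (v r) (v c) (sgn r) (sgn c).
  move=> x1 x2 x3 x4 x5 x6 h1 h2; apply/eqP.
  rewrite -[RHS](subr0 0) -{1}h2 -h1; ring.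
split=> [b|N].
  have [b0 bq bqn] := posrootP b; rewrite mxE [u (rev_ord _) 0]un /=; last lia.
  rewrite mulr0 subr0 mxE -val_eqE /= /u1 /v /= prednK //.
  have [ib|ib] := leqP i (ri b); last by rewrite mulr0.
  have -> : (rq b == i.-1) = false by lia.
  have -> : (i <= rq b)%N by lia.
  have [bj|bj] := leqP (rq b) j; last by rewrite mul0r.
  have -> : (ri b <= j)%N by lia.
  by rewrite /= exprD mulrC.
apply: (power_kill k_le (u := u) (v := v) (G := fun x => i <= x <= j)%N).
- move=> t; rewrite mulmx_evec; apply/colP => r; rewrite mxE [X _ _]mxE [RHS]mxE.
  rewrite [u (rev_ord _) 0]un; last first.
    by rewrite [nat_of_ord _]/(n + n - (pos t).+1)%N; have := pos_ltn k_le t; lia.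
  by rewrite mulr0 subr0 mulrC.
- apply/colP => r; rewrite mxE [RHS]mxE.
  transitivity (u r 0 * \sum_c v c * u c 0 - v (rev_ord r) * \sum_c u (rev_ord c) 0 * u c 0).
    rewrite !mulr_sumr -sumrB; apply: eq_bigr => c _; rewrite [X _ _]mxE; ring.
  rewrite vu mulr0 [X in _ * X]big1 ?mulr0 ?subr0 // => c _.
  have [cn|cn] := ltnP c n; last by rewrite [u c 0]un ?mulr0.
  by rewrite un ?mul0r //=; lia.
(* Blocks of size below [i] consist of vectors killed by [X]; blocks of size above [j] contain the
   supports of [u] and [v], and there the trace is [v^T u = 0]. *)
- move=> a'; have [ka|ka] := leqP i (k a').
    rewrite /= -ltnNge => jk; right; split=> [c kc|]; first by apply: u0; lia.
    rewrite (sum_block (fun c => v c * u c 0)) -[RHS]vu.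
    rewrite [RHS](bigID (fun c : 'I_(n + n) => c < k a')%N) /=.
    rewrite [X in _ = _ + X]big1 ?addr0 // => c; rewrite -leqNgt => kc.
    by rewrite [u c 0]u0 ?mulr0 //; lia.
  move=> _; left => t tj; have := pos_lt t; rewrite tj => tk.
  by rewrite /v; have -> : (i <= (pos t).+1)%N = false by lia.
Qed.

End RootElements.

(** * Fundamental weights, Dyck paths and monomials *)

Section Blocks.
Variable n : nat.

(* lam = sum of lam_i omega_{i+1} as the list of its fundamental weights *)
Definition blocks (lam : 'I_n -> nat) : seq nat :=
  flatten [seq nseq (lam i) i.+1 | i <- enum 'I_n].

Lemma sum_blocks (R : nmodType) (lam : 'I_n -> nat) (F : nat -> R) :
  \sum_(x <- blocks lam) F x = \sum_(i < n) F i.+1 *+ lam i.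
Proof.
rewrite /blocks big_flatten big_map big_enum; apply: eq_bigr => i _.
by rewrite big_nseq; elim: (lam i) => [|l IH]; rewrite ?mulr0n ?iterS ?IH ?mulrS.
Qed.

Lemma count_blocks (lam : 'I_n -> nat) (P : pred nat) :
  count P (blocks lam) = (\sum_(i < n | P i.+1) lam i)%N.
Proof.
rewrite /blocks count_flatten -map_comp sumnE big_map big_enum [RHS]big_mkcond.
by apply: eq_bigr => i _; rewrite /= count_nseq; case: (P _); rewrite ?mul1n.
Qed.

Lemma blocks_range lam x : x \in blocks lam -> (0 < x <= n)%N.
Proof.
move=> /flattenP[s /mapP[i _ ->]]; rewrite mem_nseq => /andP[_ /eqP ->].
exact: ltn_ord.
Qed.

(** [minkowski] splits off the fundamental weights in increasing order. *)
Lemma blocks_sorted lam : sorted leq (blocks lam).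
Proof.
rewrite /blocks; have : sorted ltn (map val (enum 'I_n)).
  by rewrite val_enum_ord iota_ltn_sorted.
elim: (enum 'I_n) => //= i s IH is_.
have ss := IH (path_sorted is_).
have := order_path_min ltn_trans is_; rewrite all_map => /allP i_lt.
have : all (leq i.+1) (flatten [seq nseq (lam j) j.+1 | j <- s]).
  apply/allP => x /flattenP[_ /mapP[j js ->]]; rewrite mem_nseq => /andP[_ /eqP ->].
  by have := i_lt _ js; rewrite /= => /ltnW.
elim: (lam i) => //= l IHl le_s; rewrite path_min_sorted ?IHl //.
by rewrite all_cat le_s andbT; apply/allP => x; rewrite mem_nseq => /andP[_ /eqP ->].
Qed.

Definition block_size (ks : seq nat) (j : 'I_(size ks)) : nat := nth 0 ks j.

Lemma card_block_size ks (G : pred nat) :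
  #|[pred j | G (block_size (ks := ks) j)]| = count G ks.
Proof.
rewrite -sum1_card -sum1_count /block_size.
by rewrite (big_nth 0) big_mkord; apply: eq_bigl => j; rewrite inE.
Qed.

Lemma weight_blocks (K : numClosedFieldType) lam (X : 'M[K]_(n + n)) :
  weight lam X = \sum_(t : slot n (block_size (ks := blocks lam))) X (pos t) (pos t).
Proof.
rewrite (partition_big (@blk _ _ _) predT) //=.
have kn j : (block_size (ks := blocks lam) j <= n)%N.
  by have /blocks_range/andP[] := mem_nth 0 (ltn_ord j).
under eq_bigr => j _ do rewrite (sum_block kn (fun c => X c c)).
transitivity (\sum_(x <- blocks lam) fund_weight x X).
  rewrite sum_blocks; apply: eq_bigr => i _; rewrite mulr_natl //.
by rewrite (big_nth 0) big_mkord.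
Qed.

End Blocks.

Section DyckPaths.
Variable n : nat.
Implicit Types (b : posroot n) (p : seq (posroot n)).

Lemma nested_refl : reflexive (@nested n).
Proof. by move=> b; rewrite /nested !leqnn. Qed.

Lemma nested_trans : transitive (@nested n).
Proof.
move=> b1 b2 b3 /andP[h1 h2] /andP[h3 h4].
by rewrite /nested (leq_trans h1) ?(leq_trans h2).
Qed.

Lemma dyck_step_nested b b' : dyck_step b b' -> nested b b'.
Proof. by rewrite /dyck_step /nested; lia. Qed.

Lemma dyck_nested b p : path (@dyck_step n) b p -> path (@nested n) b p.
Proof. by apply: sub_path => b1 b2; apply: dyck_step_nested. Qed.

Lemma dyck_head b p c : path (@dyck_step n) b p -> c \in b :: p -> nested b c.
Proof.
move=> /dyck_nested/(order_path_min nested_trans)/allP h.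
by rewrite inE => /orP[/eqP ->|/h//]; apply: nested_refl.
Qed.

Lemma dyck_last b p c : path (@dyck_step n) b p -> c \in b :: p -> nested c (last b p).
Proof.
elim: p b c => [|b' p IH] b c /=; first by rewrite inE => _ /eqP ->; apply: nested_refl.
move=> /andP[bb' b'p]; rewrite inE => /orP[/eqP ->|/(IH _ _ b'p)//].
by apply: nested_trans (dyck_step_nested bb') (IH _ _ b'p _); rewrite mem_head.
Qed.

Lemma dyck_chain b p : path (@dyck_step n) b p -> chain (b :: p).
Proof.
elim: p b => [|b' p IH] b bp.
  by move=> c c'; rewrite !inE => /eqP -> /eqP ->; rewrite nested_refl.
have h := dyck_head bp; move: bp => /= /andP[_ /IH hc] c c'.
have [-> _ /h -> //|cb] := eqVneq c b.
have [-> /h -> _|cb'] := eqVneq c' b; first by rewrite orbT.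
rewrite [c \in _]inE [c' \in _]inE (negPf cb) (negPf cb') /=; exact: hc.
Qed.

(** Needed to read a sum of multiplicities along a path as the number of letters lying on it. *)
Lemma dyck_uniq b p : path (@dyck_step n) b p -> uniq (b :: p).
Proof.
pose r b1 b2 := (ri b1 + rq b1 < ri b2 + rq b2)%N.
move=> bp; apply: (@sorted_uniq _ r).
- by move=> b1 b2 b3; apply: ltn_trans.
- by move=> b1; apply: ltnn.
by apply: sub_path bp => b1 b2; rewrite /dyck_step /r; lia.
Qed.

(* The points of FFLV for the sum of the fundamental weights in [ks]. *)
Definition admissible (ks : seq nat) (t : posroot n -> nat) : Prop :=
  forall b p, dyck_path b p ->
  (simple_root (last b p) -> (\sum_(c <- b :: p) t c <=
     count (fun x => ri b <= x <= ri (last b p)) ks)%N) /\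
  (long_root (last b p) -> (\sum_(c <- b :: p) t c <= count (fun x => ri b <= x) ks)%N).

Lemma FFLV_admissible (R : realType) (lam : 'I_n -> nat) (t : {ffun posroot n -> nat}) :
  FFLV_points R lam t <-> admissible (blocks lam) t.
Proof.
rewrite /admissible; split=> [[_ h] b p bp|h].
  have [h1 h2] := h b p bp; rewrite !count_blocks.
  by split=> [/h1|/h2]; rewrite -!natr_sum ler_nat.
split=> [b|b p bp]; first exact: ler0n.
have [h1 h2] := h b p bp; move: h1 h2; rewrite !count_blocks.
by move=> h1 h2; split=> [/h1|/h2]; rewrite -!natr_sum ler_nat.
Qed.

End DyckPaths.

Section Monomials.
Variables (n : nat) (e : seq (posroot n)).
Hypothesis e_enum : perm_eq e (enum {: posroot n}).
Implicit Types (b : posroot n) (w : seq (posroot n)) (t : {ffun posroot n -> nat}).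

Definition mono_word t : seq (posroot n) := flatten [seq nseq (t b) b | b <- e].

Lemma count_mono_word t b : count_mem b (mono_word t) = t b.
Proof.
rewrite /mono_word count_flatten -map_comp sumnE big_map (perm_big _ e_enum) big_enum.
rewrite (bigD1 b) //= count_nseq /= eqxx mul1n big1 ?addn0 // => b' b'b.
by rewrite count_nseq /= (negPf b'b).
Qed.

Definition content w : {ffun posroot n -> nat} := [ffun b => count_mem b w].

Lemma perm_mono_word w : perm_eq w (mono_word (content w)).
Proof. by apply/allP => b _; rewrite /= count_mono_word ffunE. Qed.

End Monomials.

(** * The monomials of the polytope span the module *)

Section Spanning.
Variables (K : numClosedFieldType) (n : nat).
Variables (e : seq (posroot n)) (lam : 'I_n -> nat).
Hypothesis e_enum : perm_eq e (enum {: posroot n}).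
Variables (V : lie_rep (sp K n)) (nu : V).
Hypotheses (V_irr : irreducible_rep V) (nu_hw : highest_weight_vector lam nu).

Lemma hw_eigen : upper_eigen nu.
Proof. by move=> X XP Xu; exists (weight lam X); apply: hw_upper. Qed.

Lemma block_size_le j : (block_size (ks := blocks lam) j <= n)%N.
Proof. by have /blocks_range/andP[] := mem_nth 0 (ltn_ord j). Qed.

Lemma power_transfer X N : X \in sp K n ->
  iter N (tensor_act X) (hw_tensor K n (block_size (ks := blocks lam))) = 0 ->
  iter N (mact X) nu = 0.
Proof.
move=> XP X0; apply: (transfer_power block_size_le (weight_blocks lam) nu_hw V_irr).
rewrite -[RHS]X0; elim: N {X0} => // N IH; by rewrite !iterS IH mact_tensor.
Qed.

Lemma spread_cat w w' : spread (w ++ w' : seq (posroot n)) = (spread w + spread w')%N.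
Proof.
rewrite /spread -big_split; apply: eq_bigr => al _; rewrite -big_split.
by apply: eq_bigr => be _; rewrite /cut big_cat.
Qed.

Lemma spread_perm w w' : perm_eq w w' -> spread w = spread (w' : seq (posroot n)).
Proof.
move=> ww'; apply: eq_bigr => al _; apply: eq_bigr => be _; exact: perm_big.
Qed.

Lemma violation_leading b0 p (w : seq (posroot n)) : dyck_path b0 p ->
  all (mem (b0 :: p)) w ->
  ~ ((simple_root (last b0 p) -> (size w <=
        count (fun x => ri b0 <= x <= ri (last b0 p)) (blocks lam))%N) /\
     (long_root (last b0 p) -> (size w <= count (fun x => ri b0 <= x) (blocks lam))%N)) ->
  fword w nu \in span [set u | exists2 w', (size w' < size w)%N \/
    size w' = size w /\ (spread w' < spread w)%N & u = fword w' nu]%classic.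
Proof.
move=> /and3P[b0s bp last_or] /allP wP viol.
have wch : chain w by move=> b b' /wP h /wP h'; apply: (dyck_chain bp).
have b0i : (0 < ri b0)%N by apply: ri_gt0.
(* A path ending at alpha_n is treated like one ending at a long root: no block is larger than [n],
   so the two bounds coincide. *)
have [[jn wn]|wn] : ((ri (last b0 p) < n)%N /\ simple_root (last b0 p) /\
     (count (fun x => ri b0 <= x <= ri (last b0 p))%N (blocks lam) < size w)%N) \/
    (count (fun x => ri b0 <= x)%N (blocks lam) < size w)%N.
- have [_ _ ln] := posrootP (last b0 p).
  apply: contrapT => /not_orP[h1 h2]; apply: viol.
  split=> [sl|_]; last by rewrite leqNgt; apply/negP.
  rewrite leqNgt; apply/negP => h; have [jn|jn] := ltnP (ri (last b0 p)) n.
    by apply: h1.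
  apply: h2; congr (_ < _)%N: h; apply: eq_in_count => x /blocks_range /andP[_ xn].
  by rewrite (leq_trans xn jn) andbT.
- have [sl {}wn] := wn.
  have lq : rq (last b0 p) = ri (last b0 p) by apply/esym/eqP.
  apply: (leading_term hw_eigen
    (Q := fun b => (ri b0 <= ri b)%N && (rq b <= ri (last b0 p))%N)) => //.
    apply/allP => b /wP bw; have /andP[-> _] := dyck_head bp bw.
    by have /andP[_] := dyck_last bp bw; rewrite lq.
  move=> z z0; have ij : (ri b0 <= ri (last b0 p))%N.
    by have /andP[] := dyck_last bp (mem_head b0 p).
  have [X XP [XE Xk]] := short_killer block_size_le (size w).*2.+1 z0 b0i ij jn.
  exists X => //; split => //; apply: power_transfer => //; apply: Xk.
  by rewrite (card_block_size _ (fun x => ri b0 <= x <= ri (last b0 p))%N).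
- apply: (leading_term hw_eigen (Q := fun b => (ri b0 <= ri b)%N)) => //.
    by apply/allP => b /wP bw; have /andP[-> _] := dyck_head bp bw.
  move=> z z0.
  have [X XP [XE Xk]] := long_killer block_size_le (size w).*2.+1 z0 b0i.
  exists X => //; split => //; apply: power_transfer => //; apply: Xk.
  by rewrite (card_block_size _ (fun x => ri b0 <= x)%N).
Qed.

(** Induction on the length, then on the spread. The letters on a violated path are first moved next
    to [nu], modulo shorter words, so that [violation_leading] applies to them; length and spread
    are additive, so a drop in this factor is a drop for the whole word. *)
Lemma admissible_span w : fword w nu \in span [set u | exists2 t : {ffun posroot n -> nat},
  admissible (blocks lam) t & u = fword (mono_word e t) nu]%classic.
Proof.
set W := span _.
have [N] := ubnP (size w); elim: N w => // N IHN w.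
have [S] := ubnP (spread w); elim: S w => // S IHS w wS wN.
have short : {subset short_span nu (size w) <= W}.
  by apply: span_ind => _ [w' w'w ->]; apply: IHN; apply: leq_trans w'w _.
have toW w' : perm_eq w w' -> fword w' nu \in W -> fword w nu \in W.
  move=> ww' w'W; rewrite -[fword w nu](subrK (fword w' nu)) rpredD //.
  by apply: short; apply: fword_perm => //; apply: hw_eigen.
have [adm|/existsNP[b0 /existsNP[p /not_implyP[bp viol]]]] :=
    pselect (admissible (blocks lam) (content w)).
  apply: (toW _ (perm_mono_word e_enum w)).
  by apply: span_mem; exists (content w).
pose w1 := filter (mem (b0 :: p)) w; pose w2 := filter (predC (mem (b0 :: p))) w.
have pw : perm_eq w (w2 ++ w1) by rewrite perm_sym perm_catC perm_filterC.
apply: (toW _ pw); rewrite fword_cat.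
have szw1 : size w1 = (\sum_(c <- b0 :: p) content w c)%N.
  rewrite size_filter; have /and3P[_ /dyck_uniq + _] := bp; elim: (b0 :: p) => [_|c q IH].
    by rewrite big_nil; apply/eqP; rewrite -leqn0 leqNgt -has_count -all_predC; apply/allP.
  move=> /= /andP[cq /IH e1]; rewrite big_cons -e1 ffunE -count_predUI.
  rewrite [X in (_ + X)%N](eq_count (a2 := pred0)) => [|x]; last first.
    by rewrite /=; case: eqP => // ->; rewrite (negPf cq).
  by rewrite count_pred0 addn0; apply: eq_count => x; rewrite /= inE.
have h := @violation_leading b0 p w1 bp (filter_all _ _).
have {h} := h; rewrite szw1 => /(_ viol).
apply: span_linear_ind (fword_is_linear _) _ _ => _ [w' w'w1 ->].
rewrite -fword_cat; have sw : size w = (size w2 + size w1)%N by rewrite (perm_size pw) size_cat.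
case: w'w1 => [w'w1|[w'w1 sp']].
  by apply: IHN; rewrite size_cat -ltnS (leq_trans _ wN) // ltnS sw szw1 ltn_add2l.
apply: IHS; last by rewrite size_cat w'w1 -szw1 -sw.
rewrite spread_cat -ltnS (leq_trans _ wS) // ltnS (spread_perm pw) spread_cat.
by rewrite ltn_add2l.
Qed.

End Spanning.

(** * Degrees in the cone *)

Section Monge.
Variables (R : realType) (N : nat) (D : nat -> nat -> R) (g : R).
Hypothesis g0 : 0 <= g.
Hypothesis D_adj : forall x y, (x < y)%N -> (y.+1 < N)%N ->
  D x y.+1 + D x.+1 y + g <= D x y + D x.+1 y.+1.

(** The adjacent inequalities add up over a rectangle, and one copy of the slack is kept: [g = 0]
    serves all points of the cone, [g = 2] serves [inner]. *)
Lemma monge x x' y y' : (x < x')%N -> (x' <= y)%N -> (y < y')%N -> (y' < N)%N ->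
  D x y' + D x' y + g <= D x y + D x' y'.
Proof.
have H x1 : forall y1 l, (x1 < y1)%N -> (y1 + l.+1 < N)%N ->
    D x1 (y1 + l.+1)%N + D x1.+1 y1 + g <= D x1 y1 + D x1.+1 (y1 + l.+1)%N.
  move=> y1 l xy; elim: l => [|l IH] lN; first by rewrite addn1 D_adj // -addn1.
  have h1 := IH ltac:(lia); have h2 := @D_adj x1 (y1 + l.+1)%N ltac:(lia) ltac:(lia).
  rewrite addnS; move: h1 h2 g0; lra.
move=> xx x'y yy' y'N; have -> : x' = (x + (x' - x).-1.+1)%N by lia.
have : (x + (x' - x).-1.+1 <= y)%N by lia.
elim: (x' - x).-1 => [|l IH] ly.
  rewrite addn1; have -> : y' = (y + (y' - y).-1.+1)%N by lia.
  by apply: H; lia.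
have h1 := IH ltac:(lia).
have h2 := @H (x + l.+1)%N y (y' - y).-1 ltac:(lia) ltac:(lia).
have e : (y + (y' - y).-1.+1 = y')%N by lia.
by rewrite e in h2; rewrite [(x + l.+2)%N]addnS; move: h1 h2 g0; lra.
Qed.

End Monge.

Section ConeDistance.
Variables (R : realType) (n : nat).
Implicit Types (d : posroot n -> R) (b : posroot n).

(* The extension of [d] to the root system of type A_{2n-1}: (x, y) with
   0 <= x < y < 2n stands for the root moving the basis vector x to y, and is
   identified with (2n - 1 - y, 2n - 1 - x). *)
Definition dist d (x y : nat) : R :=
  if (x < y)%N then
    if (x + y < n.*2)%N then coord d x.+1 y else coord d (n.*2 - y)%N (n.*2 - x.+1)%N
  else 0.

Lemma coordE d b : coord d (ri b) (rq b) = d b.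
Proof.
rewrite /coord; case: pickP => [b' /andP[/eqP e1 /eqP e2]|/(_ b)]; last by rewrite !eqxx.
by congr d; apply: posroot_inj.
Qed.

(** With [q = 2n - j] the second and third families of the cone become one adjacency inequality, for
    [q] below [n] and from [n] on. *)
Lemma cone_adj d i y : in_cone d -> (0 < i)%N -> (i < y)%N -> (i + y + 2 <= n.*2)%N ->
  coord d i y.+1 + coord d i.+1 y <= coord d i y + coord d i.+1 y.+1.
Proof.
move=> [_ h2 h3 _] i0 iy iyn; have [yn|yn] := leqP y n.-1; first exact: h2.
have := h3 i (n.*2 - y.+1)%N i0; rewrite /coord_bar.
have -> : (n.*2 - (n.*2 - y.+1) = y.+1)%N by lia.
have -> : (n.*2 - (n.*2 - y.+1).+1 = y)%N by lia.
by apply; lia.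
Qed.

(** The first family is the case [y = x.+1]. In a square centred on the antidiagonal the two terms
    on the right are the same coordinate, whence the factor 2 of the fourth family. The other
    squares are covered by [cone_adj], after reflection when they lie beyond the antidiagonal. *)
Lemma dist_adj d x y : in_cone d -> (x < y)%N -> (y.+1 < n.*2)%N ->
  dist d x y.+1 + dist d x.+1 y + 0 <= dist d x y + dist d x.+1 y.+1.
Proof.
move=> dc xy yn; have [h1 _ _ h4] := dc; rewrite addr0 /dist xy [(x.+1 < y.+1)%N]ltnS xy.
have -> : (x < y.+1)%N by lia.
rewrite addSn !addnS.
have [e|yx] := eqVneq y x.+1.
  rewrite e ltnn addr0.
  have [xn|xn] := ltnP (x + x.+1).+2 n.*2.
    have -> : (x + x.+1 < n.*2)%N by lia.
    have -> : ((x + x.+1).+1 < n.*2)%N by lia.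
    by apply: h1; lia.
  have -> : ((x + x.+1).+1 < n.*2)%N = false by lia.
  have E : (n.*2 - x.+1 = (n.*2 - x.+2).+1)%N by lia.
  rewrite E [leRHS]addrC; case: ifP => h; last by apply: h1; lia.
  have := h1 (n.*2 - x.+2)%N ltac:(lia); congr (_ <= _ + _); congr coord; lia.
have -> : (x.+1 < y)%N by lia.
have [a|a] := ltnP (x + y).+2 n.*2.
  have -> : ((x + y).+1 < n.*2)%N by lia.
  have -> : (x + y < n.*2)%N by lia.
  by apply: cone_adj => //; lia.
have [b|b] := ltnP (x + y).+1 n.*2.
  have -> : (x + y < n.*2)%N by lia.
  have -> : (n.*2 - y.+1 = x.+1)%N by lia.
  have -> : (n.*2 - x.+2 = y)%N by lia.
  have := h4 x.+1; rewrite /coord_bar.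
  have -> : (n.*2 - x.+1 = y.+1)%N by lia.
  have -> : (n.*2 - x.+2 = y)%N by lia.
  rewrite mulr2n mulrDl !mul1r; apply; lia.
have E1 : (n.*2 - y = (n.*2 - y.+1).+1)%N by lia.
have E2 : (n.*2 - x.+1 = (n.*2 - x.+2).+1)%N by lia.
rewrite [leRHS]addrC.
have [c|c] := ltnP (x + y) n.*2; last by rewrite E1 E2; apply: cone_adj => //; lia.
have := @cone_adj d (n.*2 - y.+1)%N (n.*2 - x.+2)%N dc ltac:(lia) ltac:(lia) ltac:(lia).
rewrite -E1 -E2; congr (_ <= _ + _); congr coord; lia.
Qed.

Lemma dist_root d b (r c : 'I_(n + n)) : root_mx R[i] b r c != 0 ->
  (c < r)%N /\ dist d c r = d b.
Proof.
have [b0 bq bqn] := posrootP b.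
move=> /root_mx_supp[[-> ->]|[-> ->]]; rewrite /dist /=.
  have -> : ((ri b).-1 < rq b)%N by lia.
  have -> : ((ri b).-1 + rq b < n.*2)%N by lia.
  by rewrite prednK // coordE.
rewrite prednK // addnn.
have -> : (n.*2 - (rq b).+1 < n.*2 - ri b)%N by lia.
split=> //; case: ifP => h.
  have -> : (n.*2 - (rq b).+1).+1 = ri b by lia.
  have -> : (n.*2 - ri b = rq b)%N by lia.
  by rewrite coordE.
have -> : (n.*2 - (n.*2 - ri b) = ri b)%N by lia.
have -> : (n.*2 - (n.*2 - (rq b).+1).+1 = rq b)%N by lia.
by rewrite coordE.
Qed.

Definition deg d (w : seq (posroot n)) : R := \sum_(b <- w) d b.

(** In the coordinates of [dist] this is [-(y - x)^2], whose mixed second difference is constantly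
    2. *)
Definition inner b : R := - ((rq b).+1%:R - (ri b)%:R) ^+ 2.

Lemma coord_inner i q : (0 < i)%N -> (i <= q)%N -> (i + q <= n.*2)%N ->
  coord inner i q = - (q.+1%:R - i%:R) ^+ 2.
Proof. by move=> i0 iq iqn; have [b <- <-] := mkrootP i0 iq iqn; rewrite coordE. Qed.

Lemma dist_inner x y : (x <= y)%N -> (y < n.*2)%N -> dist inner x y = - (y%:R - x%:R) ^+ 2.
Proof.
rewrite leq_eqVlt /dist => /orP[/eqP -> _|xy yn].
  by rewrite ltnn subrr expr0n oppr0.
rewrite xy; case: ifP => h; rewrite coord_inner; try lia.
  by rewrite -!natr1; congr (- _ ^+ _); ring.
have -> : (n.*2 - x.+1).+1 = (n.*2 - x)%N by lia.
by rewrite !natrB; try lia; congr (- _ ^+ _); ring.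
Qed.

Lemma inner_adj x y : (x < y)%N -> (y.+1 < n.*2)%N ->
  dist inner x y.+1 + dist inner x.+1 y + 2 <= dist inner x y + dist inner x.+1 y.+1.
Proof.
by move=> xy yn; rewrite !dist_inner ?(ltnW xy) //; try lia; rewrite -!natr1; lra.
Qed.

(* The inequalities of the cone hold with slack 2 at [inner], and a
   perturbation of all coordinates by at most 1/2 changes each of them by at most 2. *)
Lemma perturb_cone (eps : R) (h : posroot n -> R) : eps + eps <= 1 ->
  (forall b, `|h b| <= eps) -> in_cone (fun b => inner b + h b).
Proof.
move=> heps hb.
have C i q : (0 < i)%N -> (i <= q)%N -> (i + q <= n.*2)%N ->
    - (q.+1%:R - i%:R) ^+ 2 - eps <= coord (fun b => inner b + h b) i q <=
    - (q.+1%:R - i%:R) ^+ 2 + eps.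
  move=> i0 iq iqn; have [b <- <-] := mkrootP i0 iq iqn; rewrite coordE /inner.
  by have := hb b; rewrite ler_norml; lra.
have C4 i q : (0 < i)%N -> (i < q)%N -> (i + q + 2 <= n.*2)%N ->
    coord (fun b => inner b + h b) i q.+1 + coord (fun b => inner b + h b) i.+1 q <=
    coord (fun b => inner b + h b) i q + coord (fun b => inner b + h b) i.+1 q.+1.
  move=> i0 iq iqn.
  have [p1 p2] : (i + q.+1 <= n.*2)%N /\ (i.+1 + q <= n.*2)%N by lia.
  have [p3 p4] : (i + q <= n.*2)%N /\ (i.+1 + q.+1 <= n.*2)%N by lia.
  have := C i q.+1 i0 (leqW (ltnW iq)) p1; have := C i.+1 q isT iq p2.
  have := C i q i0 (ltnW iq) p3; have := C i.+1 q.+1 isT (leqW iq) p4.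
  by move: heps; rewrite -!natr1; clear; lra.
split=> [i i0|i j i0 ij jn|i j i0 ij jn|i i0]; rewrite /coord_bar.
- have [p1 p2] : (0 < i)%N /\ (i.+1 + i.+1 <= n.*2)%N by lia.
  have [p3 p4] : (i + i.+1 <= n.*2)%N /\ (i + i <= n.*2)%N by lia.
  have := C i i.+1 p1 (leqnSn i) p3; have := C i i p1 (leqnn i) p4.
  have := C i.+1 i.+1 isT (leqnn _) p2.
  by move: heps; rewrite -!natr1; clear; lra.
- by apply: C4 => //; lia.
- have -> : (n.*2 - j = (n.*2 - j.+1).+1)%N by lia.
  by apply: C4 => //; lia.
- have [p1 p2] : (0 < i)%N /\ (i < n.*2 - i.+1)%N by lia.
  have [p3 p4] : (i + (n.*2 - i.+1).+1 <= n.*2)%N /\ (i.+1 + (n.*2 - i.+1) <= n.*2)%N by lia.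
  have p5 : (i + (n.*2 - i.+1) <= n.*2)%N by lia.
  have -> : (n.*2 - i = (n.*2 - i.+1).+1)%N by lia.
  move: (n.*2 - i.+1)%N p2 p3 p4 p5 => q p2 p3 p4 p5.
  have := C i q.+1 p1 (leqW (ltnW p2)) p3; have := C i.+1 q isT p2 p4.
  have := C i q p1 (ltnW p2) p5.
  by move: heps; rewrite -!natr1; clear; lra.
Qed.

Lemma inner_cone : in_cone inner.
Proof.
have -> : inner = (fun b => inner b + 0) by apply/funext => b; rewrite addr0.
by apply: (@perturb_cone 0) => [|b]; rewrite ?addr0 ?normr0.
Qed.

Lemma deg_count d w : deg d w = \sum_b (count_mem b w)%:R * d b.
Proof.
rewrite /deg; elim: w => [|b w IH].
  by rewrite big_nil big1 // => b _; rewrite mul0r.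
rewrite big_cons IH /=; under [RHS]eq_bigr do rewrite natrD mulrDl.
rewrite big_split /=; congr (_ + _).
rewrite (bigD1 b) //= eqxx mul1r big1 ?addr0 // => b' /negPf b'b.
by rewrite eq_sym b'b mul0r.
Qed.

(** Moving [inner] by 1/2 up or down in the coordinate [b] stays in the cone, and the two resulting
    comparisons bound the multiplicity of [b] from both sides. *)
Lemma deg_separated w w' : (forall d, in_cone d -> deg d w <= deg d w') ->
  deg inner w = deg inner w' -> perm_eq w w'.
Proof.
move=> le e; apply/allP => b _; apply/eqP => /=.
pose h c b' : R := if b' == b then c else 0.
have hE c v : deg (fun b' => inner b' + h c b') v = deg inner v + (count_mem b v)%:R * c.
  rewrite !deg_count; under eq_bigr do rewrite mulrDr.
  rewrite big_split /=; congr (_ + _); rewrite (bigD1 b) //= /h eqxx big1 ?addr0 //.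
  by move=> b' /negPf ->; rewrite mulr0.
have H (c : R) : `|c| <= 2^-1 -> (count_mem b w)%:R * c <= (count_mem b w')%:R * c.
  move=> cle; have /le : in_cone (fun b' => inner b' + h c b').
    apply: (@perturb_cone 2^-1) => [|b']; first by lra.
    by rewrite /h; case: ifP; rewrite ?normr0 ?invr_ge0.
  by rewrite !hE e lerD2l.
have := H 2^-1; have := H (- 2^-1); rewrite normrN ger0_norm ?invr_ge0 // lexx.
move=> /(_ isT) h1 /(_ isT) h2; apply/eqP; rewrite -(eqr_nat R); apply/eqP.
move: h1 h2; lra.
Qed.

End ConeDistance.

(** * Coordinates of words in the tensor model *)

Section Evaluation.
Variables (R : realType) (n m : nat) (k : 'I_m -> nat).
Hypothesis k_le : forall j, (k j <= n)%N.
Local Notation C := R[i].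
Local Notation hw := (hw_tensor C n k).
Local Notation word w := (fword (E := tensor_rep C n k) w hw).
Local Notation slot := (slot n k).
Local Notation multi := (multi n k).
Implicit Types (I : multi) (t : slot) (s : {perm slot}) (D : nat -> nat -> R)
  (w : seq (posroot n)) (b : posroot n) (A : 'I_m -> {set posroot n}).

(** A transport plan: the basis vector starting at [pos (s t)] is carried to its target [I t]. *)
Definition cost D s I : R := \sum_t D (pos (s t)) (I t).

Lemma word_cons b w I :
  word (b :: w) I = \sum_t \sum_a root_mx C b (I t) a * word w (upd I t a).
Proof.
rewrite [fword _ _]/= /froot mact_tensor ?root_mx_sp // /tensor_act sum_ffunE.
by apply: eq_bigr => t _; rewrite ffunE.
Qed.

(** The Monge inequality with both middle points equal to [a], as [dist] vanishes on the
    diagonal. *)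
Lemma dist_triangle (d : posroot n -> R) (g : R) x a y : 0 <= g ->
  (forall x y, (x < y)%N -> (y.+1 < n.*2)%N ->
    dist d x y.+1 + dist d x.+1 y + g <= dist d x y + dist d x.+1 y.+1) ->
  (x < a)%N -> (a < y)%N -> (y < n.*2)%N ->
  dist d x y + g <= dist d x a + dist d a y.
Proof.
move=> g0 adj xa ay yn; have := monge g0 adj xa (leqnn a) ay yn.
by rewrite {2}/dist ltnn addr0.
Qed.

Lemma dist_diag (d : posroot n -> R) x : dist d x x = 0.
Proof. by rewrite /dist ltnn. Qed.

Lemma cost_upd D s I t a :
  cost D s I - D (pos (s t)) (I t) = cost D s (upd I t a) - D (pos (s t)) a.
Proof.
rewrite /cost (bigD1 t) //= [in RHS](bigD1 t) //= upd_same.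
rewrite addrAC subrr add0r addrAC subrr add0r.
by apply: eq_bigr => t' tt'; rewrite upd_other.
Qed.

Lemma ord_lt_double (c : 'I_(n + n)) : (c < n.*2)%N.
Proof. by rewrite -addnn. Qed.

(* The letters of [w] move every basis vector of the highest weight tensor, up
   to a permutation, to its position in [I]. *)
Lemma word_support w I : word w I != 0 -> exists s, [/\ blk_perm s,
  forall t, (pos (s t) <= I t)%N
  & forall d : posroot n -> R, in_cone d -> cost (dist d) s I <= deg d w].
Proof.
elim: w I => [|b w IH] I.
  move=> /hw_tensor_eval[s bs Is]; exists s; split=> [//|t|d dc]; rewrite ?Is //.
  by rewrite /deg big_nil /cost big1 // => t _; rewrite Is dist_diag.
rewrite word_cons => nz.
have [t [a]] : exists t a, root_mx C b (I t) a * word w (upd I t a) != 0.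
  apply: contrapT => /forallNP h; move: nz; rewrite big1 ?eqxx // => t _.
  by rewrite big1 // => a _; apply: contrapT => h'; apply: (h t); exists a; apply/eqP.
rewrite mulf_eq0 negb_or => /andP[ba /IH[s [bs ps ds]]].
exists s; have [aI _] := dist_root (fun=> 0 : R) ba.
have pa : (pos (s t) <= a)%N by have := ps t; rewrite upd_same.
split=> [//|t'|d dc].
  have [->|tt'] := eqVneq t' t; first exact: leq_trans pa (ltnW aI).
  by have := ps t'; rewrite upd_other.
have := ds d dc; rewrite /deg big_cons -(dist_root d ba).2.
have := cost_upd (dist d) s I t a.
have : dist d (pos (s t)) (I t) <= dist d (pos (s t)) a + dist d a (I t).
  move: pa; rewrite leq_eqVlt => /orP[/eqP ->|pa]; first by rewrite dist_diag add0r.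
  have := dist_triangle (lexx 0) (fun x y => @dist_adj R n d x y dc) pa aI (ord_lt_double _).
  by rewrite addr0.
rewrite -/(deg d w); lra.
Qed.

Lemma low_val b : low b = rq b :> nat. Proof. by []. Qed.

Section Antichains.

(** The roots in [A j] move one of the first [k j] basis vectors past all of them; these antichains
    are the supports of the lattice points of the polytope of omega_{k_j}. *)
Definition antichains A := forall j b, b \in A j -> [/\ (ri b <= k j)%N, (k j <= rq b)%N
  & forall b', b' \in A j -> nested b b' -> b = b'].

Definition antichain_index A : multi := [ffun t =>
  if [pick b in A (blk t) | ri b == (pos t).+1] is Some b then low b else pos t].

Lemma antichain_uniq A j b b' : antichains A -> b \in A j -> b' \in A j ->
  ri b = ri b' -> b = b'.
Proof.
move=> anti bA b'A e; have [_ _ hb] := anti _ _ bA; have [_ _ hb'] := anti _ _ b'A.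
have [le|/ltnW le] := leqP (rq b) (rq b'); first by apply: hb; rewrite // /nested e leqnn.
by apply/esym/hb'; rewrite // /nested e leqnn.
Qed.

Lemma antichain_indexE A t b : antichains A -> b \in A (blk t) -> ri b = (pos t).+1 ->
  antichain_index A t = low b.
Proof.
move=> anti bA e; rewrite ffunE; case: pickP => [b' /andP[b'A /eqP e']|/(_ b)].
  by rewrite (antichain_uniq anti b'A bA) // e' e.
by rewrite bA e eqxx.
Qed.

Lemma antichain_index_cases A t : antichains A ->
  (exists b, [/\ b \in A (blk t), ri b = (pos t).+1 & antichain_index A t = low b]) \/
  antichain_index A t = pos t /\ forall b, b \in A (blk t) -> ri b <> (pos t).+1.
Proof.
move=> anti; rewrite ffunE; case: pickP => [b /andP[bA /eqP e]|h].
  by left; exists b.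
by right; split=> // b bA e; have := h b; rewrite bA e eqxx.
Qed.

Section Exchange.
Variables (A : 'I_m -> {set posroot n}) (D : nat -> nat -> R) (g : R).
Hypotheses (anti : antichains A) (g0 : 0 <= g).
Hypothesis D_adj : forall x y, (x < y)%N -> (y.+1 < n.*2)%N ->
  D x y.+1 + D x.+1 y + g <= D x y + D x.+1 y.+1.
Local Notation I := (antichain_index A).

Lemma swap_cost s t c : t != c ->
  D (pos (s c)) (I t) + D (pos (s t)) (I c) + g <= D (pos (s t)) (I t) + D (pos (s c)) (I c) ->
  cost D (tperm t c * s)%g I + g <= cost D s I.
Proof.
move=> tc; have costE s' : cost D s' I = D (pos (s' t)) (I t) + (D (pos (s' c)) (I c) +
    \sum_(t' | (t' != t) && (t' != c)) D (pos (s' t')) (I t')).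
  by rewrite /cost (bigD1 t) // (bigD1 c) // eq_sym.
rewrite !costE !permM tpermL tpermR.
rewrite [X in _ + (_ + X) + _](eq_bigr (fun t' => D (pos (s t')) (I t'))) => [|t']; last first.
  by move=> /andP[t't t'c]; rewrite permM tpermD // eq_sym.
lra.
Qed.

(** A swap with [s c = t] makes [t] a fixed slot. If some moved [t] has target [pos t], its source
    lies before [pos t] and the target of [c] after it, so the Monge inequality applies with middle
    points [pos t]. Otherwise all moved slots carry roots of the antichain; for [t] the first of
    them in its block [pos t < pos c], so the antichain condition gives [I c < I t], and the two
    transports cross. *)
Lemma exchange_step s : blk_perm s -> (forall t, (pos (s t) <= I t)%N) -> s != 1%g ->
  exists s', [/\ blk_perm s', forall t, (pos (s' t) <= I t)%N,
    (#|[pred t | s' t != t]| < #|[pred t | s t != t]|)%N & cost D s' I + g <= cost D s I].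
Proof.
move=> /blk_permP bs ps s1.
have [t0 st0] : exists t, s t != t.
  apply/existsP; rewrite -negb_forall; apply: contra s1 => /forallP h.
  by apply/eqP/permP => t; rewrite perm1; apply/eqP.
suff [t [c [st sc bc hp hm]]] : exists t c, [/\ s t != t, s c = t, blk c = blk t,
    (pos (s t) <= I c)%N & D (pos t) (I t) + D (pos (s t)) (I c) + g <=
      D (pos (s t)) (I t) + D (pos t) (I c)].
  have tc : t != c by apply: contraNneq st => e; rewrite {1}e sc.
  have posI : (pos t <= I t)%N.
    have [[b [_ e ->]]|[-> _]] := antichain_index_cases t anti; last by [].
    by have [_ le _] := posrootP b; rewrite low_val; lia.
  exists (tperm t c * s)%g; split.
  - apply/blk_permP => x; rewrite permM; case: tpermP => [->|->|_ _].
    + by rewrite sc.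
    + by rewrite bs bc.
    + exact: bs.
  - move=> x; rewrite permM; case: tpermP => [->|->|_ _]; rewrite ?sc //.
  - apply: proper_card; apply/properP; split; last first.
      exists t; first exact: st.
      by change (~~ ((tperm t c * s)%g t != t)); rewrite permM tpermL sc eqxx.
    apply/fintype.subsetP => x; change ((tperm t c * s)%g x != x -> s x != x).
    rewrite permM; case: tpermP => [->|->|//]; first by rewrite sc eqxx.
    by move=> _; rewrite sc.
  - by apply: swap_cost; rewrite ?sc.
have I_lt x : (I x < n.*2)%N by apply: ord_lt_double.
have sI x : blk ((s^-1)%g x) = blk x by rewrite -[in RHS](permKV s x) bs.
have Iinj c t : blk c = blk t -> I t = pos t :> nat -> I c = pos t :> nat -> c = t.
  move=> bct It Ic; have [[b [bA e Ib]]|[Ic' _]] := antichain_index_cases c anti.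
    have [_ kq _] := anti bA; have := pos_lt t; rewrite -bct.
    by move: Ic; rewrite Ib low_val; lia.
  by apply: slot_inj; rewrite // -Ic Ic'.
have [/existsP[t /andP[st /eqP It]]|] := boolP [exists t, (s t != t) && (I t == pos t)].
  pose c := (s^-1)%g t; have sc : s c = t by rewrite /c permKV.
  have bc : blk c = blk t by rewrite /c sI.
  have ct : c != t by apply: contraNneq st => e; rewrite -{1}e sc.
  have st_lt : (pos (s t) < pos t)%N.
    rewrite ltn_neqAle -{2}It ps andbT; apply: contra_neqN st => /eqP e.
    by apply: slot_inj; rewrite ?bs.
  have tIc : (pos t < I c)%N.
    rewrite ltn_neqAle -{2}sc ps andbT; apply: contra_neqN ct => /eqP e.
    by apply: Iinj; rewrite ?It.
  exists t, c; split=> //; first by rewrite ltnW // (ltn_trans st_lt).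
  have := monge g0 D_adj st_lt (leqnn _) tIc (I_lt c); rewrite It; lra.
rewrite negb_exists => /forallP moved.
have [t st tmin] := @arg_minnP _ t0 (fun t => s t != t) (fun t => nat_of_ord (pos t)) st0.
pose c := (s^-1)%g t; have sc : s c = t by rewrite /c permKV.
have bc : blk c = blk t by rewrite /c sI.
have ct : c != t by apply: contraNneq st => e; rewrite -{1}e sc.
have snc : s c != c by rewrite sc eq_sym.
have snst : s (s t) != s t by rewrite (inj_eq perm_inj).
have lt_of x : blk x = blk t -> s x != x -> x != t -> (pos t < pos x)%N.
  move=> bx sx xt; rewrite ltn_neqAle tmin // andbT; apply: contra_neqN xt => /eqP e.
  by apply: slot_inj.
have tc := lt_of _ bc snc ct.
have tst := lt_of _ (bs t) snst st.
have := moved t; rewrite st /= => It.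
have := moved c; rewrite snc /= => Ic.
have [[b [bA eb Ib]]|[e]] := antichain_index_cases t anti; last by rewrite e eqxx in It.
have [[b' [b'A eb' Ib']]|[e]] := antichain_index_cases c anti; last by rewrite e eqxx in Ic.
have [_ kb hb] := anti bA; rewrite bc in b'A; have [_ kb' _] := anti b'A.
have bb' : (rq b' < rq b)%N.
  rewrite ltnNge; apply/negP => le; have E := hb _ b'A.
  have : b = b' by apply: E; rewrite /nested le eb eb' ltnS ltnW.
  by move=> E'; move: tc; rewrite -ltnS -eb -eb' E' ltnn.
have stk : (pos (s t) < k (blk t))%N by rewrite -(bs t) pos_lt.
have hp : (pos (s t) <= I c)%N by rewrite Ib' low_val; exact: leq_trans (ltnW stk) kb'.
have IcIt : (I c < I t)%N by rewrite Ib Ib' !low_val.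
exists t, c; split=> //.
have := monge g0 D_adj tst hp IcIt (I_lt t); lra.
Qed.

Lemma antichain_cost s : blk_perm s -> (forall t, (pos (s t) <= I t)%N) ->
  cost D 1%g I <= cost D s I /\ (0 < g -> s != 1%g -> cost D 1%g I < cost D s I).
Proof.
have [N] := ubnP #|[pred t | s t != t]|; elim: N s => // N IH s sN bs ps.
have [->|s1] := eqVneq s 1%g; first by rewrite lexx.
have [s' [bs' ps' s's le]] := exchange_step bs ps s1.
have [h _] := IH s' (leq_trans s's sN) bs' ps'.
split=> [|gp _]; move: h le g0; first by lra.
by move: gp; lra.
Qed.

End Exchange.

(** The word formed by the antichains attains the bound of [word_support], with the identity as
    transport plan. *)
Lemma antichain_deg A (d : posroot n -> R) w : antichains A ->
  (forall b, count_mem b w = \sum_j (b \in A j))%N ->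
  deg d w = cost (dist d) 1%g (antichain_index A).
Proof.
move=> anti wA; rewrite deg_count /cost.
have E t : dist d (pos ((1%g : {perm slot}) t)) (antichain_index A t) =
    \sum_b ((b \in A (blk t)) && (ri b == (pos t).+1))%:R * d b.
  rewrite perm1; have [[b [bA e ->]]|[-> h]] := antichain_index_cases t anti.
    have -> : dist d (pos t) (low b) = d b.
      have <- : top b = pos t by apply: val_inj; rewrite /= e.
      by have [] := @dist_root R n d b (low b) (top b); rewrite ?root_mx_entry ?eqxx ?oner_eq0.
    rewrite (bigD1 b) // bA e eqxx mul1r big1 => [|b' b'b]; first exact/esym/addr0.
    case: andP => [[b'A /eqP e']|]; last by rewrite mul0r.
    by move/eqP: b'b; case; apply: (antichain_uniq anti b'A bA); rewrite e' e.
  rewrite dist_diag big1 // => b _; case: andP => [[bA /eqP e]|]; last by rewrite mul0r.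
  by case: (h b bA).
rewrite (eq_bigr _ (fun t _ => E t)) exchange_big; apply: eq_bigr => b _.
rewrite -mulr_suml wA natr_sum; congr (_ * _).
rewrite [RHS](partition_big (@blk _ _ _) predT) //=; apply: eq_bigr => j _.
have [bA|bA] := boolP (b \in A j); last first.
  by rewrite big1 // => t /eqP tj; rewrite tj (negPf bA).
have [bk _ _] := anti _ _ bA; have b0 := ri_gt0 b.
have [t tj te] : exists2 t : slot, blk t = j & pos t = (ri b).-1 :> nat.
  by apply: slotP => //; rewrite prednK.
have te' : (pos t).+1 = ri b by rewrite te prednK.
rewrite (bigD1 t) ?tj // te' bA eqxx big1 => [|t' /andP[/eqP t'j t't]]; first exact/esym/addr0.
case: andP => // -[_ /eqP e]; case/negP: t't; apply/eqP/slot_inj; first by rewrite t'j.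
by apply: succn_inj; rewrite te' -e.
Qed.

(** There is no cancellation. Expand along the first letter [b]: a nonzero term has minimal cost for
    [inner], and strictness forces the identity plan, a single move from the original position, and
    [b] equal to the root of the antichain there. The entry used is then [(low b, top b)], which is
    1, so the entries -1 of root vectors never contribute. *)
Lemma antichain_value A w : antichains A ->
  (forall b, count_mem b w = \sum_j (b \in A j))%N ->
  0 < word w (antichain_index A).
Proof.
elim: w A => [|b w IH] A anti wA.
  have A0 j b : b \in A j = false.
    by have /esym/eqP := wA b; rewrite sum_nat_eq0 => /forall_inP/(_ j isT); rewrite eqb0 => /negPf.
  have -> : antichain_index A = [ffun t => pos t].
    apply/ffunP => t; rewrite [RHS]ffunE.
    by have [[b [bA _ _]]|[-> //]] := antichain_index_cases t anti; rewrite A0 in bA.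
  by rewrite hw_tensor_pos ltr01.
have good t c : c \in A (blk t) -> ri c = (pos t).+1 -> c = b ->
    0 < root_mx C b (antichain_index A t) (pos t) * word w (upd (antichain_index A) t (pos t)).
  move=> cA e cb; rewrite (antichain_indexE anti cA e).
  have -> : pos t = top c by apply: val_inj; rewrite /= e.
  rewrite cb root_mx_entry eqxx mul1r -cb.
  have -> : top c = pos t by apply: val_inj; rewrite /= e.
  pose A' j := if j == blk t then A j :\ c else A j.
  have A'A j b' : b' \in A' j -> b' \in A j.
    by rewrite /A'; case: ifP => // _; rewrite in_setD1 => /andP[].
  have anti' : antichains A'.
    move=> j b' /[dup] b'A' /A'A /anti[h1 h2 h3]; split=> // b'' /A'A; exact: h3.
  have -> : upd (antichain_index A) t (pos t) = antichain_index A'.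
    apply/ffunP => t'; have [->|tt'] := eqVneq t' t.
      rewrite upd_same; have [[c' [c'A e' _]]|[-> //]] := antichain_index_cases t anti'.
      move: c'A; rewrite /A' eqxx in_setD1 => /andP[/eqP c'c c'A].
      by case: c'c; apply: (antichain_uniq anti c'A cA); rewrite e' e.
    rewrite upd_other //; have [[c' [c'A e' ->]]|[-> h]] := antichain_index_cases t' anti.
      rewrite (@antichain_indexE _ _ c') // /A'; case: eqP => // bb.
      rewrite in_setD1 c'A andbT; apply: contra_neq tt' => cc.
      by apply: slot_inj; rewrite // -[LHS]/((pos t').+1.-1) -e' cc e.
    have [[c' [/A'A c'A e' _]]|[-> //]] := antichain_index_cases t' anti'.
    by case: (h _ c'A).
  apply: IH => // b'; have := wA b'; rewrite /= => h.
  apply: (@addnI (b == b')); rewrite h (bigD1 (blk t)) //= [in RHS](bigD1 (blk t)) //=.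
  rewrite addnA; congr (_ + _)%N; last first.
    by apply: eq_bigr => j /negPf jt; rewrite /A' jt.
  rewrite /A' eqxx in_setD1 -cb; have [e'|_] := eqVneq c b'; first by rewrite -e' cA.
  by [].
rewrite word_cons; have two0 : 0 < 2 :> R by rewrite ltr0n.
have term t a : 0 <= root_mx C b (antichain_index A t) a * word w (upd (antichain_index A) t a).
  set x := _ * _; have [->//|nz] := eqVneq x 0; rewrite {}/x in nz *.
  move: (nz); rewrite mulf_eq0 negb_or => /andP[ba /word_support[s [bs ps ds]]].
  have [aI da] := dist_root (@inner R n) ba.
  have pa : (pos (s t) <= a)%N by have := ps t; rewrite upd_same.
  have ps' t' : (pos (s t') <= antichain_index A t')%N.
    have [->|tt'] := eqVneq t' t; first exact: leq_trans pa (ltnW aI).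
    by have := ps t'; rewrite upd_other.
  have [le lt] := @antichain_cost A _ 2 anti (ltW two0) (@inner_adj R n) s bs ps'.
  have dg := antichain_deg (@inner R n) anti wA.
  have ds1 := ds _ (@inner_cone R n).
  move: dg; rewrite /deg big_cons -/(deg _ w) -da => dg.
  have cu := cost_upd (dist (@inner R n)) s (antichain_index A) t a.
  (* The degree of [b :: w] is already the optimal cost, which leaves no room for the loss of 2 in
     the triangle inequality. *)
  have spa : pos (s t) = a :> nat.
    move: pa; rewrite leq_eqVlt => /orP[/eqP //|pa].
    have tri := dist_triangle (ltW two0) (@inner_adj R n) pa aI (ord_lt_double _).
    exfalso; move: tri cu dg ds1 le; lra.
  have s1 : s = 1%g.
    apply/eqP/negPn/negP => /(lt two0) {}lt.
    move: cu dg ds1 lt; rewrite spa dist_diag; lra.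
  have ea : a = pos t by rewrite s1 perm1 in spa; apply/esym/val_inj.
  rewrite ea in ba aI *; have [[c [cA e Ic]]|[e _]] := antichain_index_cases t anti.
    apply/ltW/(good t c cA e).
    have pt : pos t = top c by apply: val_inj; rewrite /= e.
    by move: ba; rewrite Ic pt root_mx_entry; have [//|_] := eqVneq b c; rewrite eqxx.
  by rewrite e ltnn in aI.
have [j bA] : exists j, b \in A j.
  apply/existsP; have := wA b; rewrite /= eqxx add1n; apply: contra_eqT => h.
  by rewrite big1 // => j _; move: h; rewrite negb_exists => /forallP/(_ j)/negPf ->.
have [bk _ _] := anti _ _ bA; have b0 := ri_gt0 b.
have [t tj te] : exists2 t : slot, blk t = j & pos t = (ri b).-1 :> nat.
  by apply: slotP => //; rewrite prednK.
rewrite (bigD1 t) //= (bigD1 (pos t)) //=.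
apply: ltr_wpDr; first by apply: sumr_ge0 => t' _; apply: sumr_ge0 => a _; apply: term.
apply: ltr_wpDr; first by apply: sumr_ge0 => a _; apply: term.
by apply: (good t b); rewrite ?tj // te prednK.
Qed.

Lemma antichain_minimal A w w' : antichains A ->
  (forall b, count_mem b w = \sum_j (b \in A j))%N ->
  word w' (antichain_index A) != 0 ->
  forall d : posroot n -> R, in_cone d -> deg d w <= deg d w'.
Proof.
move=> anti wA /word_support[s [bs ps ds]] d dc.
rewrite (antichain_deg d anti wA); apply: le_trans (ds d dc).
by have [] := antichain_cost anti (lexx 0) (fun x y => @dist_adj R n d x y dc) bs ps.
Qed.

End Antichains.
End Evaluation.

(** * Decomposition of the points of the polytope *)

Section Minkowski.
Variable n : nat.
Implicit Types (b c : posroot n) (p s : seq (posroot n)) (t : posroot n -> nat).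

Lemma nested_path b c : nested b c ->
  exists2 p, path (@dyck_step n) b p & last b p = c.
Proof.
have [N] := ubnP ((ri c - ri b) + (rq c - rq b))%N; elim: N b => // N IH b Nb /andP[bi bq].
have [b0 bb bn] := posrootP b; have [c0 cc cn] := posrootP c.
have [lq|eq] := ltnP (rq b) (rq c).
  have [b' bi' bq'] := @mkrootP n (ri b) (rq b).+1 b0 ltac:(lia) ltac:(lia).
  have [||p b'p lp] := IH b'; first by rewrite bi' bq'; lia.
    by rewrite /nested bi' bq' bi.
  exists (b' :: p) => //=; rewrite b'p andbT /dyck_step bi' bq' !eqxx //.
have [li|ei] := ltnP (ri b) (ri c).
  have [b' bi' bq'] := @mkrootP n (ri b).+1 (rq b) isT ltac:(lia) ltac:(lia).
  have [||p b'p lp] := IH b'; first by rewrite bi' bq'; lia.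
    by rewrite /nested bi' bq' li.
  exists (b' :: p) => //=; rewrite b'p andbT /dyck_step bi' bq' !eqxx orbT //.
by exists [::] => //=; apply: posroot_inj; lia.
Qed.

Lemma path_start b : exists b0 p, [/\ simple_root b0, ri b0 = ri b,
  path (@dyck_step n) b0 p & last b0 p = b].
Proof.
have [i0 iq iqn] := posrootP b.
have [b0 e1 e2] := @mkrootP n (ri b) (ri b) i0 (leqnn _) ltac:(lia).
have [|p bp lp] := @nested_path b0 b; first by rewrite /nested e1 e2 leqnn iq.
by exists b0, p; rewrite /simple_root e1 e2 eqxx.
Qed.

Lemma path_end b : exists p, path (@dyck_step n) b p /\
  (simple_root (last b p) /\ ri (last b p) = rq b \/ long_root (last b p) /\ (n < rq b)%N).
Proof.
have [i0 iq iqn] := posrootP b; have [qn|qn] := leqP (rq b) n.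
  have [c e1 e2] := @mkrootP n (rq b) (rq b) ltac:(lia) (leqnn _) ltac:(lia).
  have [|p bp lp] := @nested_path b c; first by rewrite /nested e1 e2 leqnn iq.
  by exists p; rewrite lp /simple_root e1 e2 eqxx; split=> //; left.
have [c e1 e2] := @mkrootP n (n.*2 - rq b)%N (rq b) ltac:(lia) ltac:(lia) ltac:(lia).
have [|p bp lp] := @nested_path b c; first by rewrite /nested e1 e2 leqnn andbT; lia.
exists p; rewrite lp /long_root e1 e2; split=> //; right; split=> //.
by apply/andP; split; [lia|apply/eqP; lia].
Qed.

(** The weights omega_x counted by the bound of a path from [b] to [c], for both kinds of final
    root. *)
Definition path_bound b c x := (ri b <= x)%N && (simple_root c ==> (x <= ri c)%N).

Lemma admissibleE ks t : admissible ks t <-> forall b p, dyck_path b p ->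
  (\sum_(c <- b :: p) t c <= count (path_bound b (last b p)) ks)%N.
Proof.
split=> h b p bp; have /and3P[_ _ sl] := bp.
  have [h1 h2] := h b p bp; rewrite /path_bound.
  case: (boolP (simple_root (last b p))) h1 sl => [sp /(_ isT) //|_ _ /= l].
  by under eq_count do rewrite andbT; apply: h2.
have := h b p bp; rewrite /path_bound => h'; split=> sp; first by move: h'; rewrite sp.
have : simple_root (last b p) = false.
  by apply/negP => /eqP e; move: sp => /andP[l1 /eqP l2]; lia.
by move: h' => /[swap] ->; under eq_count do rewrite andbT.
Qed.

Lemma first_positive t s : (\sum_(c <- s) t c = 0)%N \/ exists s1 b s2,
  [/\ s = s1 ++ b :: s2, (0 < t b)%N & (\sum_(c <- s) t c = \sum_(c <- b :: s2) t c)%N].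
Proof.
elim: s => [|b s IH]; first by left; rewrite big_nil.
have [tb|] := posnP (t b); last by right; exists [::], b, s.
rewrite big_cons tb add0n; case: IH => [|[s1 [b1 [s2 [-> h1 h2]]]]]; [by left|right].
by exists (b :: s1), b1, s2.
Qed.

Lemma path_split b0 p s1 b s2 : path (@dyck_step n) b0 p -> b0 :: p = s1 ++ b :: s2 ->
  [/\ path (@dyck_step n) b s2, last b s2 = last b0 p & nested b0 b].
Proof.
move=> bp e; split.
- have : sorted (@dyck_step n) (s1 ++ b :: s2) by rewrite -e.
  by move=> /cat_sorted2[].
- by rewrite -[RHS]/(last b0 (b0 :: p)) e last_cat.
- by apply: (dyck_head bp); rewrite e mem_cat mem_head orbT.
Qed.

Lemma leq_sum_mem s b t : b \in s -> (t b <= \sum_(c <- s) t c)%N.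
Proof. by move=> bs; rewrite (big_rem b bs) leq_addr. Qed.

Section Step.
Variables (i : nat) (ks : seq nat) (t : posroot n -> nat).
Hypotheses (i_le : forall x, x \in ks -> (i <= x)%N) (i_n : (i <= n)%N).
Hypothesis t_adm : admissible (i :: ks) t.

Let J b := (0 < t b)%N && (ri b <= i)%N.

(** The share of the smallest weight omega_i: roots of the support with [ri b <= i] and no other
    such root before them on a Dyck path. *)
Definition minimal_set : {set posroot n} :=
  [set b | J b && [forall b', J b' && nested b' b ==> (b' == b)]]%SET.

(** If [rq b < i], then [b] lies on a path ending at the simple root of index [rq b]; its bound is
    0, as all weights in [i :: ks] are at least [i]. *)
Lemma support_above b : (0 < t b)%N -> (i <= rq b)%N.
Proof.
move=> tb; rewrite leqNgt; apply/negP => qi.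
have [b0 [p [b0s b0i b0p lp]]] := path_start b.
have [p' [bp' [[sp' lp']|[_]]]] := path_end b; last by lia.
have dp : dyck_path b0 (p ++ p').
  by rewrite /dyck_path b0s cat_path b0p lp bp' last_cat lp sp'.
have /admissibleE/(_ _ _ dp) := t_adm.
rewrite (_ : count _ _ = 0)%N ?leqn0.
  move=> /eqP s0; have : (t b <= \sum_(c <- b0 :: p ++ p') t c)%N.
    by apply: leq_sum_mem; rewrite -cat_cons mem_cat -lp mem_last.
  by rewrite s0; lia.
apply/eqP; rewrite -leqn0 leqNgt -has_count; apply/hasPn => x.
rewrite /path_bound last_cat lp sp' lp' inE => /orP[/eqP ->|/i_le]; lia.
Qed.

Lemma minimal_setP b : b \in minimal_set -> [/\ (ri b <= i)%N, (i <= rq b)%N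
  & forall b', b' \in minimal_set -> nested b b' -> b = b'].
Proof.
rewrite inE => /andP[/[dup] Jb /andP[tb bi] _]; split=> // [|b']; first exact: support_above.
by rewrite inE => /andP[_ /forallP/(_ b)/implyP h] bb'; apply/eqP/h; rewrite Jb.
Qed.

Lemma minimal_set_pos b : ((b \in minimal_set) <= t b)%N.
Proof. by rewrite inE; case: andP => // -[/andP[]]. Qed.

(** Only a path whose bound counts [i] and which misses the minimal set needs an argument. Let [b]
    be its first root in the support. If [ri b > i], starting instead from the simple root of index
    [ri b] gives a bound that no longer counts [i]. Otherwise [b] is not minimal, and a detour
    through an earlier root of the support keeps the bound while adding at least 1 to the sum. *)
Lemma admissible_sub : admissible ks (fun b => t b - (b \in minimal_set))%N.
Proof.
apply/admissibleE => b0 p dp; have /and3P[b0s b0p lor] := dp.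
pose t' b := (t b - (b \in minimal_set))%N.
rewrite -[leqLHS]/(\sum_(c <- b0 :: p) t' c)%N; pose P := path_bound b0 (last b0 p).
have t't s : (\sum_(c <- s) t' c <= \sum_(c <- s) t c)%N.
  by apply: leq_sum => b _; apply: leq_subr.
have /admissibleE := t_adm; move=> adm; have := adm _ _ dp; rewrite /= -/P.
have [Pi|nPi] := boolP (P i); last by rewrite add0n; apply: leq_trans.
have [/hasP[b bp bX] h|/hasPn noX _] := boolP (has (mem minimal_set) (b0 :: p)).
  rewrite -(leq_add2l true); apply: leq_trans h; rewrite !(big_rem b bp) addnA.
  apply: leq_add; last exact: t't.
  by have := minimal_set_pos b; rewrite /t' [b \in _]bX; lia.
apply: leq_trans (t't _) _.
have [->//|[s1 [b [s2 [e tb ->]]]]] := first_positive t (b0 :: p).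
have [bs2 ls2 b0b] := path_split b0p e; have bp : b \in b0 :: p.
  by rewrite e mem_cat mem_head orbT.
have ge x : x \in i :: ks -> (i <= x)%N by rewrite inE => /orP[/eqP ->|/i_le].
have Pge x : (i <= x)%N -> P x = (simple_root (last b0 p) ==> (x <= ri (last b0 p))%N).
  by move: Pi; rewrite /P /path_bound; lia.
have [bi|bi] := leqP (ri b) i; last first.
  have [c0 [q [c0s c0i c0q lq]]] := path_start b.
  have dq : dyck_path c0 (q ++ s2).
    by rewrite /dyck_path c0s cat_path c0q lq bs2 last_cat lq ls2.
  apply: leq_trans (leq_trans _ (adm _ _ dq)) _.
    rewrite -cat_cons big_cat big_cons leq_add2r.
    by apply: leq_sum_mem; rewrite -lq mem_last.
  rewrite /= {1}/path_bound c0i [(ri b <= i)%N]leqNgt bi add0n last_cat lq ls2.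
  apply: sub_count => x /andP[bx cx]; rewrite /P /path_bound cx andbT.
  by move: b0b bx => /andP[l _]; rewrite c0i; apply: leq_trans.
have : b \notin minimal_set by apply: noX.
rewrite inE /J tb bi /= negb_forall => /existsP[b']; rewrite negb_imply.
move=> /andP[/andP[/andP[tb' b'i] b'b] nb'b].
have [c0 [q [c0s c0i c0q lq]]] := path_start b'.
have [q' b'q' lq'] := nested_path b'b.
have dq : dyck_path c0 (q ++ q' ++ s2).
  by rewrite /dyck_path c0s !cat_path c0q lq b'q' lq' bs2 !last_cat lq lq' ls2.
have := adm _ _ dq; rewrite /= !last_cat lq lq' ls2.
have -> : path_bound c0 (last b0 p) i = true.
  by have := Pge i (leqnn i); rewrite Pi /path_bound c0i b'i => <-.
rewrite (eq_in_count (a2 := P)) => [|x /i_le ix]; last first.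
  by rewrite Pge // /path_bound c0i (leq_trans b'i).
rewrite add1n => h; rewrite -ltnS; apply: leq_trans h.
rewrite -cat_cons !big_cat /= [X in (X < _)%N]big_cons.
have h1 : (0 < \sum_(c <- c0 :: q) t c)%N.
  by apply: leq_trans tb' _; apply: leq_sum_mem; rewrite -lq mem_last.
have h2 : (t b <= \sum_(c <- q') t c)%N.
  apply: leq_sum_mem; rewrite -lq'; case: q' lq' {b'q' dq} => [e'|c q' _].
    by rewrite -e' eqxx in nb'b.
  by rewrite /= mem_last.
by rewrite addnA ltn_add2r -add1n leq_add.
Qed.

End Step.

Lemma minkowski ks t : sorted leq ks -> (forall x, x \in ks -> (x <= n)%N) ->
  admissible ks t -> exists As : seq {set posroot n}, [/\ size As = size ks,
    forall j, (j < size ks)%N -> forall b, b \in nth finset.set0 As j ->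
      [/\ (ri b <= nth 0 ks j)%N, (nth 0 ks j <= rq b)%N
        & forall b', b' \in nth finset.set0 As j -> nested b b' -> b = b']
  & forall b, t b = \sum_(X <- As) (b \in X)]%N.
Proof.
elim: ks t => [|i ks IH] t ks_sorted ksn adm.
  (* Without weights all bounds are 0, and every root lies on some Dyck path. *)
  exists [::]; split=> // b; rewrite big_nil.
  have [b0 [p [b0s _ b0p lp]]] := path_start b; have [p' [bp' lor]] := path_end b.
  have dp : dyck_path b0 (p ++ p').
    rewrite /dyck_path b0s cat_path b0p lp bp' last_cat lp.
    by case: lor => -[-> _]; rewrite ?orbT.
  have /admissibleE/(_ _ _ dp)/= := adm; rewrite leqn0 => /eqP s0.
  have : (t b <= \sum_(c <- b0 :: p ++ p') t c)%N.
    by apply: leq_sum_mem; rewrite -cat_cons mem_cat -lp mem_last.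
  by rewrite s0 leqn0 => /eqP.
have i_le : forall x, x \in ks -> (i <= x)%N.
  by apply/allP; apply: order_path_min ks_sorted; apply: leq_trans.
have i_n : (i <= n)%N by apply: ksn; rewrite mem_head.
have [|As [sA hA tA]] := IH _ (path_sorted ks_sorted) _ (admissible_sub i_le i_n adm).
  by move=> x xks; apply: ksn; rewrite inE xks orbT.
exists (minimal_set i t :: As); split=> [|[_|j jks]|b]; first by rewrite /= sA.
- exact: minimal_setP i_le i_n adm.
- exact: hA.
by rewrite big_cons -tA subnKC // minimal_set_pos.
Qed.

End Minkowski.

(** * The basis *)

Lemma seq_max_exists (R : realDomainType) (T : eqType) (f : T -> R) (s : seq T) x0 :
  x0 \in s -> exists2 x, x \in s & forall y, y \in s -> f y <= f x.
Proof.
elim: s x0 => // x s IH _ _; case: s IH => [_|y s IH].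
  by exists x; rewrite ?mem_head // => y; rewrite inE => /eqP ->.
have [z zs zmax] := IH y (mem_head _ _).
have [le|/ltW le] := lerP (f x) (f z).
  exists z; rewrite 1?inE ?zs ?orbT // => w; rewrite inE => /orP[/eqP -> //|/zmax //].
exists x; rewrite ?mem_head // => w; rewrite inE => /orP[/eqP -> //|/zmax h].
exact: le_trans h le.
Qed.

Lemma span_uniq (K : fieldType) (V : lmodType K) (I : choiceType) (P : set I) (f : I -> V) v :
  v \in span (f @` P)%classic -> exists l (c : I -> K),
  [/\ uniq l, forall i, i \in l -> P i & v = \sum_(i <- l) c i *: f i].
Proof.
move=> /asboolP[k [a [w [wA ->]]]].
have /choice[g gP] : forall i, exists x, P x /\ f x = w i.
  by move=> i; have [x Px fx] := wA i; exists x.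
pose l := undup [seq g i | i <- enum 'I_k].
exists l, (fun x => \sum_(i | g i == x) a i); split; first exact: undup_uniq.
  by move=> x; rewrite mem_undup => /mapP[i _ ->]; have [] := gP i.
under [RHS]eq_bigr => x _ do rewrite scaler_suml big_mkcond.
rewrite exchange_big; apply: eq_bigr => i _ /=.
have gl : g i \in l by rewrite mem_undup map_f // mem_enum.
rewrite (bigD1_seq _ gl (undup_uniq _)) /= eqxx big1 ?addr0; first by rewrite (gP i).2.
by move=> x xg; rewrite eq_sym (negPf xg).
Qed.

Section Basis.
Variables (R : realType) (n : nat) (e : seq (posroot n)) (lam : 'I_n -> nat).
Hypothesis e_enum : perm_eq e (enum {: posroot n}).
Local Notation C := R[i].
Variables (V : lie_rep (sp C n)) (nu : V).
Hypotheses (V_irr : irreducible_rep V) (nu_hw : highest_weight_vector lam nu).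
Variable d : posroot n -> R.
Hypothesis d_cone : in_cone d.

Local Notation S := (FFLV_points R lam).
Local Notation g t := (fword (mono_word e t) nu).
Local Notation k := (block_size (ks := blocks lam)).
Local Notation hw := (hw_tensor C n k).
Local Notation word w := (fword (E := tensor_rep C n k) w hw).
Implicit Types (w : seq (posroot n)) (t : {ffun posroot n -> nat}).

Lemma detecting_index t : S t -> exists I : multi n k,
  0 < word (mono_word e t) I /\ forall w, word w I != 0 ->
  forall d' : posroot n -> R, in_cone d' -> deg d' (mono_word e t) <= deg d' w.
Proof.
move=> /FFLV_admissible adm.
have bn x : x \in blocks lam -> (x <= n)%N by move=> /blocks_range/andP[].
have [As [sA hA tA]] := minkowski (blocks_sorted lam) bn adm.
pose A (j : 'I_(size (blocks lam))) := nth finset.set0 As j.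
have anti : antichains k A by move=> j b bA; apply: hA.
have cnt b : count_mem b (mono_word e t) = (\sum_j (b \in A j))%N.
  by rewrite count_mono_word // tA (big_nth finset.set0) sA big_mkord.
exists (antichain_index k A); split.
  exact: (antichain_value R (@block_size_le n lam) anti cnt).
by move=> w wI d' d'c; apply: (antichain_minimal (@block_size_le n lam) anti cnt wI).
Qed.

Lemma transfer_seq (r : seq (C * seq (posroot n))) :
  \sum_(p <- r) p.1 *: fword p.2 nu = 0 -> \sum_(p <- r) p.1 *: word p.2 = 0.
Proof.
rewrite !(big_tnth _ _ r) => h.
exact: (transfer_linear (@block_size_le n lam) (weight_blocks lam) nu_hw h).
Qed.

(* Evaluating at the index detecting a term of maximal inner degree among those
   of degree larger than all [w i] would leave just this term. *)
Lemma degree_bound (l : seq {ffun posroot n -> nat}) (c : {ffun posroot n -> nat} -> C)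
    q (a : 'I_q -> C) (w : 'I_q -> seq (posroot n)) :
  uniq l -> (forall t, t \in l -> S t) ->
  \sum_(t <- l) c t *: g t = \sum_i a i *: fword (w i) nu ->
  forall t, t \in l -> c t != 0 -> exists i, deg d (mono_word e t) <= deg d (w i).
Proof.
move=> lu lS rel t0 t0l ct0; apply: contrapT => /forallNP t0bad.
pose bad t := (c t != 0) && [forall i, deg d (w i) < deg d (mono_word e t)].
have t0b : t0 \in filter bad l.
  rewrite mem_filter t0l andbT /bad ct0; apply/forallP => i.
  by rewrite ltNge; apply/negP/t0bad.
have [s sl smax] := seq_max_exists (fun t => deg (@inner R n) (mono_word e t)) t0b.
move: sl; rewrite mem_filter => /andP[/andP[cs /forallP sw] sl].
have [I [Ipos Imin]] := detecting_index (lS _ sl).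
have : \sum_(p <- [seq (c t, mono_word e t) | t <- l] ++ [seq (- a i, w i) | i <- index_enum 'I_q])
    p.1 *: fword p.2 nu = 0.
  rewrite big_cat !big_map /= rel; under [X in _ + X]eq_bigr do rewrite scaleNr.
  by rewrite sumrN subrr.
move=> /transfer_seq; rewrite big_cat !big_map /=.
move=> /(congr1 (fun phi : tensor C n k => phi I)).
rewrite ffunE !sum_ffunE [X in _ + X = _]big1 => [|i _]; last first.
  rewrite ffunE; have [->|/Imin/(_ _ d_cone) le] := eqVneq (word (w i) I) 0.
    by rewrite scaler0.
  by have := sw i; rewrite ltNge le.
rewrite addr0 (bigD1_seq s) //= big1_seq => [|t /andP[ts tl]].
  rewrite addr0 !ffunE => /eqP; rewrite mulf_eq0 (negPf cs) /= => /eqP I0.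
  by move: Ipos; rewrite I0 ltxx.
rewrite ffunE; have [->|tI] := eqVneq (word (mono_word e t) I) 0; first by rewrite scaler0.
have [->|ct] := eqVneq (c t) 0; first by rewrite scale0r.
have tb : t \in filter bad l.
  rewrite mem_filter tl andbT /bad ct; apply/forallP => i.
  by apply: lt_le_trans (sw i) (Imin _ tI _ d_cone).
(* At every point of the cone [t] has at least the degree of [s]; maximality gives equality at
   [inner], hence the same monomial. *)
have st : perm_eq (mono_word e s) (mono_word e t).
  apply: (@deg_separated R) => [d' d'c|]; first exact: Imin tI _ d'c.
  by apply/eqP; rewrite eq_le smax // andbT; apply: Imin tI _ (@inner_cone R n).
case/eqP: ts; apply/ffunP => b.
by rewrite -(count_mono_word e_enum t) -(count_mono_word e_enum s); move/seq.permP: st => ->.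
Qed.

(** The expansion of [w] given by [admissible_span] is itself a relation with one word on the right,
    so [degree_bound] controls the degrees occurring in it. *)
Lemma fword_degree_span w : fword w nu \in
  span [set v | exists2 t, S t /\ deg d (mono_word e t) <= deg d w & v = g t]%classic.
Proof.
have : fword w nu \in span ((fun t => g t) @` S)%classic.
  have := admissible_span e_enum V_irr nu_hw w.
  apply: (span_ind (W := span _)) => _ [t tS ->]; apply: span_mem.
  by exists t => //; apply/FFLV_admissible.
move=> /span_uniq[l [c [lu lS wE]]]; rewrite wE big_seq rpred_sum // => t tl.
have [->|ct] := eqVneq (c t) 0; first by rewrite scale0r rpred0.
rewrite rpredZ //; apply: span_mem; exists t => //; split; first exact: lS.
have rel : \sum_(t <- l) c t *: g t = \sum_(i < 1) 1 *: fword w nu.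
  by rewrite big_ord1 scale1r wE.
by have [] := degree_bound lu lS rel tl ct.
Qed.

Lemma Vact_root_word w : Vact (R := R) (V := V) (root_word R w) nu = fword w nu.
Proof.
elim: w => [|b w IH].
  by rewrite /root_word big_nil; apply: (@uea_act1 _ _ _ (nminus_rep V)).
rewrite /root_word big_cons -/(root_word R w).
transitivity (@uea_act _ _ _ (nminus_rep V) (root_gen R b) (Vact (root_word R w) nu)).
  exact: (@uea_actM _ _ _ (nminus_rep V)).
by rewrite IH /root_gen uea_act_gen /= -mact_rho.
Qed.

Lemma pbw_monomialE t : pbw_monomial R e t = root_word R (mono_word e t).
Proof.
rewrite /root_word /mono_word big_flatten big_map; apply: eq_bigr => b _.
by rewrite big_nseq -Monoid.iteropE.
Qed.

Lemma degreeE t : degree d t = deg d (mono_word e t).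
Proof. by rewrite deg_count; apply: eq_bigr => b _; rewrite count_mono_word. Qed.

Lemma gr_monomial_nu_word t :
  gr_monomial_nu d nu e t = gr_in (Vfilt d nu) (deg d (mono_word e t)) (g t).
Proof.
by rewrite gr_monomial_nuE // addr0 degreeE pbw_monomialE Vact_root_word.
Qed.

Lemma orbit_words (P : seq (posroot n) -> Prop) v :
  v \in image_space (nu_orbit (R := R) nu)
          (span [set u | exists2 w, P w & u = root_word R w]%classic) ->
  exists q (a : 'I_q -> C) (f : 'I_q -> seq (posroot n)),
  (forall i, P (f i)) /\ v = \sum_i a i *: fword (f i) nu.
Proof.
move=> /asboolP[u /asboolP[q [a [r [rA ->]]]] ->].
have /choice[f fP] : forall i, exists w, P w /\ r i = root_word R w.
  by move=> i; have [w Pw ->] := rA i; exists w.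
exists q, a, f; split=> [i|]; first by have [] := fP i.
rewrite linear_sum; apply: eq_bigr => i _; rewrite linearZ /=; congr (_ *: _).
by rewrite (fP i).2; apply: Vact_root_word.
Qed.

Lemma fword_Vle m w : deg d w <= m -> fword w nu \in Vle d nu m.
Proof.
move=> wm; rewrite -Vact_root_word -[X in X \in _]/(nu_orbit nu _); apply: image_mem.
by apply: span_mem; exists w.
Qed.

Lemma fword_Vlt m w : deg d w < m -> fword w nu \in Vlt d nu m.
Proof.
move=> wm; rewrite -Vact_root_word -[X in X \in _]/(nu_orbit nu _); apply: image_mem.
by apply: span_mem; exists w.
Qed.

Local Notation grV := (gr (Vfilt d nu)).

Lemma component_linear m (a : C) (x y : grV) :
  component (a *: x + y) m = a *: component x m + component y m.
Proof. by []. Qed.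

Lemma component_sum (J : Type) (r : seq J) (c : J -> C) (f : J -> grV) m :
  component (\sum_(j <- r) c j *: f j) m = \sum_(j <- r) c j *: component (f j) m.
Proof.
elim: r => [|j r IH]; first by rewrite !big_nil.
by rewrite !big_cons component_linear IH.
Qed.

Lemma gr_class_sum m (J : eqType) (r : seq J) (c : J -> C) (f : J -> V) :
  (forall j, j \in r -> f j \in Vle d nu m) ->
  gr_class (Vfilt d nu) m (\sum_(j <- r) c j *: f j) =
  \sum_(j <- r) c j *: gr_class (Vfilt d nu) m (f j).
Proof.
elim: r => [_|j r IH fV].
  by rewrite !big_nil; apply/gr_class_eq0; [exact: rpred0|exact: rpred0].
have fj : f j \in Vle d nu m by apply: fV; rewrite mem_head.
have fr i : i \in r -> f i \in Vle d nu m by move=> ir; apply: fV; rewrite inE ir orbT.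
rewrite !big_cons -IH // -gr_class_linear // big_seq rpred_sum // => i ir.
by rewrite rpredZ // fr.
Qed.

Lemma gr_in_sum m (J : finType) (c : J -> C) (f : J -> V) :
  (forall j, f j \in Vle d nu m) ->
  gr_in (Vfilt d nu) m (\sum_j c j *: f j) = \sum_j c j *: gr_in (Vfilt d nu) m (f j).
Proof.
move=> fV; apply: val_inj; apply: famP => m'.
rewrite -[LHS]/(component (gr_in _ _ _) m') -[RHS]/(component _ m') component_sum.
under [RHS]eq_bigr do rewrite gr_inE.
rewrite gr_inE; case: eqP => [->|_].
  by apply: gr_class_sum => j _; apply: fV.
by rewrite big1 // => j _; rewrite scaler0.
Qed.

Lemma gr_decomp (x : grV) : exists s : seq R,
  x = \sum_(m <- s) gr_in (Vfilt d nu) m (gr_rep (component x m)).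
Proof.
have /asboolP/finite_seqP[s sE] := valP x.
exists (undup s); apply: val_inj; apply: famP => m.
rewrite -[LHS]/(component x m) -[RHS]/(component _ m).
under [in RHS]eq_bigr do rewrite -[gr_in _ _ _]scale1r.
rewrite component_sum; under eq_bigr do rewrite scale1r gr_inE.
have [ms|ms] := boolP (m \in undup s).
  rewrite (bigD1_seq m) ?undup_uniq //= eqxx gr_class_rep big1 ?addr0 // => m' m'm.
  by rewrite eq_sym (negPf m'm).
rewrite big1_seq => [|m' /andP[_ m's]]; last by case: eqP m's ms => [->->|//].
apply: contrapT => xm; case/negP: ms; rewrite mem_undup.
have : [set` s]%classic m by rewrite -sE.
by [].
Qed.

Lemma gr_spanning (x : grV) : x \in span ((gr_monomial_nu d nu e) @` S)%classic.
Proof.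
have [s ->] := gr_decomp x; rewrite rpred_sum // => m _.
have [q [a [w [wm ->]]]] := orbit_words (gr_rep_mem (component x m)).
have {}wm i : deg d (w i) <= m := wm i.
rewrite gr_in_sum => [|i]; last exact: fword_Vle (wm i).
rewrite rpred_sum // => i _; rewrite rpredZ //.
have /asboolP[q' [a' [v [vA ->]]]] := fword_degree_span (w i).
rewrite gr_in_sum => [|j]; last first.
  by have [t [_ tw] ->] := vA j; exact: fword_Vle (le_trans tw (wm i)).
rewrite rpred_sum // => j _; rewrite rpredZ //.
have [t [tS tw] ->] := vA j.
have := le_trans tw (wm i); rewrite le_eqVlt => /orP[/eqP <-|tm].
  by rewrite -gr_monomial_nu_word; apply: span_mem; exists t.
(* A term of degree below [m] has class zero in degree [m]. *)
suff -> : gr_in (Vfilt d nu) m (g t) = 0 by rewrite rpred0.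
apply: val_inj; apply: famP => m'.
rewrite -[LHS]/(component (gr_in _ _ _) m') gr_inE; case: eqP => // ->.
by apply/gr_class_eq0; [apply/fword_Vle/ltW|apply: fword_Vlt].
Qed.

(** The degree [m] part of the relation puts a combination of monomials of degree [m] into [Vlt],
    hence equates it with a combination of words of degree less than [m], against [degree_bound]. *)
Lemma gr_independent (l : seq {ffun posroot n -> nat}) (c : {ffun posroot n -> nat} -> C) :
  uniq l -> (forall t, t \in l -> S t) ->
  \sum_(t <- l) c t *: gr_monomial_nu d nu e t = 0 -> forall t, t \in l -> c t = 0.
Proof.
move=> lu lS rel s sl; apply/eqP/negPn/negP => cs.
pose m := deg d (mono_word e s); pose l' := [seq t <- l | deg d (mono_word e t) == m].
have l'V t : t \in l' -> g t \in Vle d nu m.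
  by rewrite mem_filter => /andP[/eqP tm _]; apply: fword_Vle; rewrite tm.
have : gr_class (Vfilt d nu) m (\sum_(t <- l') c t *: g t) = 0.
  rewrite gr_class_sum // big_filter big_mkcond.
  have := congr1 (fun x : grV => component x m) rel.
  rewrite component_sum => h; rewrite -[RHS]/(component (0 : grV) m) -h.
  apply: eq_bigr => t _; rewrite gr_monomial_nu_word gr_inE eq_sym.
  by case: eqP => [//|_]; rewrite scaler0.
move=> /gr_class_eq0 h.
have /orbit_words[q [a [w [wm relV]]]] : \sum_(t <- l') c t *: g t \in Vlt d nu m.
  apply: h; rewrite big_seq rpred_sum // => t tl; rewrite rpredZ //; exact: l'V.
have l'u : uniq l' by rewrite filter_uniq.
have l'S t : t \in l' -> S t by rewrite mem_filter => /andP[_ /lS].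
have sl' : s \in l' by rewrite mem_filter eqxx sl.
have [i le] := degree_bound l'u l'S relV sl' cs.
have lt : deg d (w i) < m := wm i.
by move: lt; rewrite ltNge le.
Qed.

End Basis.

Theorem theorem1p2 (R : realType) (n : nat) (n_gt0 : (0 < n)%N)
  (e : seq (posroot n)) (e_enum : perm_eq e (enum {: posroot n}))
  (lam : 'I_n -> nat) (V : lie_rep (sp R[i] n)) (nu : V)
  (V_irr : irreducible_rep V) (nu_hw : highest_weight_vector lam nu)
  (d : posroot n -> R) (d_cone : in_cone d) :
  is_basis (FFLV_points R lam) (gr_monomial_nu d nu e).
Proof.
split; first by move=> l c; apply: gr_independent.
exact: gr_spanning.
Qed.
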